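(* Let $\mathcal{K}$ be a locally trace class orthogonal projection on $L^2(S,\lambda)$ with kernel $K$, and let $\{\Lambda^{(n)}\}_{n\in\mathbb{N}}$ be an exhaustion of $S$. Assume that the determinantal point process associated to $\mathcal{K}$ is hyperuniform along this exhaustion. Let $\rho_{\Lambda^{(n)}}$ be the accumulated spectrogram associated to $(\mathcal{K},\Lambda^{(n)})$ and $N_{\Lambda^{(n)}}$ the upper integer part of $\mathrm{Tr}(\mathcal{P}_{\Lambda^{(n)}}\mathcal{K}\mathcal{P}_{\Lambda^{(n)}})$. Then $$\lim_{n\to+\infty}\frac{1}{N_{\Lambda^{(n)}}}\int_S\left|\rho_{\Lambda^{(n)}}(x)-K(x,x)\mathbf{1}_{\Lambda^{(n)}}(x)\right|d\lambda(x)=0.$$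
   Context: Setting. $S$ is a locally compact, complete, separable metric space and $\lambda$ a Radon measure on $S$. $L^2(S,\lambda)$ is the complex Hilbert space with inner product $\langle f,g\rangle=\int_S f\overline{g}\,d\lambda$. For a bounded Borel set $\Lambda\subset S$, $\mathcal{P}_\Lambda f=\mathbf{1}_\Lambda f$. An operator $\mathcal{K}$ on $L^2(S,\lambda)$ is locally trace class if $\mathcal{P}_\Lambda\mathcal{K}\mathcal{P}_\Lambda$ is trace class for every bounded Borel $\Lambda\subset S$; such an operator has a kernel $K$, i.e. $\mathcal{K}f(x)=\int_S K(x,y)f(y)\,d\lambda(y)$. If $\mathcal{K}$ is a locally trace class orthogonal projection onto a closed subspace $L\subset L^2(S,\lambda)$, fix a Borel set $S_0\subset S$ with $\lambda(S\setminus S_0)=0$ on which all functions of $L$ are defined pointwise; the kernel and the pointwise values are taken so that, writing $K_x(y)=K(y,x)$, one has $K_x\in L$ and $f(x)=\langle f,K_x\rangle$ for all $f\in L$, $x\in S_0$. In particular $K(x,y)=\overline{K(y,x)}$ and $\int_S K(x,y)K(y,z)\,d\lambda(y)=K(x,z)$ on $S_0$. Accumulated spectrogram. For a bounded Borel set $\Lambda$, let $\mathcal{M}_\Lambda=\mathcal{P}_\Lambda\mathcal{K}\mathcal{P}_\Lambda$, with spectral decomposition $\mathcal{M}_\Lambda f=\sum_{j\ge1}\mu_j^{(\Lambda)}\langle f,\Phi_j^{(\Lambda)}\rangle\Phi_j^{(\Lambda)}$, where $1\ge\mu_1^{(\Lambda)}\ge\mu_2^{(\Lambda)}\ge\dots\ge0$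 are the eigenvalues counted with multiplicity and the $\Phi_j^{(\Lambda)}$ are corresponding orthonormal eigenfunctions (a finite sequence if $L^2(S,\lambda)$ is finite-dimensional). Let $\mathcal{N}_\Lambda=\mathcal{K}\mathcal{P}_\Lambda$, with polar decomposition $\mathcal{N}_\Lambda=\mathcal{W}_\Lambda\sqrt{\mathcal{M}_\Lambda}$, where $\mathcal{W}_\Lambda(\sqrt{\mathcal{M}_\Lambda}f)=\mathcal{N}_\Lambda f$ (extended by continuity to the closure of the range) and $\mathcal{W}_\Lambda=0$ on $\ker\mathcal{M}_\Lambda=\ker\mathcal{N}_\Lambda$. Put $\Psi_j^{(\Lambda)}=\mathcal{W}_\Lambda\Phi_j^{(\Lambda)}\in L$, so that $\mathcal{N}_\Lambda\Phi_j^{(\Lambda)}=\sqrt{\mu_j^{(\Lambda)}}\,\Psi_j^{(\Lambda)}$. Let $N_\Lambda$ be the upper integer part (ceiling) of $\mathrm{Tr}(\mathcal{M}_\Lambda)$. The accumulated spectrogram associated to $(\mathcal{K},\Lambda)$ is $\rho_\Lambda(x)=\sum_{j=1}^{N_\Lambda}|\Psi_j^{(\Lambda)}(x)|^2$, $x\in S_0$. Any fixed choice of eigenfunctions is allowed. Exhaustion. A family $\{\Lambda^{(n)}\}_{n\in\mathbb{N}}$ of relatively compact Borel subsets of $S$ with $\Lambda^{(n)}\subset\Lambda^{(n+1)}$ for all $n$ and $\bigcup_n\Lambda^{(n)}=S$. Point processes. A configuration $\Xi$ is a non-negative-integer-valued Radon measure on $S$; it is simple if $\Xi(\{x\})\in\{0,1\}$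 for all $x$. A (simple) point process $\mathbb{P}$ is a probability measure on the space of configurations (supported on simple configurations); $\mathbb{E}$ and $\mathrm{var}$ denote expectation and variance under $\mathbb{P}$. The $n$-th correlation function $\rho_n$ (with respect to $\lambda^{\otimes n}$) is defined by $\mathbb{E}\big[\sum^*_{x_1,\dots,x_n\in\mathrm{supp}\,\Xi}f(x_1,\dots,x_n)\big]=\int_{S^n}f\rho_n\,d\lambda^{\otimes n}$ for all measurable compactly supported $f$, the sum being over pairwise distinct points. The determinantal point process associated to $\mathcal{K}$ is the simple point process with $\rho_n(x_1,\dots,x_n)=\det(K(x_i,x_j))_{i,j=1}^n$ for all $n$; it is known to exist for every locally trace class orthogonal projection. It is hyperuniform along $\{\Lambda^{(n)}\}$ if $\mathbb{E}[\Xi(\Lambda^{(n)})]\to\infty$ and $\mathrm{var}(\Xi(\Lambda^{(n)}))/\mathbb{E}[\Xi(\Lambda^{(n)})]\to0$ as $n\to\infty$. *)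

(* Defs.v *)
From HB Require Import structures.
From mathcomp Require Import all_boot all_order all_algebra.
From mathcomp Require Import complex.
From mathcomp Require Import all_classical all_reals all_analysis
  measurable_realfun.

Set Implicit Arguments.
Unset Strict Implicit.
Unset Printing Implicit Defensive.

Import Order.TTheory GRing.Theory Num.Theory.
Import numFieldNormedType.Exports.

Notation normc := ComplexField.Normc.normc.

Local Open Scope classical_set_scope.
Local Open Scope complex_scope.
Local Open Scope ring_scope.

(* The complex Hilbert space L^2(T, mu) is handled as a setoid: its elements are
   the square-integrable functions T -> R[i], and equality is a.e. equality. *)
Section ComplexL2.
Context d (T : measurableType d) (R : realType).
Variable mu : {measure set T -> \bar R}.
Implicit Types (f g : T -> R[i]) (A B : (T -> R[i]) -> (T -> R[i])).

Definition cmeasurable d' (U : measurableType d') (f : U -> R[i]) : Prop :=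
  measurable_fun [set: U] (fun x => complex.Re (f x)) /\
  measurable_fun [set: U] (fun x => complex.Im (f x)).

Definition cintegral f : R[i] :=
  (\int[mu]_x complex.Re (f x)) +i* (\int[mu]_x complex.Im (f x)).

Definition L2 : set (T -> R[i]) :=
  [set f | cmeasurable f /\ (\int[mu]_x (normc (f x) ^+ 2)%:E < +oo)%E].

Definition aeeq f g : Prop := ae_eq mu [set: T] f g.

Definition dotp f g : R[i] := cintegral (fun x => f x * conjc (g x)).

Definition norm2 f : R := \int[mu]_x (normc (f x) ^+ 2).

(* convergence in L^2, stated with squared norms *)
Definition L2_cvg (u : nat -> T -> R[i]) f : Prop :=
  norm2 (fun x => u n x - f x) @[n --> \oo] --> (0 : R).

Definition bounded_operator A : Prop :=
  [/\ forall f, L2 f -> L2 (A f),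
      forall f g, L2 f -> L2 g -> aeeq f g -> aeeq (A f) (A g),
      forall (a : R[i]) f g, L2 f -> L2 g ->
        aeeq (A (fun x => a * f x + g x)) (fun x => a * A f x + A g x)
    & exists c : R, forall f, L2 f -> norm2 (A f) <= c * norm2 f].

Definition positive_operator A : Prop :=
  bounded_operator A /\ forall f, L2 f -> 0 <= dotp (A f) f.

Definition closed_subspace (L : set (T -> R[i])) : Prop :=
  [/\ L `<=` L2,
      forall f g, L f -> L2 g -> aeeq f g -> L g,
      L (fun=> 0),
      forall (a : R[i]) f g, L f -> L g -> L (fun x => a * f x + g x)
    & forall (u : nat -> T -> R[i]) f,
        (forall n, L (u n)) -> L2 f -> L2_cvg u f -> L f].

Definition orthogonal_projection (L : set (T -> R[i])) A : Prop :=
  [/\ closed_subspace L, bounded_operator A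
    & forall f, L2 f ->
        L (A f) /\ forall g, L g -> dotp (fun x => f x - A f x) g = 0].

(* orthonormal families indexed by a set D of natural numbers, so that the
   finite-dimensional and the separable infinite-dimensional cases are both
   covered *)
Definition orthonormal (D : set nat) (e : nat -> T -> R[i]) : Prop :=
  (forall j, D j -> L2 (e j)) /\
  (forall i j, D i -> D j -> dotp (e i) (e j) = (i == j)%:R).

Definition complete_system (D : set nat) (e : nat -> T -> R[i]) : Prop :=
  forall f, L2 f -> (forall j, D j -> dotp f (e j) = 0) -> aeeq f (fun=> 0).

Definition hilbert_basis (D : set nat) (e : nat -> T -> R[i]) : Prop :=
  orthonormal D e /\ complete_system D e.

(* B = |A| = sqrt(A^* A): B is positive and <B^2 f, g> = <A^* A f, g>. *)
Definition absolute_value A B : Prop :=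
  positive_operator B /\
  forall f g, L2 f -> L2 g -> dotp (B f) (B g) = dotp (A f) (A g).

Definition square_root A B : Prop :=
  positive_operator B /\ forall f, L2 f -> aeeq (B (B f)) (A f).

(* \sum_j <|A| e_j, e_j> < +oo for some (equivalently, every) Hilbert basis *)
Definition trace_class A : Prop :=
  bounded_operator A /\
  exists B D e, [/\ absolute_value A B, hilbert_basis D e
    & (\esum_(j in D) (complex.Re (dotp (B (e j)) (e j)))%:E < +oo)%E].

(* the common value of \sum_j <A e_j, e_j> over all Hilbert bases *)
Definition trace A : R[i] :=
  xget 0 [set t : R[i] | forall D e, hilbert_basis D e ->
    normc (\sum_(0 <= j < n | j \in D) dotp (A (e j)) (e j) - t)
      @[n --> \oo] --> (0 : R)].

Definition restrict_op (X : set T) f : T -> R[i] := fun x => (\1_X x)%:C * f x.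

Definition compression (K : (T -> R[i]) -> (T -> R[i])) (X : set T) :=
  fun f => restrict_op X (K (restrict_op X f)).

(* k is a kernel of the projection K onto L, and S0 a set of full measure on
   which the elements of L are evaluated pointwise: the value of f in L at x in
   S0 is <f, k_x>, where k_x(y) = k y x. In particular the last condition says
   that the value of k_x at y is k y x. *)
Definition reproducing_kernel (L : set (T -> R[i]))
    (K : (T -> R[i]) -> (T -> R[i])) (k : T -> T -> R[i]) (S0 : set T) : Prop :=
  [/\ cmeasurable (fun p : T * T => k p.1 p.2),
      measurable S0 /\ mu (~` S0) = 0%E,
      forall f, L2 f -> aeeq (K f) (fun x => cintegral (fun y => k x y * f y)),
      forall x, S0 x -> L (k^~ x)
    & (forall f, L f -> aeeq f (fun x => dotp f (k^~ x))) /\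
      (forall x y, S0 x -> S0 y -> k y x = dotp (k^~ x) (k^~ y))].

Definition evaluation (k : T -> T -> R[i]) f : T -> R[i] :=
  fun x => dotp f (k^~ x).

(* Spectral decomposition of the compression M of K to X and polar decomposition
   of N f = K (1_X f). The eigenvalues are indexed from 0; the index set is nat
   unless L^2 is finite-dimensional. *)
Record spectral_data (K : (T -> R[i]) -> (T -> R[i])) (X : set T) := {
  sd_index : set nat ;
  sd_eigval : nat -> R ;
  sd_eigfun : nat -> T -> R[i] ;
  sd_sqrt : (T -> R[i]) -> (T -> R[i]) ;
  sd_polar : (T -> R[i]) -> (T -> R[i]) ;
  sd_indexP : sd_index = [set: nat] \/
    (exists m, sd_index = `I_m) /\ complete_system sd_index sd_eigfun ;
  sd_orthonormal : orthonormal sd_index sd_eigfun ;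
  sd_eigval_bound : forall j, sd_index j -> 0 <= sd_eigval j <= 1 ;
  sd_eigval_noninc : forall i j, sd_index i -> sd_index j -> (i <= j)%N ->
    sd_eigval j <= sd_eigval i ;
  sd_eigen : forall j, sd_index j ->
    aeeq (compression K X (sd_eigfun j))
         (fun x => (sd_eigval j)%:C * sd_eigfun j x) ;
  sd_spectral : forall f, L2 f ->
    L2_cvg (fun n x => \sum_(0 <= j < n | j \in sd_index)
              (sd_eigval j)%:C * dotp f (sd_eigfun j) * sd_eigfun j x)
           (compression K X f) ;
  sd_sqrtP : square_root (compression K X) sd_sqrt ;
  sd_polar_bounded : bounded_operator sd_polar ;
  sd_polarP : forall f, L2 f ->
    aeeq (sd_polar (sd_sqrt f)) (K (restrict_op X f)) ;
  sd_polar_ker : forall f, L2 f -> aeeq (compression K X f) (fun=> 0) ->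
    aeeq (sd_polar f) (fun=> 0)
}.

Definition upper_trace (K : (T -> R[i]) -> (T -> R[i])) (X : set T) : nat :=
  `|Num.ceil (complex.Re (trace (compression K X)))|%N.

Definition acc_spectrogram (K : (T -> R[i]) -> (T -> R[i]))
    (k : T -> T -> R[i]) (X : set T) (s : spectral_data K X) (x : T) : R :=
  \sum_(0 <= j < upper_trace K X)
    normc (evaluation k (sd_polar s (sd_eigfun s j)) x) ^+ 2.

End ComplexL2.

#[short(type="completeMetricType")]
HB.structure Definition CompleteMetric (R : numDomainType) :=
  {T of Complete T & Metric R T}.

Definition separable_space (S : topologicalType) : Prop :=
  exists2 A : set S, countable A & dense A.

Definition borel (S : ptopologicalType) := g_sigma_algebraType (@open S).

Section Power.
Context d (T : measurableType d) (R : realType).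
Variables (m : {measure set T -> \bar R}) (m_sf : sigma_finite [set: T] m).

Definition sf_measure of sigma_finite [set: T] m : set T -> \bar R := m.
HB.instance Definition _ := Measure.on (sf_measure m_sf).
HB.instance Definition _ := Measure_isSigmaFinite.Build _ _ _
  (sf_measure m_sf) m_sf.

Definition tuple_cons n (p : n.-tuple T * T) : n.+1.-tuple T :=
  [the n.+1.-tuple T of p.2 :: p.1].

Lemma measurable_tuple_cons n : measurable_fun setT (@tuple_cons n).
Proof. exact: measurable_cons. Qed.

Definition power_step n (mu : {measure set (n.-tuple T) -> \bar R}) :
    set (n.+1.-tuple T) -> \bar R :=
  pushforward (mu \x sf_measure m_sf)%E (@tuple_cons n).

Section power_step_measure.
Context n (mu : {measure set (n.-tuple T) -> \bar R}).
Local Open Scope ereal_scope.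

Let power_step0 : power_step mu set0 = 0.
Proof. by rewrite /power_step /pushforward preimage_set0 measure0. Qed.

Let power_step_ge0 A : 0 <= power_step mu A.
Proof. exact: (measure_ge0 (mu \x sf_measure m_sf)). Qed.

Let power_step_sigma_additive : semi_sigma_additive (power_step mu).
Proof.
have mc := @measurable_tuple_cons n.
move=> F mF tF mUF; rewrite /power_step /pushforward preimage_bigcup.
apply: (measure_semi_sigma_additive (s := (mu \x sf_measure m_sf))).
- by move=> i; rewrite -[X in measurable X]setTI; exact: mc.
- apply/trivIsetP => /= i j _ _ ij; rewrite -preimage_setI.
  by move/trivIsetP : tF => /(_ _ _ _ _ ij) ->//; rewrite preimage_set0.
- by rewrite -preimage_bigcup -[X in measurable X]setTI; exact: mc.
Qed.

HB.instance Definition _ := isMeasure.Build _ _ _ (power_step mu)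
  power_step0 power_step_ge0 power_step_sigma_additive.

End power_step_measure.

(* the product measure m^{(x) n} on T^n, by recursion on n *)
Fixpoint power_measure n : {measure set (n.-tuple T) -> \bar R} :=
  match n return {measure set (n.-tuple T) -> \bar R} with
  | 0 => \d_([tuple])
  | n'.+1 => power_step (power_measure n')
  end.

End Power.

Section MetricMeasureSpace.
Context (R : realType) (S : completeMetricType R).

(* Radon = Borel and finite on compact sets; regularity is automatic on a
   locally compact separable metric space. *)
Definition radon (m : {measure set (borel S) -> \bar R}) : Prop :=
  forall A : set S, compact A -> (m A < +oo)%E.

Lemma compact_measurable (A : set S) :
  compact A -> measurable (A : set (borel S)).
Proof.
move=> cA; rewrite -(setCK A); apply: measurableC.
apply: sub_sigma_algebra; rewrite /= openC.
by apply: compact_closed => //; exact: metric_hausdorff.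
Qed.

Lemma radon_sigma_finite (m : {measure set (borel S) -> \bar R}) :
  separable_space S -> locally_compact [set: S] -> radon m ->
  sigma_finite [set: borel S] m.
Proof.
move=> [A cA dA] lc mfin.
have [f fA] : exists f : nat -> S, A `<=` range f.
  have [A0|[f]] := pfcard_geP cA.
    have [|x [_]] := dA setT _ openT; first by exists point.
    by rewrite A0.
  by exists f => x /(@surj _ _ _ _ f)[n _ <-]; exists n.
pose C (p : nat * nat) : set S := xget set0
  [set B : set S | compact B /\ ball (f p.1) p.2.+1%:R^-1 `<=` B].
have cC p : compact (C p).
  by rewrite /C; case: xgetP => [B _ []//|_]; exact: compact0.
pose F n := if unpickle n is Some p then C p else set0.
have cF n : compact (F n).
  by rewrite /F; case: unpickle => // *; exact: compact0.
exists F; last first.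
  by move=> n; split; [exact: compact_measurable|exact: mfin].
apply/esym; rewrite -subTset => x _.
have [B xB [cB _]] := lc x I.
have {xB} /nbhs_ballP[e /= e0 xeB] : nbhs x B.
  by move: xB; rewrite /within /=; apply: filterS => y; exact.
have [n ne] : exists n : nat, n.+1%:R^-1 < e / 2.
  have /ltr_add_invr[n] : 0 < e / 2 by rewrite divr_gt0.
  by rewrite add0r; exists n.
have n0 : 0 < n.+1%:R^-1 :> R by rewrite invr_gt0.
have [|a [/interior_subset xa /fA[p _ pa]]] :=
  dA _ _ (open_interior (ball x n.+1%:R^-1)); first by exists x; exact: nbhsx_ballx.
exists (pickle (p, n)) => //; rewrite /F pickleK /C.
case: xgetP => [D _ [_]|/(_ B) []].
  by apply; apply: ball_sym; rewrite pa.
split=> // z az; apply: xeB; rewrite /= in az.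
rewrite (splitr e); apply: (le_ball (ltW (ltrD ne ne))).
by apply: ball_triangle az; rewrite pa.
Qed.

Definition bounded_subset (A : set S) : Prop :=
  exists (x : S) (r : R), A `<=` ball x r.

Definition locally_trace_class (m : {measure set (borel S) -> \bar R})
    (K : (borel S -> R[i]) -> (borel S -> R[i])) : Prop :=
  forall A : set (borel S), measurable A -> bounded_subset A ->
    trace_class m (compression K A).

Definition exhaustion (A : nat -> set (borel S)) : Prop :=
  [/\ forall n, measurable (A n),
      forall n, precompact (A n : set S),
      forall n, A n `<=` A n.+1
    & \bigcup_n A n = [set: S]].

Definition config : Type :=
  {xi : {measure set (borel S) -> \bar R} | radon xi /\
    forall A : set (borel S), measurable A -> (xi A < +oo)%E ->
      exists n : nat, xi A = n%:R%:E}.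

Definition config_measure (xi : config) : {measure set (borel S) -> \bar R} :=
  sval xi.

Program Definition empty_config : config := exist _ mzero _.
Next Obligation.
by split=> [A _|A _ _]; [exact: ltry|exists 0%N].
Qed.

HB.instance Definition _ := gen_eqMixin config.
HB.instance Definition _ := gen_choiceMixin config.
HB.instance Definition _ := isPointed.Build config empty_config.

(* the configuration space, with the sigma-algebra generated by the maps
   xi |-> xi(A), A Borel *)
Definition config_space := g_sigma_algebraType
  (\bigcup_(A in (measurable : set (set (borel S))))
    preimage_set_system [set: config] (fun xi => config_measure xi A)
      (measurable : set (set (\bar R)))).

Definition simple_config (xi : config) : Prop :=
  forall x : S, config_measure xi [set x] = 0%E \/
                config_measure xi [set x] = 1%E.

Definition supp (xi : config) : set S :=
  [set x | forall U : set S, open U -> U x -> (0 < config_measure xi U)%E].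

Definition simple_point_process (P : probability config_space R) : Prop :=
  {ae P, forall xi, simple_config xi}.

(* r is the n-th correlation function of P; test functions are taken
   nonnegative, so that both sides make sense in [0, +oo]. *)
Definition correlation_function (m : {measure set (borel S) -> \bar R})
    (m_sf : sigma_finite [set: borel S] m) (P : probability config_space R)
    (n : nat) (r : n.-tuple (borel S) -> R) : Prop :=
  forall f : n.-tuple (borel S) -> R,
    measurable_fun [set: n.-tuple (borel S)] f ->
    (forall t, 0 <= f t) ->
    (exists2 C : set S, compact C &
       forall t, f t != 0 -> forall i, C (tnth t i)) ->
    (\int[P]_xi
        (\esum_(t in [set t : n.-tuple (borel S) |
                      uniq t /\ forall i, supp xi (tnth t i)]) (f t)%:E) =
     \int[power_measure m_sf n]_t (f t * r t)%:E)%E.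

(* det (k(x_i, x_j)) is real for almost every (x_1, ..., x_n) *)
Definition determinantal (m : {measure set (borel S) -> \bar R})
    (m_sf : sigma_finite [set: borel S] m) (k : borel S -> borel S -> R[i])
    (P : probability config_space R) : Prop :=
  simple_point_process P /\
  forall n, correlation_function m_sf P (fun t : n.-tuple (borel S) =>
    complex.Re (\det (\matrix_(i < n, j < n) k (tnth t i) (tnth t j)))).

Definition number_of_points (A : set (borel S)) : config_space -> R :=
  fun xi => fine (config_measure xi A).

Definition hyperuniform (P : probability config_space R)
    (A : nat -> set (borel S)) : Prop :=
  ('E_P[number_of_points (A n)] @[n --> \oo] --> +oo)%E /\
  ('V_P[number_of_points (A n)] *
     ((fine 'E_P[number_of_points (A n)])^-1)%:E @[n --> \oo] --> 0)%E.

End MetricMeasureSpace.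

(* Main.v *)
(* Write [M] for the compression of the projection to [X], [mu_j] for its
   eigenvalues, [T] for its trace and [V] for the variance of the number of
   points in [X]. The functions [u_j = |K (1_X phi_j)|^2] satisfy
   [u_j = mu_j |Psi_j|^2] and have integral [mu_j]; by Bessel their sum is at
   most [F x], the integral of [|k y x|^2] over [y] in [X]. The correlation
   functions of orders 1 and 2 give [T] as the integral of [k x x] over [X] and
   [V] as the integral of [F] over the complement of [X], which by symmetry is
   also the integral over [X] of [k x x - F x]. Replacing [k x x 1_X] by [F], [F]
   by the sum of the [u_j] with [j < N], and [u_j] by [|Psi_j|^2] costs in L^1
   at most [2 V], [T - A] and [N - A], where [A] is the sum of the first [N]
   eigenvalues. Since [V >= \sum mu_j (1 - mu_j) >= T - A], the total is at most
   [1 + 4 V], which is negligible with respect to [T <= N] by hyperuniformity.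
   Identifying [T] with the sum of the diagonal coefficients in an arbitrary
   complete orthonormal system requires Parseval, hence the completeness of L^2;
   [T] is finite because [M] is dominated by its absolute value. *)
Require Import Defs.
From mathcomp Require Import all_boot all_order all_algebra.
From mathcomp Require Import complex ring lra.
From mathcomp Require Import all_classical all_reals all_analysis
  measurable_realfun.

Set Implicit Arguments.
Unset Strict Implicit.
Unset Printing Implicit Defensive.

Import Order.TTheory GRing.Theory Num.Theory.
Import numFieldNormedType.Exports.

Local Open Scope classical_set_scope.
Local Open Scope complex_scope.
Local Open Scope ring_scope.

(** * Square-integrable complex functions *)

Section ComplexNumbers.
Variable R : realType.
Implicit Types z w : R[i].

(** With [N f = K (1_X f)], the function [F] is the diagonal of the kernel of [N N^*], that is of K
    1_X K, whose eigenfunctions are the [Psi_j] with eigenvalues [mu_j]. It is the right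
    intermediate term because every comparison with it has a known sign almost everywhere:
    [k x x - F x] is nonnegative on [X], partial sums of the [u_j] stay below [F], and
    [u_j <= |Psi_j|^2] since [mu_j <= 1]. Each L^1 distance is thus a difference of integrals, and
    only traces have to be computed. In [1 + 4 V], two [V] come from exchanging the kernel for [F],
    one from [T - A], and [N - A = (N - T) + (T - A)] gives the last one together with the 1 due to
    the ceiling. The obstacle is that the eigenfunctions need not span L^2, while the trace is
    defined by Hilbert bases and trace class by an absolute value known only through inner products.
    Sums over eigenfunctions are therefore bounded by Bessel alone, and the integral of [k x x] over
    [X] serves as the common value to which the trace, the eigenvalues and the expectation are all
    compared. *)

Lemma normc2E z : normc z ^+ 2 = complex.Re z ^+ 2 + complex.Im z ^+ 2.
Proof. by case: z => a b /=; rewrite sqr_sqrtr// addr_ge0// sqr_ge0. Qed.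

Lemma normc_ge0 z : 0 <= normc z.
Proof. by case: z => a b /=; exact: sqrtr_ge0. Qed.

Lemma mulcJ z : z * conjc z = (normc z ^+ 2)%:C.
Proof.
rewrite normc2E; case: z => a b /=.
by apply/eqP; rewrite eq_complex /=; apply/andP; split; apply/eqP; ring.
Qed.

Lemma cReM z w : complex.Re (z * w) =
  complex.Re z * complex.Re w - complex.Im z * complex.Im w.
Proof. by case: z w => a b [c d]. Qed.

Lemma cImM z w : complex.Im (z * w) =
  complex.Re z * complex.Im w + complex.Im z * complex.Re w.
Proof. by case: z w => a b [c d] /=; ring. Qed.

Lemma cReD z w : complex.Re (z + w) = complex.Re z + complex.Re w.
Proof. by case: z w => a b [c d]. Qed.

Lemma cImD z w : complex.Im (z + w) = complex.Im z + complex.Im w.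
Proof. by case: z w => a b [c d]. Qed.

Lemma cReJ z : complex.Re (conjc z) = complex.Re z.
Proof. by case: z. Qed.

Lemma cImJ z : complex.Im (conjc z) = - complex.Im z.
Proof. by case: z. Qed.

Lemma complex_eqP z w :
  complex.Re z = complex.Re w -> complex.Im z = complex.Im w -> z = w.
Proof. by case: z w => a b [c d] /= -> ->. Qed.

Lemma normc_conj z : normc (conjc z) = normc z.
Proof. by case: z => a b /=; rewrite sqrrN. Qed.

Lemma normc_real (r : R) : normc r%:C = `|r|.
Proof. by rewrite /= expr0n addr0 sqrtr_sqr. Qed.

Lemma realcV (r : R) : (r^-1)%:C = (r%:C)^-1 :> R[i].
Proof. exact: (fmorphV (real_complex R)). Qed.

Lemma realcM (r s : R) : (r * s)%:C = r%:C * s%:C :> R[i].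
Proof. exact: (rmorphM (real_complex R)). Qed.

Lemma realcN (r : R) : (- r)%:C = - r%:C :> R[i].
Proof. exact: (rmorphN (real_complex R)). Qed.

Lemma realcD (r s : R) : (r + s)%:C = r%:C + s%:C :> R[i].
Proof. exact: (rmorphD (real_complex R)). Qed.

Lemma conjc_realM (r : R) z : conjc (r%:C * z) = r%:C * conjc z.
Proof. by case: z => a b; apply: complex_eqP => /=; ring. Qed.

Lemma normc2_0 : normc (0 : R[i]) ^+ 2 = 0.
Proof. by rewrite ComplexField.Normc.normc0 expr0n. Qed.

Lemma normc2_eq0 z : normc z ^+ 2 = 0 -> z = 0.
Proof. by move/eqP; rewrite sqrf_eq0 => /eqP /ComplexField.Normc.eq0_normc. Qed.

Lemma normc2D z w : normc (z + w) ^+ 2 <= 2 * normc z ^+ 2 + 2 * normc w ^+ 2.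
Proof.
rewrite !normc2E cReD cImD.
have := sqr_ge0 (complex.Re z - complex.Re w).
have := sqr_ge0 (complex.Im z - complex.Im w).
nra.
Qed.

Lemma Re_le_normc z : `|complex.Re z| <= normc z.
Proof.
rewrite -(@ler_pXn2r _ 2)// ?nnegrE ?normc_ge0// normc2E real_normK ?num_real//.
by rewrite lerDl sqr_ge0.
Qed.

Lemma Im_le_normc z : `|complex.Im z| <= normc z.
Proof.
rewrite -(@ler_pXn2r _ 2)// ?nnegrE ?normc_ge0// normc2E real_normK ?num_real//.
by rewrite lerDr sqr_ge0.
Qed.

End ComplexNumbers.

Section ComplexMeasurable.
Context d (T : measurableType d) (R : realType).
Implicit Types f g : T -> R[i].

Lemma cmeasurable_cst (c : R[i]) : cmeasurable (fun _ : T => c).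
Proof. by split; exact: measurable_cst. Qed.

Lemma cmeasurableD f g :
  cmeasurable f -> cmeasurable g -> cmeasurable (fun x => f x + g x).
Proof.
move=> [f1 f2] [g1 g2]; split.
- by under eq_fun do rewrite cReD; exact: measurable_funD.
- by under eq_fun do rewrite cImD; exact: measurable_funD.
Qed.

Lemma cmeasurableM f g :
  cmeasurable f -> cmeasurable g -> cmeasurable (fun x => f x * g x).
Proof.
move=> [f1 f2] [g1 g2]; split.
- under eq_fun do rewrite cReM.
  by apply: measurable_funB; exact: measurable_funM.
- under eq_fun do rewrite cImM.
  by apply: measurable_funD; exact: measurable_funM.
Qed.

Lemma cmeasurableJ f : cmeasurable f -> cmeasurable (fun x => conjc (f x)).
Proof.
move=> [f1 f2]; split.
- by under eq_fun do rewrite cReJ.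
- under eq_fun do rewrite cImJ.
  exact: (@measurable_funN _ _ _ _ (fun x => complex.Im (f x))).
Qed.

Lemma cmeasurable_real (h : T -> R) :
  measurable_fun setT h -> cmeasurable (fun x => (h x)%:C).
Proof. by move=> mh; split => //=; exact: measurable_cst. Qed.

Lemma measurable_normc2 f : cmeasurable f ->
  measurable_fun setT (fun x => normc (f x) ^+ 2).
Proof.
move=> [f1 f2]; under eq_fun do rewrite normc2E.
by apply: measurable_funD; exact: measurable_funX.
Qed.

Lemma measurable_normc f : cmeasurable f ->
  measurable_fun setT (fun x => normc (f x)).
Proof.
move=> mf; have -> : (fun x => normc (f x)) =
    (fun x => Num.sqrt (normc (f x) ^+ 2)).
  by apply/funext => x; rewrite sqrtr_sqr ger0_norm// normc_ge0.
apply: (@measurableT_comp _ _ _ _ _ _ (@Num.sqrt R)); last exact: measurable_normc2.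
by apply: continuous_measurable_fun; exact: sqrt_continuous.
Qed.

Lemma cmeasurable_restrict (X : set T) f : measurable X ->
  cmeasurable f -> cmeasurable (restrict_op X f).
Proof.
by move=> mX mf; apply: cmeasurableM => //; apply: cmeasurable_real;
  exact: measurable_indic.
Qed.

Lemma cmeasurable_comp d' (U : measurableType d') (h : U -> T) f :
  measurable_fun setT h -> cmeasurable f -> cmeasurable (fun x => f (h x)).
Proof.
move=> mh [f1 f2]; split; first exact: measurableT_comp f1 mh.
exact: measurableT_comp f2 mh.
Qed.

End ComplexMeasurable.

(** Naming the combination gives the linearity lemmas a pattern that rewriting can match; the
    difference [g - f] is written [lin (-1) f g]. *)
Definition lin (R : realType) (T : Type) (a : R[i]) (f g : T -> R[i]) :=
  fun x => a * f x + g x.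

Arguments ComplexField.Normc.normc : simpl never.
Arguments dotp : simpl never.
Arguments norm2 : simpl never.

(** * Inner product, squared norm and Cauchy-Schwarz *)

Section InnerProduct.
Context d (T : measurableType d) (R : realType).
Variable mu : {measure set T -> \bar R}.
Implicit Types f g h : T -> R[i].
Local Notation dotp := (dotp mu).
Local Notation norm2 := (norm2 mu).
Local Notation aeeq := (aeeq mu).
Local Notation L2 := (L2 mu).

Lemma aeeq_refl f : aeeq f f.
Proof. exact: ae_eq_refl. Qed.

Lemma aeeq_sym f g : aeeq f g -> aeeq g f.
Proof. exact: ae_eq_sym. Qed.

Lemma aeeq_trans f g h : aeeq f g -> aeeq g h -> aeeq f h.
Proof. exact: ae_eq_trans. Qed.

Lemma L2_meas f : L2 f -> cmeasurable f. Proof. by case. Qed.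

Lemma L2_integrable f : L2 f ->
  mu.-integrable setT (EFin \o (fun x => normc (f x) ^+ 2)).
Proof.
move=> [mf fi]; apply/integrableP; split.
  by apply/measurable_EFinP; exact: measurable_normc2.
by under eq_integral do rewrite /= ger0_norm ?sqr_ge0//.
Qed.

Lemma L2P f : cmeasurable f ->
  mu.-integrable setT (EFin \o (fun x => normc (f x) ^+ 2)) -> L2 f.
Proof.
move=> mf /integrableP[_]; split => //.
by move: b; under eq_integral do rewrite /= ger0_norm ?sqr_ge0//.
Qed.

Lemma L2_le f (b : T -> R) : cmeasurable f ->
  mu.-integrable setT (EFin \o b) ->
  (forall x, normc (f x) ^+ 2 <= b x) -> L2 f.
Proof.
move=> mf bi fb; apply: L2P => //; apply: le_integrable bi => //.
  by apply/measurable_EFinP; exact: measurable_normc2.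
move=> x _ /=; rewrite lee_fin ger0_norm ?sqr_ge0//.
by rewrite (le_trans (fb x))// ler_norm.
Qed.

Lemma norm2E f : L2 f -> (norm2 f)%:E = (\int[mu]_x (normc (f x) ^+ 2)%:E)%E.
Proof.
move=> /L2_integrable fi; rewrite /norm2 /Rintegral fineK//.
exact: integrable_fin_num.
Qed.

Lemma norm2_ge0 f : 0 <= norm2 f.
Proof. by apply: Rintegral_ge0 => x _; exact: sqr_ge0. Qed.

Lemma L2_lin (a : R[i]) f g : L2 f -> L2 g -> L2 (lin a f g).
Proof.
move=> Lf Lg; pose b x := 2 * normc a ^+ 2 * normc (f x) ^+ 2 + 2 * normc (g x) ^+ 2.
apply: (@L2_le _ b).
- apply: cmeasurableD; last exact: L2_meas.
  by apply: cmeasurableM; [exact: cmeasurable_cst|exact: L2_meas].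
- apply: (@integrableD _ _ _ _ _ _ (fun x => (2 * normc a ^+ 2 * normc (f x) ^+ 2)%:E)
    (fun x => (2 * normc (g x) ^+ 2)%:E)) => //.
    have := integrableZl measurableT (2 * normc a ^+ 2) (L2_integrable Lf).
    by apply: eq_integrable => // x _ /=; rewrite EFinM.
  have := integrableZl measurableT 2 (L2_integrable Lg).
  by apply: eq_integrable => // x _ /=; rewrite EFinM.
- move=> x; rewrite (le_trans (normc2D _ _))// lerD2r.
  by rewrite ComplexField.Normc.normcM exprMn mulrA.
Qed.

Lemma L20 : L2 (fun=> 0).
Proof.
apply: L2P; first exact: cmeasurable_cst.
rewrite [X in integrable _ _ X](_ : _ = cst 0%E); first exact: integrable0.
by apply/funext => x; rewrite /= normc2_0.
Qed.

Lemma L2_scale (c : R[i]) f : L2 f -> L2 (fun x => c * f x).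
Proof.
move=> Lf; rewrite (_ : (fun x => _) = lin c f (fun=> 0)).
  by apply: L2_lin => //; exact: L20.
by apply/funext => x; rewrite /lin addr0.
Qed.

Lemma L2_restrict X f : measurable X -> L2 f -> L2 (restrict_op X f).
Proof.
move=> mX Lf; apply: (@L2_le _ (fun x => normc (f x) ^+ 2)).
- by apply: cmeasurable_restrict => //; exact: L2_meas.
- exact: L2_integrable.
- move=> x; rewrite /restrict_op ComplexField.Normc.normcM exprMn normc_real.
  rewrite indicE; case: (_ \in _); rewrite ?normr1 ?normr0 ?expr1n ?expr0n.
    by rewrite mul1r.
  by rewrite mul0r sqr_ge0.
Qed.

Lemma dotp_integrable f g : L2 f -> L2 g ->
  mu.-integrable setT (EFin \o (fun x => complex.Re (f x * conjc (g x)))) /\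
  mu.-integrable setT (EFin \o (fun x => complex.Im (f x * conjc (g x)))).
Proof.
move=> Lf Lg.
have [m1 m2] : cmeasurable (fun x => f x * conjc (g x)).
  by apply: cmeasurableM; [|apply: cmeasurableJ]; exact: L2_meas.
have bi := integrableD measurableT (L2_integrable Lf) (L2_integrable Lg).
have H x : normc (f x * conjc (g x)) <= `|normc (f x) ^+ 2 + normc (g x) ^+ 2|.
  rewrite ComplexField.Normc.normcM normc_conj ger0_norm ?addr_ge0 ?sqr_ge0//.
  have := normc_ge0 (f x); have := normc_ge0 (g x).
  have := sqr_ge0 (normc (f x) - normc (g x)); nra.
split; apply: le_integrable bi => //; try exact/measurable_EFinP.
- by move=> x _ /=; rewrite lee_fin (le_trans (Re_le_normc _)).
- by move=> x _ /=; rewrite lee_fin (le_trans (Im_le_normc _)).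
Qed.

Lemma Re_dotp f g : complex.Re (dotp f g) =
  (\int[mu]_x complex.Re (f x * conjc (g x)))%R.
Proof. by []. Qed.

Lemma Im_dotp f g : complex.Im (dotp f g) =
  (\int[mu]_x complex.Im (f x * conjc (g x)))%R.
Proof. by []. Qed.

Lemma dotp_linl (a : R[i]) f g h : L2 f -> L2 g -> L2 h ->
  dotp (lin a f g) h = a * dotp f h + dotp g h.
Proof.
move=> Lf Lg Lh.
have [f1 f2] := dotp_integrable Lf Lh; have [g1 g2] := dotp_integrable Lg Lh.
have Zi (r : R) u : mu.-integrable setT (EFin \o u) ->
    mu.-integrable setT (EFin \o (fun x => r * u x)).
  move=> /(integrableZl measurableT r).
  by apply: eq_integrable => // x _; rewrite /= EFinM.
have Di u v : mu.-integrable setT (EFin \o u) -> mu.-integrable setT (EFin \o v) ->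
    mu.-integrable setT (EFin \o (fun x => u x + v x)).
  by move=> ui vi; exact: (integrableD measurableT ui vi).
have Bi u v : mu.-integrable setT (EFin \o u) -> mu.-integrable setT (EFin \o v) ->
    mu.-integrable setT (EFin \o (fun x => u x - v x)).
  by move=> ui vi; exact: (integrableB measurableT ui vi).
have Zl (r : R) (u : T -> R) : mu.-integrable setT (EFin \o u) ->
    r * (\int[mu]_x u x)%R = (\int[mu]_x (r * u x))%R.
  by move=> ui; rewrite RintegralZl.
apply: complex_eqP; rewrite !(cReD, cImD, cReM, cImM) !(Re_dotp, Im_dotp).
- rewrite (Zl _ _ f1) (Zl _ _ f2) -RintegralB//; [|exact: Zi|exact: Zi].
  rewrite -RintegralD//; last by apply: Bi; exact: Zi.
  apply: eq_Rintegral => x _; rewrite /lin !(cReM, cReD, cImM, cImD, cReJ, cImJ); ring.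
- rewrite (Zl _ _ f1) (Zl _ _ f2) -RintegralD//; [|exact: Zi|exact: Zi].
  rewrite -RintegralD//; last by apply: Di; exact: Zi.
  apply: eq_Rintegral => x _; rewrite /lin !(cReM, cReD, cImM, cImD, cReJ, cImJ); ring.
Qed.

Lemma dotpC f g : L2 f -> L2 g -> dotp g f = conjc (dotp f g).
Proof.
move=> Lf Lg; have [f1 f2] := dotp_integrable Lf Lg.
apply: complex_eqP; rewrite !(cReJ, cImJ) !(Re_dotp, Im_dotp).
- by apply: eq_Rintegral => x _; rewrite !(cReM, cReJ, cImJ); ring.
- rewrite -mulN1r.
  rewrite -RintegralZl//; by apply: eq_Rintegral => x _; rewrite !(cImM, cReJ, cImJ); ring.
Qed.

Lemma dotp_linr (a : R[i]) f g h : L2 f -> L2 g -> L2 h ->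
  dotp h (lin a f g) = conjc a * dotp h f + dotp h g.
Proof.
move=> Lf Lg Lh; rewrite (dotpC (L2_lin a Lf Lg) Lh) (dotpC Lf Lh) (dotpC Lg Lh).
by rewrite dotp_linl// rmorphD rmorphM.
Qed.

Lemma dotpff f : dotp f f = (norm2 f)%:C.
Proof.
apply: complex_eqP; rewrite /dotp /cintegral /norm2 /=.
- by apply: eq_Rintegral => x _; rewrite mulcJ.
- rewrite (@eq_Rintegral _ _ _ mu setT (cst 0)); last by move=> x _; rewrite mulcJ.
  by rewrite /Rintegral integral0.
Qed.

Lemma dotp_aeeq f f' g g' : L2 f -> L2 f' -> L2 g -> L2 g' ->
  aeeq f f' -> aeeq g g' -> dotp f g = dotp f' g'.
Proof.
move=> Lf Lf' Lg Lg' ff' gg'.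
have [m1 m2] : cmeasurable (fun x => f x * conjc (g x)).
  by apply: cmeasurableM; [|apply: cmeasurableJ]; exact: L2_meas.
have [m1' m2'] : cmeasurable (fun x => f' x * conjc (g' x)).
  by apply: cmeasurableM; [|apply: cmeasurableJ]; exact: L2_meas.
apply: complex_eqP; rewrite /dotp /cintegral /Rintegral /=; congr fine;
  apply: ae_eq_integral => //; try exact/measurable_EFinP.
- by apply: filterS2 ff' gg' => x /(_ I) -> /(_ I) ->.
- by apply: filterS2 ff' gg' => x /(_ I) -> /(_ I) ->.
Qed.

Lemma norm2_aeeq f g : L2 f -> L2 g -> aeeq f g -> norm2 f = norm2 g.
Proof.
move=> Lf Lg fg; apply: complexI.
by rewrite -!dotpff; exact: dotp_aeeq.
Qed.

Lemma norm2_eq0 f : L2 f -> norm2 f = 0 -> aeeq f (fun=> 0).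
Proof.
move=> Lf f0.
have : (\int[mu]_x `|(normc (f x) ^+ 2)%:E| = 0)%E.
  under eq_integral do rewrite gee0_abs ?lee_fin ?sqr_ge0//.
  by rewrite -norm2E// f0.
move/(ae_eq_integral_abs mu measurableT _).1 => H.
have {H} : ae_eq mu setT (fun x => (normc (f x) ^+ 2)%:E) (cst 0%E).
  by apply: H; apply/measurable_EFinP; apply: measurable_normc2; exact: L2_meas.
by apply: filterS => x /(_ I) [] /normc2_eq0 ->.
Qed.

Lemma norm2_0 : norm2 (fun=> 0) = 0.
Proof.
rewrite /norm2 (@eq_Rintegral _ _ _ mu setT (cst 0)); first by rewrite /Rintegral integral0.
by move=> x _; rewrite normc2_0.
Qed.

Lemma dotp0l g : dotp (fun=> 0) g = 0.
Proof.
rewrite /dotp (_ : (fun x => _) = (fun=> 0)).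
  by apply: complex_eqP; rewrite /cintegral /Rintegral /= integral0.
by apply/funext => x; rewrite mul0r.
Qed.

Lemma dotp0r g : dotp g (fun=> 0) = 0.
Proof.
rewrite /dotp (_ : (fun x => _) = (fun=> 0)).
  by apply: complex_eqP; rewrite /cintegral /Rintegral /= integral0.
by apply/funext => x; rewrite (_ : conjc 0 = 0) ?mulr0//; exact: conjc0.
Qed.

Lemma dotpZl (c : R[i]) f g : L2 f -> L2 g ->
  dotp (fun x => c * f x) g = c * dotp f g.
Proof.
move=> Lf Lg; rewrite (_ : (fun x => _) = lin c f (fun=> 0)).
  by rewrite dotp_linl ?dotp0l ?addr0//; exact: L20.
by apply/funext => x; rewrite /lin addr0.
Qed.

Lemma norm2_lin (a : R[i]) f g : L2 f -> L2 g ->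
  norm2 (lin a f g) =
  normc a ^+ 2 * norm2 f + norm2 g + 2 * complex.Re (a * dotp f g).
Proof.
move=> Lf Lg; apply: complexI; rewrite -dotpff.
rewrite dotp_linl ?dotp_linr//; last exact: L2_lin.
rewrite (dotpC Lf Lg) !dotpff.
apply: complex_eqP; rewrite ?normc2E; case: a => a b; case: (dotp f g) => u v /=; ring.
Qed.

Lemma norm2Z (c : R[i]) f : L2 f ->
  norm2 (fun x => c * f x) = normc c ^+ 2 * norm2 f.
Proof.
move=> Lf; rewrite (_ : (fun x => _) = lin c f (fun=> 0)).
  by rewrite norm2_lin ?norm2_0 ?dotp0r ?mulr0 ?addr0//; exact: L20.
by apply/funext => x; rewrite /lin addr0.
Qed.

Lemma cauchy_schwarz f g : L2 f -> L2 g ->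
  normc (dotp f g) ^+ 2 <= norm2 f * norm2 g.
Proof.
move=> Lf Lg; have [g0|g0] := eqVneq (norm2 g) 0.
  rewrite g0 mulr0 (@dotp_aeeq f f g (fun=> 0))//.
  - by rewrite dotp0r normc2_0.
  - exact: L20.
  - exact: aeeq_refl.
  - exact: norm2_eq0.
have gp : 0 < norm2 g by rewrite lt0r g0 norm2_ge0.
(* The vector is [f] minus its projection onto the line of [g]; its squared norm is the defect in
   the inequality divided by [norm2 g]. *)
have := norm2_ge0 (lin (- (dotp f g / (norm2 g)%:C)) g f).
rewrite norm2_lin// normcN ComplexField.Normc.normcM ComplexField.Normc.normcV.
rewrite normc_real (ger0_norm (ltW gp)) (dotpC Lf Lg).
set z := dotp f g; set n := norm2 g in g0 gp *.
have -> : - (z / n%:C) * conjc z = (- (normc z ^+ 2 / n))%:C.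
  by rewrite mulNr mulrAC mulcJ -realcV -realcM -realcN.
rewrite [complex.Re _]/=.
have -> : (normc z / n) ^+ 2 * n + norm2 f + 2 * (- (normc z ^+ 2 / n)) =
   (norm2 f * n - normc z ^+ 2) / n by field.
by rewrite ler_pdivlMr// mul0r subr_ge0.
Qed.

Lemma dotp_sum (I : Type) (r : seq I) (Q : pred I) (c : I -> R[i])
    (e : I -> T -> R[i]) g : (forall i, Q i -> L2 (e i)) -> L2 g ->
  L2 (fun x => \sum_(i <- r | Q i) c i * e i x) /\
  dotp (fun x => \sum_(i <- r | Q i) c i * e i x) g =
  \sum_(i <- r | Q i) c i * dotp (e i) g.
Proof.
move=> Le Lg; elim: r => [|i r [IH1 IH2]].
  rewrite big_nil; under eq_fun do rewrite big_nil.
  by split; [exact: L20|exact: dotp0l].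
rewrite big_cons; under eq_fun do rewrite big_cons.
case: ifPn => // Qi; split.
  by apply: (L2_lin (c i) (Le _ Qi)); exact: IH1.
by rewrite -IH2 -dotp_linl//; exact: Le.
Qed.

Lemma L2_cvg_dotp u f g : (forall n, L2 (u n)) -> L2 f -> L2 g ->
  L2_cvg mu u f ->
  complex.Re (dotp (u n) g) @[n --> \oo] --> complex.Re (dotp f g).
Proof.
move=> Lu Lf Lg uf; apply/cvgrPdist_le => e e0.
have [g0|g0] := eqVneq (norm2 g) 0.
  near=> n.
  have H v : L2 v -> dotp v g = 0.
    move=> Lv; rewrite (@dotp_aeeq v v g (fun=> 0)) ?dotp0r//.
    - exact: L20.
    - exact: aeeq_refl.
    - exact: norm2_eq0.
  by rewrite !H// subrr normr0 ltW.
have gp : 0 < norm2 g by rewrite lt0r g0 norm2_ge0.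
(* By Cauchy-Schwarz, a squared distance below this threshold moves the inner product with [g] by at
   most [e]. *)
have e'0 : 0 < e ^+ 2 / norm2 g by rewrite divr_gt0// exprn_gt0.
move/cvgrPdist_le : uf => /(_ _ e'0); apply: filterS => n.
rewrite sub0r normrN ger0_norm ?norm2_ge0// ler_pdivlMr// => H.
rewrite distrC -(@ler_pXn2r _ 2)// ?nnegrE ?normr_ge0 ?(ltW e0)//.
apply: le_trans H; rewrite (_ : (fun x => _) = lin (-1) f (u n)); last first.
  by apply/funext => x; rewrite /lin mulN1r addrC.
apply: le_trans (cauchy_schwarz _ Lg); last exact: L2_lin.
rewrite dotp_linl// mulN1r.
have -> : complex.Re (dotp (u n) g) - complex.Re (dotp f g) =
   complex.Re (- dotp f g + dotp (u n) g).
  by rewrite cReD; case: (dotp f g) => a b /=; rewrite addrC.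
by rewrite ler_pXn2r// ?nnegrE ?normr_ge0 ?normc_ge0// Re_le_normc.
Unshelve. all: by end_near. Qed.

End InnerProduct.

(** * Completeness of L^2 and Parseval's identity *)

Section RealCompleteness.
Context d (T : measurableType d) (R : realType).
Variable mu : {measure set T -> \bar R}.

Lemma sum_half_le2 n : \sum_(0 <= k < n) 2^-1 ^+ k <= 2 :> R.
Proof.
have -> : \sum_(0 <= k < n) 2^-1 ^+ k = 2 - 2 * 2^-1 ^+ n :> R.
  elim: n => [|n IH]; first by rewrite big_nil expr0 mulr1 subrr.
  by rewrite big_nat_recr//= IH exprS; field.
by rewrite gerBl mulr_ge0// exprn_ge0// invr_ge0.
Qed.

Lemma cvg_increments (v : R^nat) (C : R) :
  (forall n, \sum_(0 <= k < n) `|v k.+1 - v k| <= C) -> cvgn v.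
Proof.
move=> vC.
have c1 : cvgn [normed series (fun k => v k.+1 - v k)].
  apply: nondecreasing_is_cvgn.
  apply/nondecreasing_seqP => n.
  change (\sum_(0 <= k < n) `|v k.+1 - v k| <= \sum_(0 <= k < n.+1) `|v k.+1 - v k|).
  by rewrite big_nat_recr//= lerDl.
  by exists C => _ [n _ <-]; exact: vC.
have c2 := normed_cvg c1.
have -> : v = (fun n => v 0%N + series (fun k => v k.+1 - v k) n).
  by apply/funext => n; rewrite /series/= telescope_sumr// addrC subrK.
by apply: is_cvgD => //; exact: is_cvg_cst.
Qed.

Lemma summable_increments (v : R^nat) :
  (\sum_(k <oo) (2 ^+ k * (v k.+1 - v k) ^+ 2)%:E < +oo)%E -> cvgn v.
Proof.
set G := (\sum_(k <oo) _)%E => Goo.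
have G0 : (0 <= G)%E.
  by apply: nneseries_ge0 => k _ _; rewrite lee_fin mulr_ge0 ?sqr_ge0// exprn_ge0.
have GE : G = (fine G)%:E by rewrite fineK// ge0_fin_numE.
apply: (@cvg_increments v (fine G + 2)) => n.
apply: (@le_trans _ _ (\sum_(0 <= k < n) (2 ^+ k * (v k.+1 - v k) ^+ 2) +
    \sum_(0 <= k < n) (2^-1) ^+ k)).
  rewrite -big_split /=; apply: ler_sum => k _.
  have p0 : 0 < 2 ^+ k :> R by rewrite exprn_gt0.
  rewrite exprVn -(real_normK (num_real (v k.+1 - v k))).
  set a := `|_|; have a0 : 0 <= a by rewrite normr_ge0.
  set p := 2 ^+ k in p0 *.
  rewrite -subr_ge0.
  (* Completing the square in [p * a] bounds [a] by [p * a ^+ 2 + p^-1], which trades a summable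
     weighted square for a summable increment. *)
  have -> : p * a ^+ 2 + p^-1 - a = ((p * a - 2^-1) ^+ 2 + 3/4) / p.
    by field; rewrite gt_eqF.
  by rewrite divr_ge0 ?(ltW p0)// addr_ge0 ?sqr_ge0//; lra.
apply: lerD.
  rewrite -lee_fin -GE -sumEFin.
  by apply: nneseries_lim_ge => k _; rewrite lee_fin mulr_ge0 ?sqr_ge0// exprn_ge0.
exact: sum_half_le2.
Qed.

(* Along a subsequence with squared increments of integral at most 4^-k, the sum
   of 2^k d_k^2 is integrable, hence finite a.e., so that the increments d_k are
   a.e. summable by [|d_k| <= 2^k d_k^2 + 2^-k]; Fatou then bounds the limit. *)
Lemma real_L2_complete (u : nat -> T -> R) (b : nat -> R) :
  (forall n, measurable_fun setT (u n)) ->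
  (forall m n, (m <= n)%N ->
     (\int[mu]_x ((u n x - u m x) ^+ 2)%:E <= (b m)%:E)%E) ->
  b n @[n --> \oo] --> 0 ->
  exists h : T -> R, measurable_fun setT h /\
    forall m, (\int[mu]_x ((h x - u m x) ^+ 2)%:E <= (b m)%:E)%E.
Proof.
move=> mu_ ub b0.
have [N HN] : exists N : nat -> nat, forall k n, (N k <= n)%N -> b n <= (4^-1) ^+ k.
  suff H k : exists N, forall n, (N <= n)%N -> b n <= (4^-1) ^+ k.
    by have [N HN] := boolp.choice H; exists N.
  have e0 : 0 < 4^-1 ^+ k :> R by rewrite exprn_gt0// invr_gt0.
  move/cvgrPdist_le : b0 => /(_ _ e0)[N _ H].
  exists N => n Nn; have := H n Nn; rewrite sub0r normrN.
  exact: le_trans (ler_norm _).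
(* Summing the [(N i).+1] gives a nondecreasing index that exceeds both [N k] and [k], even if [N]
   itself is not monotone. *)
pose phi k := (\sum_(0 <= i < k.+1) (N i).+1)%N.
have phiS k : (phi k <= phi k.+1)%N by rewrite /phi [in leqRHS]big_nat_recr//= leq_addr.
have Nphi k : (N k <= phi k)%N.
  by rewrite /phi big_nat_recr//= addnS leqW// leq_addl.
have kphi k : (k <= phi k)%N.
  elim: k => // k IH; rewrite /phi big_nat_recr//= addnS ltnS.
  by rewrite (leq_trans IH)// leq_addr.
pose g k x := (2 ^+ k * (u (phi k.+1) x - u (phi k) x) ^+ 2)%:E.
have g0 k x : (0 <= g k x)%E by rewrite lee_fin mulr_ge0 ?sqr_ge0// exprn_ge0.
have mg k : measurable_fun setT (g k).
  apply/measurable_EFinP; apply: measurable_funM => //.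
  by apply: measurable_funX; exact: measurable_funB.
pose G x := (\sum_(k <oo) g k x)%E.
have mG : measurable_fun setT G by exact: ge0_emeasurable_sum.
have G0 x : (0 <= G x)%E by exact: nneseries_ge0.
have Gi : (\int[mu]_x G x < +oo)%E.
  rewrite integral_nneseries//.
  apply: (@le_lt_trans _ _ (\sum_(k <oo) (2^-1 ^+ k)%:E)%E).
    apply: lee_nneseries => [k _ _|k _].
      by apply: integral_ge0 => x _.
    rewrite /g; under eq_integral do rewrite EFinM.
    rewrite ge0_integralZl_EFin//; last 2 first.
    - by move=> x _; rewrite lee_fin sqr_ge0.
    - by apply/measurable_EFinP; apply: measurable_funX; exact: measurable_funB.
    apply: (@le_trans _ _ ((2 ^+ k)%:E * (4^-1 ^+ k)%:E)%E).
      apply: lee_wpmul2l; first by rewrite lee_fin exprn_ge0.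
      by apply: le_trans (ub _ _ (phiS k)) _; rewrite lee_fin HN.
    by rewrite -EFinM lee_fin -exprMn (_ : 2 * 4^-1 = 2^-1 :> R)//; field.
  apply: (@le_lt_trans _ _ 2%:E); last exact: ltry.
  apply: lime_le; first by apply: is_cvg_nneseries => k _ _; rewrite lee_fin exprn_ge0// invr_ge0.
  apply: nearW => n; rewrite sumEFin lee_fin.
  exact: sum_half_le2.
have Gae : {ae mu, forall x, G x < +oo}%E.
  have : mu.-integrable setT G.
    by apply/integrableP; split => //; under eq_integral do rewrite gee0_abs//.
  move/(integrable_ae measurableT); apply: filterS => x /(_ I).
  by rewrite ge0_fin_numE.
pose D := [set x | G x < +oo]%E.
have mD : measurable D.
  by rewrite /D -[X in measurable X]setTI; exact: emeasurable_fun_infty_o.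
(* Setting the sequence to zero off [D] makes it converge everywhere, so that its pointwise limit is
   measurable. *)
pose v k x := u (phi k) x * \1_D x.
have mv k : measurable_fun setT (v k).
  by apply: measurable_funM => //; exact: measurable_indic.
have vc x : cvgn (v ^~ x).
  rewrite /v; have [xD|xD] := pselect (D x).
    rewrite indicE mem_set// (_ : (fun k => _) = (fun k => u (phi k) x)); last first.
      by apply/funext => k; rewrite mulr1.
    by apply: (@summable_increments (fun k => u (phi k) x)); exact: xD.
  rewrite indicE memNset// (_ : (fun k => _) = cst 0); first exact: is_cvg_cst.
  by apply/funext => k; rewrite mulr0.
pose h x := limn (v ^~ x).
have mh : measurable_fun setT h.
  by apply: (measurable_fun_cvg mv) => x _; exact: vc.
exists h; split => // m.
pose f k x := ((u (phi k) x - u m x) ^+ 2)%:E.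
have mf k : measurable_fun setT (f k).
  by apply/measurable_EFinP; apply: measurable_funX; exact: measurable_funB.
have f0 k x : (0 <= f k x)%E by rewrite lee_fin sqr_ge0.
apply: (@le_trans _ _ (\int[mu]_x limn_einf (f ^~ x))%E).
  apply: ae_ge0_le_integral => //.
  - by move=> x _; rewrite lee_fin sqr_ge0.
  - by apply/measurable_EFinP; apply: measurable_funX; exact: measurable_funB.
  - move=> x _; rewrite limn_einf_lim; apply: lime_ge; first exact: is_cvg_einfs.
    by apply: nearW => n; apply: le_ereal_inf_tmp => _ [p /= np <-]; exact: f0.
  - under eq_fun do rewrite limn_einf_lim.
    apply: (@emeasurable_fun_cvg _ _ _ _ (fun n x => einfs (f ^~ x) n)).
      by move=> n; exact: measurable_fun_einfs.
    by move=> x _; exact: is_cvg_einfs.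
  apply: filterS Gae => x xD _.
  have c : u (phi k) x @[k --> \oo] --> h x.
    have := vc x; rewrite /h (_ : v ^~ x = (fun k => u (phi k) x))//.
    by apply/funext => k; rewrite /v indicE mem_set// mulr1.
  have c2 : f k x @[k --> \oo] --> ((h x - u m x) ^+ 2)%:E.
    apply: cvg_EFin; first exact: nearW.
    rewrite [X in X @ _ --> _](_ : _ =
      (fun k => (u (phi k) x - u m x) * (u (phi k) x - u m x))); last first.
      by apply/funext => k; rewrite /f /= expr2.
    by rewrite expr2; apply: cvgM; apply: cvgB => //; exact: cvg_cst.
  rewrite is_cvg_limn_einfE; last by apply/cvg_ex; eexists; exact: c2.
  by rewrite (cvg_lim _ c2).
apply: (le_trans (fatou mu measurableT mf _)) => //.
rewrite limn_einf_lim; apply: lime_le; first exact: is_cvg_einfs.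
apply: nearW => n.
(* The index [maxn n m] lies in the tail after [n], and [phi] sends it to at least [m], where the
   Cauchy bound [ub] applies. *)
apply: (@le_trans _ _ (\int[mu]_x f (maxn n m) x)%E).
  by apply: ereal_inf_lbound; exists (maxn n m) => //=; exact: leq_maxl.
by apply: ub; rewrite (leq_trans _ (kphi _))// leq_maxr.
Qed.

End RealCompleteness.

(** * Complex L^2: Bessel's inequality and Parseval's identity *)

Section HilbertSpace.
Context d (T : measurableType d) (R : realType).
Variable mu : {measure set T -> \bar R}.
Implicit Types f g h : T -> R[i].
Local Notation dotp := (dotp mu).
Local Notation norm2 := (norm2 mu).
Local Notation aeeq := (aeeq mu).
Local Notation L2 := (L2 mu).

(** Real and imaginary parts converge separately, and adding their two bounds costs the factor 2.
    The rate [b] is explicit because the intended use takes it to be the tail of a convergent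
    series. *)
Lemma L2_complete (u : nat -> T -> R[i]) (b : nat -> R) :
  (forall n, L2 (u n)) ->
  (forall m n, (m <= n)%N -> norm2 (lin (-1) (u m) (u n)) <= b m) ->
  b n @[n --> \oo] --> 0 ->
  exists h, L2 h /\ forall m, norm2 (lin (-1) (u m) h) <= 2 * b m.
Proof.
move=> Lu ub b0.
have mRe n : measurable_fun setT (fun x => complex.Re (u n x)) by have [[]] := Lu n.
have mIm n : measurable_fun setT (fun x => complex.Im (u n x)) by have [[]] := Lu n.
have ub' m n : (m <= n)%N ->
    (\int[mu]_x (normc (lin (-1) (u m) (u n) x) ^+ 2)%:E <= (b m)%:E)%E.
  move=> mn; rewrite -norm2E; last exact: L2_lin.
  by rewrite lee_fin ub.
have linE m h x : normc (lin (-1) (u m) h x) ^+ 2 =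
    (complex.Re (h x) - complex.Re (u m x)) ^+ 2 +
    (complex.Im (h x) - complex.Im (u m x)) ^+ 2.
  rewrite normc2E /lin cReD cImD mulN1r.
  by case: (u m x) => p q; case: (h x) => r s /=; ring.
have mlin m n : measurable_fun setT
    (fun x => (normc (lin (-1) (u m) (u n) x) ^+ 2)%:E).
  apply/measurable_EFinP; apply: measurable_normc2; apply: L2_meas.
  exact: L2_lin.
have [|h1 [mh1 H1]] := @real_L2_complete _ _ _ mu _ b mRe _ b0.
  move=> m n mn; apply: le_trans (ub' m n mn); apply: ge0_le_integral => //.
  - by move=> x _; rewrite lee_fin sqr_ge0.
  - by apply/measurable_EFinP; apply: measurable_funX; exact: measurable_funB.
  - by move=> x _; rewrite lee_fin linE lerDl sqr_ge0.
have [|h2 [mh2 H2]] := @real_L2_complete _ _ _ mu _ b mIm _ b0.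
  move=> m n mn; apply: le_trans (ub' m n mn); apply: ge0_le_integral => //.
  - by move=> x _; rewrite lee_fin sqr_ge0.
  - by apply/measurable_EFinP; apply: measurable_funX; exact: measurable_funB.
  - by move=> x _; rewrite lee_fin linE lerDr sqr_ge0.
pose h x := h1 x +i* h2 x.
have mh : cmeasurable h by split.
have mlh m : cmeasurable (lin (-1) (u m) h).
  apply: cmeasurableD => //; apply: cmeasurableM; first exact: cmeasurable_cst.
  exact: L2_meas (Lu m).
have Hb m : (\int[mu]_x (normc (lin (-1) (u m) h x) ^+ 2)%:E <= (2 * b m)%:E)%E.
  under eq_integral do rewrite linE EFinD.
  rewrite ge0_integralD//; last 4 first.
  - by move=> x _; rewrite lee_fin sqr_ge0.
  - by apply/measurable_EFinP; apply: measurable_funX; exact: measurable_funB.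
  - by move=> x _; rewrite lee_fin sqr_ge0.
  - by apply/measurable_EFinP; apply: measurable_funX; exact: measurable_funB.
  by rewrite mulr_natl mulr2n EFinD leeD// ?H1 ?H2.
have Llh m : L2 (lin (-1) (u m) h).
  by split => //; apply: le_lt_trans (Hb m) _; rewrite ltry.
have Lh : L2 h.
  rewrite (_ : h = lin 1 (u 0%N) (lin (-1) (u 0%N) h)).
    by apply: L2_lin.
  by apply/funext => x; rewrite /lin mul1r mulN1r addrA subrr add0r.
by exists h; split => // m; rewrite -lee_fin norm2E.
Qed.

(* A zero vector is allowed, so that a family indexed by a subset of nat can be
   extended by zero to a sequence. *)
Definition suborthonormal (e : nat -> T -> R[i]) :=
  [/\ forall j, L2 (e j), forall i j, i != j -> dotp (e i) (e j) = 0
    & forall j, e j = (fun=> 0) \/ norm2 (e j) = 1].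

(** Removing one coordinate at a time, instead of subtracting a finite sum, makes each property
    below a one-step induction through [lin]. *)
Fixpoint remainder f (e : nat -> T -> R[i]) n :=
  if n is m.+1 then lin (- dotp f (e m)) (e m) (remainder f e m) else f.

Section Remainder.
Variables (f : T -> R[i]) (e : nat -> T -> R[i]).
Hypotheses (Lf : L2 f) (eo : suborthonormal e).

Lemma remainder_L2 n : L2 (remainder f e n).
Proof. by elim: n => //= n IH; apply: L2_lin => //; case: eo. Qed.

Lemma dotp_remainder n j :
  dotp (remainder f e n) (e j) = if (j < n)%N then 0 else dotp f (e j).
Proof.
have [Le oe ne] := eo.
elim: n => //= n IH; rewrite dotp_linl//; last exact: remainder_L2.
rewrite IH; have [->|jn] := eqVneq j n; last first.
  by rewrite oe 1?eq_sym// mulr0 add0r ltnS [in RHS]leq_eqVlt (negbTE jn).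
rewrite ltnSn ltnn; case: (ne n) => [->|n1]; first by rewrite !dotp0r mulr0 addr0.
by rewrite dotpff n1 mulr1 addNr.
Qed.

Lemma norm2_remainderB m n : (m <= n)%N ->
  norm2 (lin (-1) (remainder f e m) (remainder f e n)) =
  \sum_(m <= j < n) normc (dotp f (e j)) ^+ 2.
Proof.
have [Le oe ne] := eo.
elim: n => [|n IH].
  rewrite leqn0 => /eqP ->; rewrite big_geq//.
  rewrite (_ : lin _ _ _ = (fun=> 0)) ?norm2_0//.
  by apply/funext => x; rewrite /lin mulN1r addNr.
rewrite leq_eqVlt => /predU1P[->|].
  rewrite big_geq// (_ : lin _ _ _ = (fun=> 0)) ?norm2_0//.
  by apply/funext => x; rewrite /lin mulN1r addNr.
rewrite ltnS => mn; rewrite big_nat_recr//= -IH//.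
rewrite (_ : lin _ _ _ = lin (- dotp f (e n)) (e n)
    (lin (-1) (remainder f e m) (remainder f e n))); last first.
  by apply/funext => x; rewrite /lin addrCA.
have Lm := remainder_L2 m; have Ln := remainder_L2 n.
rewrite norm2_lin//; last exact: L2_lin.
(* Both remainders have index at most [n], so they still carry the same coefficient along [e n], and
   it cancels in their difference. *)
have -> : dotp (e n) (lin (-1) (remainder f e m) (remainder f e n)) = 0.
  rewrite (dotpC (L2_lin (-1) Lm Ln) (Le n)) dotp_linl//.
  by rewrite !dotp_remainder ltnn (leq_gtF mn) mulN1r addNr conjc0.
rewrite !mulr0 addr0 addrC normcN; congr (_ + _).
case: (ne n) => [->|->]; last by rewrite mulr1.
by rewrite norm2_0 dotp0r mulr0 normc2_0.
Qed.

Lemma norm2_remainder n : norm2 (remainder f e n) =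
  norm2 f - \sum_(0 <= j < n) normc (dotp f (e j)) ^+ 2.
Proof.
have [Le oe ne] := eo.
elim: n => [|n IH]; first by rewrite big_nil subr0.
rewrite big_nat_recr//= norm2_lin//; last exact: remainder_L2.
rewrite IH (dotpC (remainder_L2 n) (Le n)) dotp_remainder ltnn normcN mulNr mulcJ.
rewrite -realcN /=.
case: (ne n) => [->|->]; last by ring.
by rewrite norm2_0 dotp0r normc2_0; ring.
Qed.

Lemma bessel n : \sum_(0 <= j < n) normc (dotp f (e j)) ^+ 2 <= norm2 f.
Proof. by rewrite -subr_ge0 -norm2_remainder norm2_ge0. Qed.

Lemma bessel_series :
  (\sum_(j <oo) (normc (dotp f (e j)) ^+ 2)%:E <= (norm2 f)%:E)%E.
Proof.
apply: lime_le.
  by apply: is_cvg_nneseries => k _ _; rewrite lee_fin sqr_ge0.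
by apply: nearW => n; rewrite sumEFin lee_fin bessel.
Qed.

(** The remainders are Cauchy, at the rate given by the tail of the Bessel series. Their limit [h]
    is orthogonal to every [e j], hence null by completeness of the system, so the remainders tend
    to 0 in norm. *)
Lemma parseval :
  (forall g, L2 g -> (forall j, dotp g (e j) = 0) -> aeeq g (fun=> 0)) ->
  (\sum_(j <oo) (normc (dotp f (e j)) ^+ 2)%:E = (norm2 f)%:E)%E.
Proof.
move=> ec; have [Le oe ne] := eo.
pose S n := \sum_(0 <= j < n) normc (dotp f (e j)) ^+ 2.
have Sc : cvgn S.
  apply: nondecreasing_is_cvgn.
    by apply/nondecreasing_seqP => n; rewrite /S big_nat_recr//= lerDl sqr_ge0.
  by exists (norm2 f) => _ [n _ <-]; exact: bessel.
pose s := limn S; pose b m := s - S m.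
have Ss n : S n <= s.
  apply: nondecreasing_cvgn_le => //.
  by apply/nondecreasing_seqP => k; rewrite /S big_nat_recr//= lerDl sqr_ge0.
have b0 : b n @[n --> \oo] --> 0.
  by rewrite -[0](subrr s); apply: cvgB; [exact: cvg_cst|exact: Sc].
have [||h [Lh hb]] := @L2_complete (remainder f e) b _ _ b0.
- exact: remainder_L2.
- move=> m n mn; rewrite norm2_remainderB// /b lerBrDl.
  by rewrite -big_cat_nat//; exact: Ss.
have h0 : aeeq h (fun=> 0).
  apply: ec => // j; apply: normc2_eq0; apply/eqP; rewrite eq_le sqr_ge0 andbT.
  have b20 : 2 * b n * norm2 (e j) @[n --> \oo] --> 0.
    rewrite -[0](mul0r (norm2 (e j))); apply: cvgMl.
    by rewrite -[0](mulr0 2); exact: cvgMr.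
  rewrite -(cvg_lim _ b20)//; apply: limr_ge; first by apply/cvg_ex; exists 0.
  exists j.+1 => //= n jn.
  have -> : dotp h (e j) = dotp (lin (-1) (remainder f e n) h) (e j).
    rewrite dotp_linl//; last exact: remainder_L2.
    by rewrite dotp_remainder jn mulr0 add0r.
  have Ln : L2 (lin (-1) (remainder f e n) h) by apply: L2_lin => //; exact: remainder_L2.
  apply: le_trans (cauchy_schwarz Ln (Le j)) _.
  by apply: ler_wpM2r => //; exact: norm2_ge0.
have rb n : norm2 (remainder f e n) <= 2 * b n.
  apply: le_trans (hb n).
  have Lr := remainder_L2 n.
  rewrite norm2_lin// normcN.
  have -> : normc (1 : R[i]) = 1 by exact: ComplexField.Normc.normc1.
  rewrite (norm2_aeeq Lh (L20 mu) h0) norm2_0.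
  rewrite (dotp_aeeq Lr Lr Lh (L20 mu) (aeeq_refl _ _) h0) dotp0r.
  by rewrite !mulr0 expr1n mul1r !addr0.
have fs : norm2 f <= s.
  have H n : norm2 f - s <= b n.
    by have := rb n; rewrite norm2_remainder /b -/(S n); lra.
  rewrite -subr_le0 -(cvg_lim _ b0)//; apply: limr_ge; first by apply/cvg_ex; exists 0.
  exact: nearW.
have sf : s = norm2 f.
  apply/eqP; rewrite eq_le fs andbT; apply: limr_le => //.
  by apply: nearW => n; exact: bessel.
rewrite -sf; apply/cvg_lim => //.
under eq_fun do rewrite sumEFin.
by apply: cvg_EFin; [exact: nearW|exact: Sc].
Qed.

End Remainder.

Definition zero_ext (D : set nat) (e : nat -> T -> R[i]) j :=
  if j \in D then e j else (fun=> 0).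

Lemma suborthonormal_zero_ext D e : Defs.orthonormal mu D e -> suborthonormal (zero_ext D e).
Proof.
move=> [Le oe]; split => [j|i j ij|j]; rewrite /zero_ext.
- by case: ifPn => [/set_mem/Le//|_]; exact: L20.
- case: ifPn => [/set_mem iD|_]; last by rewrite dotp0l.
  case: ifPn => [/set_mem jD|_]; last by rewrite dotp0r.
  by rewrite oe// (negbTE ij).
- case: ifPn => [/set_mem jD|_]; [right|by left].
  by apply: complexI; rewrite -dotpff oe// eqxx.
Qed.

Lemma zero_ext_complete D e : complete_system mu D e ->
  forall g, L2 g -> (forall j, dotp g (zero_ext D e j) = 0) -> aeeq g (fun=> 0).
Proof.
move=> ec g Lg g0; apply: ec => // j jD.
by have := g0 j; rewrite /zero_ext mem_set.
Qed.

End HilbertSpace.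

(** * Reproducing kernels *)

Lemma indic_ge0 (T : Type) (R : realType) (X : set T) (x : T) :
  0 <= \1_X x :> R.
Proof. by rewrite indicE ler0n. Qed.

Lemma measurable_indic_fst d (T : measurableType d) (R : realType) (X : set T) :
  measurable X -> measurable_fun [set: T * T] (fun p => \1_X p.1 : R).
Proof.
move=> mX; have mi : measurable_fun setT (\1_X : T -> R) by exact: measurable_indic.
by have := measurableT_comp mi (@measurable_fst _ _ T T); exact.
Qed.

Lemma measurable_indic_snd d (T : measurableType d) (R : realType) (X : set T) :
  measurable X -> measurable_fun [set: T * T] (fun p => \1_X p.2 : R).
Proof.
move=> mX; have mi : measurable_fun setT (\1_X : T -> R) by exact: measurable_indic.
by have := measurableT_comp mi (@measurable_snd _ _ T T); exact.
Qed.

Section SigmaFiniteTonelli.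
Context d (T : measurableType d) (R : realType).
Variables (mu : {measure set T -> \bar R}) (sf : sigma_finite [set: T] mu).
Local Open Scope ereal_scope.

(** Tonelli's theorem expects a measure carrying a sigma-finite structure; [sf_measure] attaches one
    to [mu] and is convertible to it, so the results can be restated for [mu] itself. *)
Lemma measurable_section_integral (h : T * T -> \bar R) :
  measurable_fun setT h -> (forall p, 0 <= h p) ->
  measurable_fun setT (fun x => \int[mu]_y h (x, y)).
Proof.
move=> mh h0.
exact: (@measurable_fun_fubini_tonelli_F _ _ _ _ _ (sf_measure sf) h mh h0).
Qed.

Lemma sf_tonelli (h : T * T -> \bar R) :
  measurable_fun setT h -> (forall p, 0 <= h p) ->
  \int[mu]_x \int[mu]_y h (x, y) = \int[mu]_y \int[mu]_x h (x, y).
Proof.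
move=> mh h0.
exact: (@fubini_tonelli _ _ _ _ _ (sf_measure sf) (sf_measure sf) h mh h0).
Qed.

(** Positive and negative parts are treated separately because the sections need not be integrable;
    [fine] then supplies a measurable default where the integral is infinite. *)
Lemma measurable_section_Rintegral (h : T * T -> R) :
  measurable_fun setT h ->
  measurable_fun setT (fun x => (\int[mu]_y h (x, y))%R).
Proof.
move=> mh; have mh' : measurable_fun setT (EFin \o h) by exact/measurable_EFinP.
apply: (@measurableT_comp _ _ _ _ _ _ (@fine R) _ (fun x => \int[mu]_y (h (x, y))%:E)) => //.
under eq_fun do rewrite integralE.
apply: emeasurable_funB.
- rewrite (_ : (fun x => _) = (fun x => \int[mu]_y (EFin \o h)^\+ (x, y))).
    exact: (@measurable_section_integral _ (measurable_funepos mh') (funepos_ge0 _)).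
  by apply/funext => x; apply: eq_integral => y _; rewrite !funeposE.
- rewrite (_ : (fun x => _) = (fun x => \int[mu]_y (EFin \o h)^\- (x, y))).
    exact: (@measurable_section_integral _ (measurable_funeneg mh') (funeneg_ge0 _)).
  by apply/funext => x; apply: eq_integral => y _; rewrite !funenegE.
Qed.

End SigmaFiniteTonelli.

(** * The kernel of a projection and the mass of its sections *)

Section Kernel.
Context d (T : measurableType d) (R : realType).
Variables (mu : {measure set T -> \bar R}) (sf : sigma_finite [set: T] mu).
Variables (L : set (T -> R[i])) (K : (T -> R[i]) -> (T -> R[i])).
Variables (k : T -> T -> R[i]) (S0 : set T).
Hypotheses (K_proj : orthogonal_projection mu L K)
  (k_kernel : reproducing_kernel mu L K k S0).
Implicit Types (f g : T -> R[i]) (X : set T).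
Local Notation dotp := (dotp mu).
Local Notation norm2 := (norm2 mu).
Local Notation aeeq := (aeeq mu).
Local Notation L2 := (L2 mu).

Lemma proj_L2 f : L2 f -> L2 (K f).
Proof. by have [_ [KL2 _ _ _] _] := K_proj; exact: KL2. Qed.

Lemma proj_in f : L2 f -> L (K f).
Proof. by have [_ _ H] := K_proj => /H[]. Qed.

Lemma proj_sub f : L f -> L2 f.
Proof. by have [[H _ _ _ _] _ _] := K_proj; exact: H. Qed.

Lemma dotp_proj f g : L2 f -> L g -> dotp (K f) g = dotp f g.
Proof.
move=> Lf Lg; have [_ _ /(_ f Lf)[_ /(_ g Lg)]] := K_proj.
rewrite (_ : (fun x => _) = lin (-1) (K f) f); last first.
  by apply/funext => x; rewrite /lin mulN1r addrC.
rewrite dotp_linl//; last 2 first.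
- exact: proj_L2.
- exact: proj_sub.
by rewrite mulN1r addrC => /eqP; rewrite subr_eq0 => /eqP.
Qed.

Lemma dotp_projl f g : L2 f -> L2 g -> dotp (K f) g = dotp (K f) (K g).
Proof.
move=> Lf Lg; rewrite (dotpC Lg (proj_L2 Lf)) (dotpC (proj_L2 Lg) (proj_L2 Lf)).
by rewrite [in RHS]dotp_proj//; exact: proj_in.
Qed.

Lemma kernel_L2 x : S0 x -> L2 (k^~ x).
Proof. by have [_ _ _ H _] := k_kernel => /H/proj_sub. Qed.

Lemma kernel_diag x : S0 x -> k x x = (norm2 (k^~ x))%:C.
Proof. by move=> Sx; have [_ _ _ _ [_ ->]] := k_kernel => //; rewrite dotpff. Qed.

Lemma kernel_conj x y : S0 x -> S0 y -> k y x = conjc (k x y).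
Proof.
move=> Sx Sy; have [_ _ _ _ [_ H]] := k_kernel.
by rewrite !H// -dotpC//; exact: kernel_L2.
Qed.

Lemma kernel_ae : {ae mu, forall x, S0 x}.
Proof.
have [_ [mS S00] _ _ _] := k_kernel.
by exists (~` S0); split => //; exact: measurableC.
Qed.

Lemma kernel_meas : cmeasurable (fun p : T * T => k p.1 p.2).
Proof. by case: k_kernel. Qed.

Lemma kernel_section_meas x : cmeasurable (k^~ x).
Proof.
exact: (cmeasurable_comp (pair2_measurable x) kernel_meas).
Qed.

Lemma kernel_diag_meas : cmeasurable (fun x => k x x).
Proof.
have m2 : measurable_fun setT (fun x : T => (x, x)) by exact: measurable_fun_pair.
exact: (cmeasurable_comp m2 kernel_meas).
Qed.

Lemma evaluation_proj f : L2 f -> aeeq (evaluation mu k f) (K f).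
Proof.
move=> Lf; have [_ _ _ kL [kev _]] := k_kernel.
have := kev _ (proj_in Lf); apply: filterS2 kernel_ae => x Sx /(_ I) -> _.
by rewrite dotp_proj//; exact: kL.
Qed.

Lemma evaluation_id f : L f -> aeeq (evaluation mu k f) f.
Proof.
by move=> Lf; have [_ _ _ _ [kev _]] := k_kernel; exact/aeeq_sym/kev.
Qed.

Lemma evaluation_meas f : cmeasurable f -> cmeasurable (evaluation mu k f).
Proof.
move=> mf.
have mk' : cmeasurable (fun p : T * T => f p.2 * conjc (k p.2 p.1)).
  apply: cmeasurableM; first exact: cmeasurable_comp measurable_snd mf.
  apply: cmeasurableJ.
  exact: (cmeasurable_comp (measurable_fun_pair measurable_snd measurable_fst) kernel_meas).
by case: mk' => m1 m2; split; [exact: (measurable_section_Rintegral sf m1)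
  |exact: (measurable_section_Rintegral sf m2)].
Qed.

Definition kernel_mass X x : R := norm2 (restrict_op X (k^~ x)).

Lemma normc2_restrict X f x :
  normc (restrict_op X f x) ^+ 2 = \1_X x * normc (f x) ^+ 2.
Proof.
rewrite /restrict_op ComplexField.Normc.normcM normc_real exprMn indicE.
by case: (_ \in _); rewrite ?normr1 ?normr0 ?expr1n ?expr0n.
Qed.

Lemma kernel_mass_ge0 X x : 0 <= kernel_mass X x.
Proof. exact: norm2_ge0. Qed.

Lemma kernel_massE X x : measurable X -> S0 x ->
  (kernel_mass X x)%:E = (\int[mu]_y (\1_X y * normc (k y x) ^+ 2)%:E)%E.
Proof.
move=> mX Sx; rewrite norm2E; last exact/L2_restrict/kernel_L2.
by apply: eq_integral => y _; rewrite normc2_restrict.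
Qed.

Lemma kernel_mass_meas X : measurable X -> measurable_fun setT (kernel_mass X).
Proof.
move=> mX; rewrite /kernel_mass /Defs.norm2.
apply: (measurable_section_Rintegral sf
  (h := fun p => normc (restrict_op X (k^~ p.1) p.2) ^+ 2)).
apply: measurable_normc2; apply: cmeasurableM.
- apply: cmeasurable_real.
  exact: measurable_indic_snd.
- exact: (cmeasurable_comp (measurable_fun_pair measurable_snd measurable_fst) kernel_meas).
Qed.

Lemma kernel_massC X x : measurable X -> S0 x ->
  kernel_mass X x + kernel_mass (~` X) x = complex.Re (k x x).
Proof.
move=> mX Sx; rewrite kernel_diag//=; apply: EFin_inj.
have mX' := measurableC mX.
have m1 Y : measurable Y ->
    measurable_fun setT (fun y => (\1_Y y * normc (k y x) ^+ 2)%:E).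
  move=> mY; apply/measurable_EFinP; apply: measurable_funM.
    exact: measurable_indic.
  exact/measurable_normc2/kernel_section_meas.
rewrite EFinD !kernel_massE// -ge0_integralD//; last 4 first.
- by move=> y _; rewrite lee_fin mulr_ge0 ?indic_ge0 ?sqr_ge0.
- exact: m1.
- by move=> y _; rewrite lee_fin mulr_ge0 ?indic_ge0 ?sqr_ge0.
- exact: m1.
rewrite norm2E; last exact: kernel_L2.
apply: eq_integral => y _; rewrite -EFinD -mulrDl !indicE in_setC.
by case: (_ \in _); rewrite ?addr0 ?add0r mul1r.
Qed.

(* Tonelli and |k(y,x)| = |k(x,y)| *)
Lemma kernel_mass_sym X Y : measurable X -> measurable Y ->
  (\int[mu]_x (\1_Y x * kernel_mass X x)%:E =
   \int[mu]_x (\1_X x * kernel_mass Y x)%:E)%E.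
Proof.
move=> mX mY.
pose h (p : T * T) := (\1_Y p.1 * \1_X p.2 * normc (k p.2 p.1) ^+ 2)%:E.
have m1 Z : measurable Z -> measurable_fun setT (fun p : T * T => \1_Z p.1 : R).
  exact: measurable_indic_fst.
have m2 Z : measurable Z -> measurable_fun setT (fun p : T * T => \1_Z p.2 : R).
  exact: measurable_indic_snd.
have mh : measurable_fun setT h.
  apply/measurable_EFinP; apply: measurable_funM.
    by apply: measurable_funM; [exact: m1|exact: m2].
  apply: (@measurable_normc2 _ _ _ (fun p : T * T => k p.2 p.1)).
  exact: (cmeasurable_comp (measurable_fun_pair measurable_snd measurable_fst) kernel_meas).
have mh' : measurable_fun setT (fun p => h (p.2, p.1)).
  by apply: (measurableT_comp mh); exact: measurable_fun_pair.
have h0 p : (0 <= h p)%E.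
  by rewrite lee_fin mulr_ge0 ?sqr_ge0// mulr_ge0 ?indic_ge0.
transitivity (\int[mu]_x \int[mu]_y h (x, y))%E.
  apply: ge0_ae_eq_integral => //.
  - apply/measurable_EFinP; apply: measurable_funM.
      exact: measurable_indic.
    exact: kernel_mass_meas.
  - exact: measurable_section_integral.
  - by move=> x _; rewrite lee_fin mulr_ge0 ?indic_ge0 ?kernel_mass_ge0.
  - by move=> x _; exact: integral_ge0.
  apply: filterS kernel_ae => x Sx _; rewrite EFinM kernel_massE//.
  rewrite -ge0_integralZl_EFin//; last 2 first.
  - by move=> y _; rewrite lee_fin mulr_ge0 ?indic_ge0 ?sqr_ge0.
  - apply/measurable_EFinP; apply: measurable_funM.
      exact: measurable_indic.
    exact/measurable_normc2/kernel_section_meas.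
  by apply: eq_integral => y _; rewrite -EFinM mulrA.
rewrite (sf_tonelli sf mh h0).
apply: ge0_ae_eq_integral => //.
- exact: (measurable_section_integral sf (h := fun p => h (p.2, p.1))).
- apply/measurable_EFinP; apply: measurable_funM.
    exact: measurable_indic.
  exact: kernel_mass_meas.
- by move=> x _; exact: integral_ge0.
- by move=> x _; rewrite lee_fin mulr_ge0 ?indic_ge0 ?kernel_mass_ge0.
apply: filterS kernel_ae => y Sy _; rewrite EFinM kernel_massE//.
rewrite -ge0_integralZl_EFin//; last 2 first.
- by move=> x _; rewrite lee_fin mulr_ge0 ?indic_ge0 ?sqr_ge0.
- apply/measurable_EFinP; apply: measurable_funM.
    exact: measurable_indic.
  exact/measurable_normc2/kernel_section_meas.
apply: ge0_ae_eq_integral => //.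
- by apply: (measurableT_comp mh); exact: pair2_measurable.
- apply/measurable_EFinP; apply: measurable_funM; first exact: measurable_cst.
  apply: measurable_funM; first exact: measurable_indic.
  exact/measurable_normc2/kernel_section_meas.
- by move=> x _; rewrite lee_fin mulr_ge0 ?indic_ge0// mulr_ge0 ?indic_ge0 ?sqr_ge0.
apply: filterS kernel_ae => x Sx _; rewrite /h /=.
by rewrite -EFinM (kernel_conj Sx Sy) normc_conj; congr EFin; ring.
Qed.

Lemma kernel_mass_setT x : kernel_mass setT x = norm2 (k^~ x).
Proof.
by congr norm2; apply/funext => y; rewrite /restrict_op indicT mul1r.
Qed.

(** Symmetry of the kernel mass against the whole space, where the mass of a section is its full
    squared norm, hence the diagonal value. *)
Lemma integral_kernel_mass X : measurable X ->
  (\int[mu]_x (kernel_mass X x)%:E =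
   \int[mu]_x (\1_X x * complex.Re (k x x))%:E)%E.
Proof.
move=> mX; have := kernel_mass_sym mX measurableT.
rewrite (eq_integral (fun x => (kernel_mass X x)%:E)); last first.
  by move=> x _; rewrite indicT mul1r.
move=> ->; apply: ae_eq_integral => //.
- apply/measurable_EFinP; apply: measurable_funM; first exact: measurable_indic.
  exact: kernel_mass_meas.
- apply/measurable_EFinP; apply: measurable_funM; first exact: measurable_indic.
  by have [] := kernel_diag_meas.
apply: filterS kernel_ae => x Sx _.
by rewrite kernel_mass_setT (kernel_diag Sx).
Qed.

End Kernel.

(** * Traces of compressions *)

Section PositiveOperators.
Context d (T : measurableType d) (R : realType).
Variable mu : {measure set T -> \bar R}.
Implicit Types (f g h : T -> R[i]) (A B : (T -> R[i]) -> (T -> R[i])).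
Local Notation dotp := (dotp mu).
Local Notation norm2 := (norm2 mu).
Local Notation aeeq := (aeeq mu).
Local Notation L2 := (L2 mu).

Lemma bounded_operator0 A : bounded_operator mu A -> aeeq (A (fun=> 0)) (fun=> 0).
Proof.
move=> [AL2 _ _ [c Ac]]; have L0 := L20 mu; apply: norm2_eq0; first exact: AL2.
apply/eqP; rewrite eq_le norm2_ge0 andbT.
by have := Ac _ L0; rewrite norm2_0 mulr0.
Qed.

Lemma bounded_operatorZ A (a : R[i]) f : bounded_operator mu A -> L2 f ->
  aeeq (A (fun x => a * f x)) (fun x => a * A f x).
Proof.
move=> bA Lf; have [AL2 Aae Alin _] := bA; have L0 := L20 mu.
have Ea : (fun x => a * f x) = (fun x => a * f x + (fun=> 0) x).
  by apply/funext => x; rewrite addr0.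
rewrite Ea; apply: aeeq_trans (Alin a f _ Lf L0) _.
by apply: filterS (bounded_operator0 bA) => x /(_ I) -> _; rewrite addr0.
Qed.

(** Polarization: <B h, h> is real for [h = f + g] and for [h = i f + g], and the two vanishing
    imaginary parts force the cross terms <B f, g> and <B g, f> to be conjugate. *)
Lemma positive_operator_sym B f g : positive_operator mu B -> L2 f -> L2 g ->
  dotp (B f) g = dotp f (B g).
Proof.
move=> [[BL2 Bae Blin _] Bpos] Lf Lg.
have LBf := BL2 _ Lf; have LBg := BL2 _ Lg.
have exp (a : R[i]) : dotp (B (lin a f g)) (lin a f g) =
    a * (conjc a * dotp (B f) f + dotp (B f) g) +
    (conjc a * dotp (B g) f + dotp (B g) g).
  rewrite (@dotp_aeeq _ _ _ _ _ (lin a (B f) (B g)) _ (lin a f g)).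
  - by rewrite dotp_linl ?dotp_linr//; exact: L2_lin.
  - exact/BL2/L2_lin.
  - exact: L2_lin.
  - exact: L2_lin.
  - exact: L2_lin.
  - exact: Blin.
  - exact: aeeq_refl.
have im0 h : L2 h -> complex.Im (dotp (B h) h) = 0.
  by move=> /Bpos/ger0_Im.
have i1 := im0 _ (L2_lin 1 Lf Lg); have i2 := im0 _ (L2_lin 'i%C Lf Lg).
rewrite exp in i1; rewrite exp in i2.
have ff := im0 _ Lf; have gg := im0 _ Lg.
rewrite (dotpC LBg Lf); move: i1 i2 ff gg.
case: (dotp (B f) f) => a1 a2; case: (dotp (B f) g) => b1 b2.
case: (dotp (B g) f) => c1 c2; case: (dotp (B g) g) => d1 d2 /= i1 i2 ff gg.
by apply: complex_eqP => /=; lra.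
Qed.

(* [v = B f - c f] satisfies [B v = - c v], which forces [v = 0] when [B >= 0]. *)
Lemma positive_operator_eigen B f (c : R) : positive_operator mu B -> L2 f ->
  0 < c -> aeeq (B (B f)) (fun x => (c ^+ 2)%:C * f x) ->
  aeeq (B f) (fun x => c%:C * f x).
Proof.
move=> [bB Bpos] Lf c0 BBf; have [BL2 Bae Blin _] := bB.
have LBf := BL2 _ Lf; pose v := lin (- c%:C) f (B f).
have Lv : L2 v by exact: L2_lin.
have Bv : aeeq (B v) (fun x => (- c)%:C * v x).
  apply: aeeq_trans (Blin (- c%:C) f (B f) Lf LBf) _.
  apply: filterS BBf => x /(_ I) -> _; rewrite /v /lin realcN expr2 realcM.
  by ring.
have LBv := BL2 _ Lv.
have LZ := L2_scale (- c)%:C Lv.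
have v0 : norm2 v = 0.
  apply/eqP; rewrite eq_le norm2_ge0 andbT.
  have := Bpos _ Lv; rewrite (@dotp_aeeq _ _ _ _ _ _ v v LBv LZ Lv Lv Bv (aeeq_refl _ _)).
  rewrite dotpZl// dotpff -realcM ler0c mulNr oppr_ge0.
  by rewrite pmulr_rle0.
apply: filterS (norm2_eq0 Lv v0) => x /(_ I); rewrite /v /lin => H _.
by rewrite -[RHS]addr0 -H mulNr addrA subrr add0r.
Qed.

End PositiveOperators.

(** * The trace of a compression as an integral over the diagonal *)

Section Trace.
Context d (T : measurableType d) (R : realType).
Variables (mu : {measure set T -> \bar R}) (sf : sigma_finite [set: T] mu).
Variables (L : set (T -> R[i])) (K : (T -> R[i]) -> (T -> R[i])).
Variables (k : T -> T -> R[i]) (S0 : set T).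
Hypotheses (K_proj : orthogonal_projection mu L K)
  (k_kernel : reproducing_kernel mu L K k S0).
Variables (X : set T) (mX : measurable X).
Implicit Types (f g : T -> R[i]).
Local Notation dotp := (dotp mu).
Local Notation norm2 := (norm2 mu).
Local Notation aeeq := (aeeq mu).
Local Notation L2 := (L2 mu).
Local Notation M := (compression K X).
Local Notation N f := (K (restrict_op X f)).

Lemma dotp_restrict f g : dotp (restrict_op X f) g = dotp f (restrict_op X g).
Proof.
rewrite /dotp; congr cintegral; apply/funext => x; rewrite /restrict_op.
by rewrite conjc_realM mulrCA mulrA.
Qed.

Lemma N_L2 f : L2 f -> L2 (N f).
Proof. by move=> Lf; apply: (proj_L2 K_proj); exact: L2_restrict. Qed.

Lemma compression_L2 f : L2 f -> L2 (M f).
Proof. by move=> Lf; apply: L2_restrict => //; exact: N_L2. Qed.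

Lemma dotp_compression f g : L2 f -> L2 g -> dotp (M f) g = dotp (N f) (N g).
Proof.
move=> Lf Lg; rewrite /compression dotp_restrict (dotp_projl K_proj)//;
  exact: L2_restrict.
Qed.

Lemma dotp_compressionff f : L2 f -> dotp (M f) f = (norm2 (N f))%:C.
Proof. by move=> Lf; rewrite dotp_compression// dotpff. Qed.

Lemma compression_sym f g : L2 f -> L2 g -> dotp (M f) g = dotp f (M g).
Proof.
move=> Lf Lg; rewrite dotp_compression// (dotpC (compression_L2 Lg) Lf).
by rewrite dotp_compression// -(dotpC (N_L2 Lg) (N_L2 Lf)).
Qed.

(** Kept extended real, since its finiteness is established only later, from the trace-class
    assumption. *)
Definition kernel_trace : \bar R :=
  (\int[mu]_x (\1_X x * complex.Re (k x x))%:E)%E.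

(** This form shows the value at [x] as a coefficient of one fixed vector, the restricted section at
    [x], so that Bessel and Parseval apply pointwise in [x]. *)
Lemma normc2_N f : L2 f -> {ae mu, forall x,
  normc (N f x) ^+ 2 = normc (dotp (restrict_op X (k^~ x)) f) ^+ 2}.
Proof.
move=> Lf; have Lr := L2_restrict mX Lf.
apply: filterS2 (kernel_ae k_kernel) (evaluation_proj K_proj k_kernel Lr).
move=> x Sx /(_ I) <-; rewrite /evaluation dotp_restrict.
have Lk := kernel_L2 K_proj k_kernel Sx.
by rewrite (dotpC (L2_restrict mX Lk) Lf) normc_conj.
Qed.

Lemma dotp_kernel_meas f : L2 f -> measurable_fun setT (fun x =>
  normc (evaluation mu k (restrict_op X f) x) ^+ 2).
Proof.
move=> Lf; apply: measurable_normc2; apply: (evaluation_meas sf k_kernel).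
exact: (L2_meas (L2_restrict mX Lf)).
Qed.

Lemma norm2_NE f : L2 f -> (norm2 (N f))%:E =
  (\int[mu]_x (normc (evaluation mu k (restrict_op X f) x) ^+ 2)%:E)%E.
Proof.
move=> Lf; rewrite norm2E; last exact: N_L2.
apply: ge0_ae_eq_integral => //.
- by apply/measurable_EFinP; apply: measurable_normc2; exact: (L2_meas (N_L2 Lf)).
- by apply/measurable_EFinP; exact: dotp_kernel_meas.
- by move=> x _; rewrite lee_fin sqr_ge0.
- by move=> x _; rewrite lee_fin sqr_ge0.
have := evaluation_proj K_proj k_kernel (L2_restrict mX Lf).
by apply: filterS => x /(_ I) ->.
Qed.

(* Parseval for the kernel sections turns the sum over the basis into the
   integral of the kernel mass. *)
Lemma kernel_trace_basis e : suborthonormal mu e ->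
  (forall g, L2 g -> (forall j, dotp g (e j) = 0) -> aeeq g (fun=> 0)) ->
  (\sum_(j <oo) (norm2 (N (e j)))%:E = kernel_trace)%E.
Proof.
move=> eo ec; have [Le _ _] := eo.
rewrite (eq_eseriesr (fun j _ => norm2_NE (Le j))) -integral_nneseries//; last 2 first.
- by move=> j; apply/measurable_EFinP; exact: dotp_kernel_meas.
- by move=> j x _; rewrite lee_fin sqr_ge0.
rewrite /kernel_trace -(integral_kernel_mass sf K_proj k_kernel mX).
apply: ge0_ae_eq_integral => //.
- apply: ge0_emeasurable_sum => j x; first by rewrite lee_fin sqr_ge0.
  by apply/measurable_EFinP; exact: dotp_kernel_meas.
- by apply/measurable_EFinP; exact: (kernel_mass_meas sf k_kernel).
- by move=> x _; apply: nneseries_ge0 => j _ _; rewrite lee_fin sqr_ge0.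
- by move=> x _; rewrite lee_fin kernel_mass_ge0.
apply: filterS (kernel_ae k_kernel) => x Sx _.
have Lk := kernel_L2 K_proj k_kernel Sx.
rewrite -(parseval (L2_restrict mX Lk) eo ec).
apply: eq_eseriesr => j _; rewrite /evaluation dotp_restrict.
by rewrite (dotpC (L2_restrict mX Lk) (Le j)) normc_conj.
Qed.

(** * Eigenvalues of the compression against its trace and absolute value *)

Section Spectral.
Variable s : spectral_data mu K X.

Definition eigfun := zero_ext (sd_index s) (sd_eigfun s).
(** The default 0 goes with the zero vector of [eigfun]: the eigenvalue equation and the
    monotonicity both survive beyond a finite index set. *)
Definition eigval j := if j \in sd_index s then sd_eigval s j else 0.

Lemma eigfun_suborthonormal : suborthonormal mu eigfun.
Proof. exact/suborthonormal_zero_ext/sd_orthonormal. Qed.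

Lemma eigfun_L2 j : L2 (eigfun j).
Proof. by case: eigfun_suborthonormal. Qed.

Lemma eigval_bound j : 0 <= eigval j <= 1.
Proof.
rewrite /eigval; case: ifPn => [/set_mem/sd_eigval_bound//|_].
by rewrite lexx ler01.
Qed.

Lemma compression_eigfun j : aeeq (M (eigfun j)) (fun x => (eigval j)%:C * eigfun j x).
Proof.
rewrite /eigfun /eigval /zero_ext; case: ifPn => [/set_mem/sd_eigen//|_].
have L0 := L20 mu; have LM := compression_L2 L0.
apply: (@aeeq_trans _ _ _ _ _ (fun=> 0)); last by apply: aeW => x _; rewrite mul0r.
apply: norm2_eq0 => //; apply: complexI; rewrite -dotpff.
have [_ bK _] := K_proj.
have r0 : restrict_op X (fun=> 0) = (fun=> 0) :> (T -> R[i]).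
  by apply/funext => x; rewrite /restrict_op mulr0.
rewrite /compression r0 dotp_restrict.
have LK := proj_L2 K_proj L0.
rewrite (dotp_aeeq LK L0 _ _ (bounded_operator0 bK) (aeeq_refl _ _)) ?dotp0l//.
- by apply: L2_restrict => //; exact: L2_restrict.
- by apply: L2_restrict => //; exact: L2_restrict.
Qed.

(** Convergence of the spectral series in L^2 passes to its inner product with [f], and <M f, f> is
    [norm2 (N f)] because M is [N^* N]. *)
Lemma spectral_norm2 f : L2 f ->
  (\sum_(j <oo) (eigval j * normc (dotp f (eigfun j)) ^+ 2)%:E = (norm2 (N f))%:E)%E.
Proof.
move=> Lf; have [Le _] := sd_orthonormal s.
pose c j := (sd_eigval s j)%:C * dotp f (sd_eigfun s j).
have Ls n := @dotp_sum _ _ _ mu _ (index_iota 0 n) (fun j => j \in sd_index s) c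
  (sd_eigfun s) f (fun j jD => Le j (set_mem jD)) Lf.
have E n : complex.Re (dotp (fun x => \sum_(0 <= j < n | j \in sd_index s)
    c j * sd_eigfun s j x) f) =
    \sum_(0 <= j < n) eigval j * normc (dotp f (eigfun j)) ^+ 2.
  rewrite (Ls n).2 big_mkcond.
  rewrite (_ : complex.Re (\sum_(0 <= j < n) _) = \sum_(0 <= j < n)
    complex.Re (if j \in sd_index s then c j * dotp (sd_eigfun s j) f else 0)).
    apply: eq_bigr => j _; rewrite /eigval /eigfun /zero_ext.
    case: ifPn => [/set_mem jD|_]; last by rewrite mul0r.
    by rewrite /c -mulrA (dotpC Lf (Le _ jD)) mulcJ -realcM.
  by elim/big_ind2 : _ => // x1 x2 y1 y2 <- <-; rewrite cReD.
have := L2_cvg_dotp (fun n => (Ls n).1) (compression_L2 Lf) Lf (sd_spectral s Lf).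
rewrite dotp_compressionff// [complex.Re (_%:C)]/= => H.
apply/cvg_lim => //.
under eq_fun do rewrite sumEFin.
apply: cvg_EFin; first exact: nearW.
rewrite (_ : fine \o _ = (fun n => complex.Re (dotp (fun x =>
  \sum_(0 <= j < n | j \in sd_index s) c j * sd_eigfun s j x) f)))//.
by apply/funext => n; rewrite E.
Qed.

(** Each [norm2 (N (e i))] is expanded over the eigenfunctions and the two sums are exchanged; what
    multiplies the [j]-th eigenvalue is then a Bessel sum of [eigfun j] in the basis, at most 1. *)
Lemma kernel_trace_le_eigval D e : hilbert_basis mu D e ->
  (kernel_trace <= \sum_(j <oo) (eigval j)%:E)%E.
Proof.
move=> [eo ec]; have eo' := suborthonormal_zero_ext eo; have [Le _ _] := eo'.
rewrite -(kernel_trace_basis eo' (zero_ext_complete ec)).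
rewrite (eq_eseriesr (fun j _ => esym (spectral_norm2 (Le j)))).
rewrite nneseries_interchange; last first.
  move=> i j; rewrite lee_fin mulr_ge0 ?sqr_ge0//.
  by have /andP[] := eigval_bound j.
apply: lee_nneseries => [j _ _|j _].
  apply: nneseries_ge0 => i _ _; rewrite lee_fin mulr_ge0 ?sqr_ge0//.
  by have /andP[] := eigval_bound j.
under eq_eseriesr do rewrite EFinM.
have e0 := andP (eigval_bound j).
rewrite nneseriesZl; last by move=> i _; rewrite lee_fin sqr_ge0.
rewrite -[leRHS]mule1; apply: lee_wpmul2l; first by rewrite lee_fin; case: e0.
have Lj := eigfun_L2 j.
under eq_eseriesr do rewrite (dotpC Lj (Le _)) normc_conj.
apply: le_trans (bessel_series Lj eo') _; rewrite lee_fin.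
have [_ _ ne] := eigfun_suborthonormal.
by case: (ne j) => [->|->//]; rewrite norm2_0.
Qed.

(** Since B and M are symmetric, <B f, B g> = <M f, M g> gives B (B phi) = mu^2 phi when tested
    against every vector, and positivity of B selects the root mu. For mu = 0 the same identity
    makes the norm of B phi vanish. *)
Lemma absolute_value_eigfun B j : absolute_value mu M B ->
  aeeq (B (eigfun j)) (fun x => (eigval j)%:C * eigfun j x).
Proof.
move=> [Bpos BM]; have [[BL2 _ _ _] _] := Bpos.
have Lj := eigfun_L2 j; have LBj := BL2 _ Lj.
have Mj := compression_eigfun j; have LMj := compression_L2 Lj.
have dM g : L2 g -> dotp (M (eigfun j)) g = (eigval j)%:C * dotp (eigfun j) g.
  move=> Lg; rewrite -dotpZl//; apply: dotp_aeeq => //; first exact: L2_scale.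
  exact: aeeq_refl.
have [e0 _] := andP (eigval_bound j).
have [e00|ep] := eqVneq (eigval j) 0.
  apply: (@aeeq_trans _ _ _ _ _ (fun=> 0)); last by apply: aeW => x _; rewrite e00 mul0r.
  apply: norm2_eq0 => //; apply: complexI; rewrite -dotpff BM// dM//.
  by rewrite e00 mul0r.
apply: positive_operator_eigen => //; first by rewrite lt0r ep.
have LBB := BL2 _ LBj.
pose w := lin (- (eigval j ^+ 2)%:C) (eigfun j) (B (B (eigfun j))).
have Lw : L2 w by exact: L2_lin.
have dw g : L2 g -> dotp w g = 0.
  move=> Lg; rewrite dotp_linl// (positive_operator_sym Bpos)// BM// dM;
    last exact: compression_L2.
  rewrite -(compression_sym Lj Lg) dM// expr2 realcM.
  by rewrite mulrA mulNr addNr.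
have w0 : norm2 w = 0 by apply: complexI; rewrite -dotpff dw.
apply: filterS (norm2_eq0 Lw w0) => x /(_ I); rewrite /w /lin => H _.
by rewrite -[RHS]addr0 -H mulNr addrA subrr add0r.
Qed.

(* [B] and [M] agree on the span of the eigenfunctions; splitting off the first
   [n] coordinates of [f] leaves the nonnegative term [<B r, r>]. *)
Lemma norm2_le_absolute_value B f : absolute_value mu M B -> L2 f ->
  norm2 (N f) <= complex.Re (dotp (B f) f).
Proof.
move=> BM Lf; have [Bpos _] := BM; have [[BL2 Bae Blin _] Bge0] := Bpos.
have eo := eigfun_suborthonormal.
pose r n := remainder mu f eigfun n.
have Lr n : L2 (r n) by exact: remainder_L2.
have E n : complex.Re (dotp (B (r n)) (r n)) = complex.Re (dotp (B f) f) -
    \sum_(0 <= j < n) eigval j * normc (dotp f (eigfun j)) ^+ 2.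
  elim: n => [|n IH]; first by rewrite big_nil subr0.
  have Ln := eigfun_L2 n; have LBn := BL2 _ Ln; have LBr := BL2 _ (Lr n).
  have rS : r n.+1 = lin (- dotp f (eigfun n)) (eigfun n) (r n) by [].
  have dBn g : L2 g -> dotp (B (eigfun n)) g = (eigval n)%:C * dotp (eigfun n) g.
    move=> Lg; rewrite -dotpZl//; apply: dotp_aeeq => //; first exact: L2_scale.
      exact: (absolute_value_eigfun n BM).
    exact: aeeq_refl.
  have -> : dotp (B (r n.+1)) (r n.+1) =
      dotp (lin (- dotp f (eigfun n)) (B (eigfun n)) (B (r n))) (r n.+1).
    apply: dotp_aeeq => //; first exact: BL2.
    - exact: L2_lin.
    - exact: Blin.
    - exact: aeeq_refl.
  rewrite dotp_linl// dBn// (dotpC (Lr n.+1) Ln) dotp_remainder// ltnSn.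
  rewrite conjc0 !mulr0 add0r rS dotp_linr//.
  rewrite (dotpC Ln LBr) -(positive_operator_sym Bpos)// dBn//.
  rewrite (dotpC (Lr n) Ln) dotp_remainder// ltnn.
  rewrite big_nat_recr// cReD IH normc2E.
  set c := dotp f (eigfun n); case: c => a b /=; ring.
rewrite -lee_fin -spectral_norm2//; apply: lime_le.
  apply: is_cvg_nneseries => j _ _; rewrite lee_fin mulr_ge0 ?sqr_ge0//.
  by have /andP[] := eigval_bound j.
apply: nearW => n; rewrite sumEFin lee_fin -subr_ge0 -E.
by have := Bge0 _ (Lr n); rewrite lecE => /andP[].
Qed.

Lemma kernel_trace_lty : trace_class mu M -> (kernel_trace < +oo)%E.
Proof.
move=> [_ [B [D [e [BM [eo ec] Boo]]]]].
have eo' := suborthonormal_zero_ext eo; have [Le _ _] := eo'.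
have [[[BL2 _ _ _] Bge0] _] := BM.
apply: le_lt_trans Boo.
rewrite -(kernel_trace_basis eo' (zero_ext_complete ec)) esum_mkcond -nneseries_esumT.
  apply: lee_nneseries => [j _ _|j _]; first by rewrite lee_fin norm2_ge0.
  apply: (@le_trans _ _ (complex.Re (dotp (B (zero_ext D e j)) (zero_ext D e j)))%:E).
    by rewrite lee_fin norm2_le_absolute_value.
  by rewrite /zero_ext; case: ifPn => // _; rewrite dotp0r.
move=> j; case: ifPn => // /set_mem jD.
by have := Bge0 _ (eo.1 _ jD); rewrite lecE lee_fin => /andP[].
Qed.

Lemma trace_compression : trace_class mu M -> trace mu M = (fine kernel_trace)%:C.
Proof.
move=> tM; have Toy := kernel_trace_lty tM.
have T0 : (0 <= kernel_trace)%E.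
  rewrite /kernel_trace -(integral_kernel_mass sf K_proj k_kernel mX).
  by apply: integral_ge0 => x _; rewrite lee_fin kernel_mass_ge0.
have TE : kernel_trace = (fine kernel_trace)%:E by rewrite fineK// ge0_fin_numE.
set P := [set t : R[i] | forall D e, hilbert_basis mu D e ->
  normc (\sum_(0 <= j < n | j \in D) dotp (M (e j)) (e j) - t) @[n --> \oo] --> (0 : R)].
have Pt : P (fine kernel_trace)%:C.
  move=> D e [eo ec]; have eo' := suborthonormal_zero_ext eo; have [Le _ _] := eo'.
  have := kernel_trace_basis eo' (zero_ext_complete ec); rewrite TE => H.
  have cv : (fun n => \sum_(0 <= j < n) norm2 (N (zero_ext D e j))) @ \oo --> fine kernel_trace.
    have := is_cvg_nneseries (fun j _ _ =>
      norm2_ge0 mu (N (zero_ext D e j)) : (0 <= (norm2 _)%:E)%E).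
    move=> /(_ xpredT 0%N); rewrite /cvg_to H.
    under eq_fun do rewrite sumEFin.
    by move/fine_cvg.
  have SE n : \sum_(0 <= j < n | j \in D) dotp (M (e j)) (e j) =
      (\sum_(0 <= j < n) norm2 (N (zero_ext D e j)))%:C.
    rewrite big_mkcond (rmorph_sum (real_complex R)); apply: eq_bigr => j _.
    transitivity (dotp (M (zero_ext D e j)) (zero_ext D e j)).
      by rewrite /zero_ext; case: ifPn => // _; rewrite dotp0r.
    by rewrite dotp_compressionff.
  under eq_fun do rewrite SE -realcN -realcD normc_real.
  have cv0 : (fun n => `|\sum_(0 <= j < n) norm2 (N (zero_ext D e j)) -
      fine kernel_trace|) @ \oo --> `|fine kernel_trace - fine kernel_trace|.
    by apply: cvg_norm; apply: cvgB => //; exact: cvg_cst.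
  by move: cv0; rewrite subrr normr0.
(* Two candidate traces can be compared only along an actual Hilbert basis; the trace-class witness
   provides one. *)
have [_ [B [D [e [_ hb _]]]]] := tM.
apply: xget_unique => // t Pt'.
have := cvgD (Pt _ _ hb) (Pt' _ _ hb); rewrite addr0 => H.
apply/esym/eqP; rewrite -subr_eq0; apply/eqP/ComplexField.Normc.eq0_normc.
apply/eqP; rewrite eq_le normc_ge0 andbT -[leRHS](cvg_lim _ (H _))//.
apply: limr_ge; first by apply/cvg_ex; exists 0; exact: (H _).
apply: nearW => n; pose S := \sum_(0 <= j < n | j \in D) dotp (M (e j)) (e j).
change (normc ((fine kernel_trace)%:C - t) <=
  normc (S - (fine kernel_trace)%:C) + normc (S - t)).
rewrite (_ : _ - t = - (S - (fine kernel_trace)%:C) + (S - t)); last first.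
  by rewrite opprB addrA subrK.
by apply: le_trans (le_normcD _ _) _; rewrite normcN.
Qed.

End Spectral.
End Trace.

(** * The accumulated spectrogram *)

Section RealIntegrals.
Context d (T : measurableType d) (R : realType).
Variable mu : {measure set T -> \bar R}.
Local Notation Ri u := (mu.-integrable setT (EFin \o u)).

Lemma Rintegrable_scale (r : R) (u : T -> R) : Ri u ->
  Ri (fun x => r * u x) /\
  (\int[mu]_x (r * u x))%R = r * (\int[mu]_x u x)%R.
Proof.
move=> ui; split; last by rewrite RintegralZl.
by have := integrableZl measurableT r ui; apply: eq_integrable => // x _; rewrite /= EFinM.
Qed.

Lemma Rintegrable_add (u v : T -> R) : Ri u -> Ri v ->
  Ri (fun x => u x + v x) /\
  (\int[mu]_x (u x + v x))%R = (\int[mu]_x u x)%R + (\int[mu]_x v x)%R.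
Proof.
by move=> ui vi; split; [exact: (integrableD measurableT ui vi)|rewrite RintegralD].
Qed.

Lemma Rintegrable_sub (u v : T -> R) : Ri u -> Ri v ->
  Ri (fun x => u x - v x) /\
  (\int[mu]_x (u x - v x))%R = (\int[mu]_x u x)%R - (\int[mu]_x v x)%R.
Proof.
by move=> ui vi; split; [exact: (integrableB measurableT ui vi)|rewrite RintegralB].
Qed.

Lemma Rintegrable_sum (u : nat -> T -> R) n : (forall j, Ri (u j)) ->
  Ri (fun x => \sum_(0 <= j < n) u j x) /\
  (\int[mu]_x (\sum_(0 <= j < n) u j x))%R = \sum_(0 <= j < n) (\int[mu]_x u j x)%R.
Proof.
move=> ui; elim: n => [|n [IH1 IH2]].
  rewrite (_ : (fun x => _) = cst 0); last by apply/funext => x; rewrite big_nil.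
  rewrite big_nil; split; first exact: (integrable0 mu setT).
  by rewrite /Rintegral integral0.
rewrite (_ : (fun x => _) = (fun x => \sum_(0 <= j < n) u j x + u n x)); last first.
  by apply/funext => x; rewrite big_nat_recr.
have [H1 H2] := Rintegrable_add IH1 (ui n).
by split => //; rewrite H2 IH2 big_nat_recr.
Qed.

Lemma Rintegrable_ge0 (u : T -> R) : measurable_fun setT u ->
  (forall x, 0 <= u x) -> (\int[mu]_x (u x)%:E < +oo)%E -> Ri u.
Proof.
move=> m_u u0 uoo; apply/integrableP; split; first exact/measurable_EFinP.
by under eq_integral do rewrite /= ger0_norm//.
Qed.

Lemma ae_le_Rintegral (u v : T -> R) : Ri u -> Ri v ->
  {ae mu, forall x, u x <= v x} -> (\int[mu]_x u x)%R <= (\int[mu]_x v x)%R.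
Proof.
move=> ui vi uv; rewrite -subr_ge0.
have [wi <-] := Rintegrable_sub vi ui.
have mw : measurable_fun setT (fun x => v x - u x).
  by apply/measurable_EFinP; exact: measurable_int wi.
have -> : (\int[mu]_x (v x - u x))%R = (\int[mu]_x `|v x - u x|)%R.
  rewrite /Rintegral; congr fine; apply: ae_eq_integral => //.
  - exact/measurable_EFinP.
  - by apply/measurable_EFinP; exact: measurableT_comp.
  - by apply: filterS uv => x uvx _; rewrite ger0_norm// subr_ge0.
by apply: Rintegral_ge0 => x _.
Qed.

Lemma ae_integral_le (g b : T -> R) : measurable_fun setT g ->
  (forall x, 0 <= g x) -> Ri b -> {ae mu, forall x, g x <= b x} ->
  (\int[mu]_x (g x)%:E <= ((\int[mu]_x b x)%R)%:E)%E.
Proof.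
move=> mg g0 bi gb.
have mb : measurable_fun setT b by apply/measurable_EFinP; exact: measurable_int bi.
(* The bound [b] is nonnegative only almost everywhere, so its absolute value serves as a majorant
   that is nonnegative everywhere. *)
apply: (@le_trans _ _ (\int[mu]_x (`|b x|)%:E)%E).
  apply: ae_ge0_le_integral => //.
  - by move=> x _; rewrite lee_fin.
  - exact/measurable_EFinP.
  - by apply/measurable_EFinP; exact: measurableT_comp.
  - by apply: filterS gb => x gbx _; rewrite lee_fin (le_trans gbx)// ler_norm.
rewrite (@ae_eq_integral _ _ _ mu setT (EFin \o b))//; last 3 first.
- by apply/measurable_EFinP; exact: measurableT_comp.
- exact/measurable_EFinP.
- by apply: filterS gb => x gbx _ /=; rewrite ger0_norm// (le_trans (g0 x)).
by rewrite /Rintegral fineK//; exact: integrable_fin_num.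
Qed.

End RealIntegrals.

Section EstimateArithmetic.
Variable R : realFieldType.
Implicit Types r U W F G : R.

(** Here [r] stands for the spectrogram, [U] for the sum of the eigenmasses and [F + G] for the
    diagonal value. The factors [1%:R] and [0%:R] are the values of the two indicators, left
    unreduced so that the statement unifies with its use. *)
Lemma estimate_inside r U W F G : `|r - U| <= W -> U <= F -> 0 <= F -> 0 <= G ->
  `|r - (F + G) * 1%:R| <= W + (F - U) + (1%:R * G + 0%:R * F).
Proof.
rewrite mulr1 mul1r mul0r addr0 !ler_norml => /andP[h1 h2] *.
by apply/andP; split; lra.
Qed.

Lemma estimate_outside r U W F G : `|r - U| <= W -> U <= F -> 0 <= F -> 0 <= G ->
  `|r - (F + G) * 0%:R| <= W + (F - U) + (0%:R * G + 1%:R * F).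
Proof.
rewrite mulr0 mul1r mul0r add0r subr0 !ler_norml => /andP[h1 h2] *.
by apply/andP; split; lra.
Qed.

(** With [e] the integral of an eigenmass, this is the L^1 cost of normalizing it; at [e = 0] the
    left side vanishes, as [0^-1 = 0]. *)
Lemma estimate_term (e : R) : 0 <= e -> e <= 1 -> `|e^-1 - 1| * e <= 1 - e.
Proof.
move=> e0 e1; have [->|en0] := eqVneq e 0; first by rewrite mulr0 subr0.
have ep : 0 < e by rewrite lt0r en0.
rewrite ger0_norm; last by rewrite subr_ge0 invf_ge1.
by rewrite mulrBl mulVf// mul1r.
Qed.

Lemma estimate_total (W n A t V : R) : W <= n - A -> t - A <= V -> n < t + 1 ->
  W + (t - A) + (V + V) <= 1 + 4 * V.
Proof. by move=> *; lra. Qed.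

End EstimateArithmetic.

(** * The L^1 estimate for a fixed set *)

Section Estimate.
Context d (T : measurableType d) (R : realType).
Variables (mu : {measure set T -> \bar R}) (sf : sigma_finite [set: T] mu).
Variables (L : set (T -> R[i])) (K : (T -> R[i]) -> (T -> R[i])).
Variables (k : T -> T -> R[i]) (S0 : set T).
Hypotheses (K_proj : orthogonal_projection mu L K)
  (k_kernel : reproducing_kernel mu L K k S0).
Variables (X : set T) (mX : measurable X).
Variable s : spectral_data mu K X.
Hypothesis M_trace : trace_class mu (compression K X).
Implicit Types (f g : T -> R[i]).
Local Notation dotp := (dotp mu).
Local Notation norm2 := (norm2 mu).
Local Notation aeeq := (aeeq mu).
Local Notation L2 := (L2 mu).
Local Notation N f := (K (restrict_op X f)).
Local Notation Ri u := (mu.-integrable setT (EFin \o u)).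
Local Notation phi := (eigfun s).
Local Notation ev := (eigval s).
Local Notation phi_L2 := (eigfun_L2 s).
Local Notation F := (kernel_mass mu k X).
Local Notation G := (kernel_mass mu k (~` X)).
Local Notation rank := (upper_trace mu K X).

Definition kernel_traceR : R := fine (kernel_trace mu k X).
(** Defined from the kernel alone, so that the estimate is purely operator-theoretic; the link with
    the number of points is made through the moments. *)
Definition kernel_var : R := (\int[mu]_x (\1_(~` X) x * F x))%R.
Local Notation tr := kernel_traceR.
Local Notation V := kernel_var.

Lemma kernel_traceE : kernel_trace mu k X = tr%:E.
Proof.
have Toy := kernel_trace_lty sf K_proj k_kernel mX s M_trace.
rewrite fineK// ge0_fin_numE// /kernel_trace.
rewrite -(integral_kernel_mass sf K_proj k_kernel mX).
by apply: integral_ge0 => x _; rewrite lee_fin kernel_mass_ge0.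
Qed.

Lemma kernel_mass_integrable : Ri F /\ (\int[mu]_x F x)%R = tr.
Proof.
have E := integral_kernel_mass sf K_proj k_kernel mX.
split; last by rewrite /Rintegral E.
apply: Rintegrable_ge0; first exact: (kernel_mass_meas sf k_kernel).
- exact: kernel_mass_ge0.
- by rewrite E -/(kernel_trace mu k X) kernel_traceE ltry.
Qed.

Lemma indic_integrable (Y : set T) (u : T -> R) : measurable Y -> Ri u ->
  Ri (fun x => \1_Y x * u x).
Proof.
move=> mY ui.
have m_u : measurable_fun setT u by apply/measurable_EFinP; exact: measurable_int ui.
apply: le_integrable ui => //.
  by apply/measurable_EFinP; apply: measurable_funM => //; exact: measurable_indic.
move=> x _ /=; rewrite lee_fin normrM indicE.
by case: (_ \in _); rewrite ?normr1 ?normr0 ?mul1r ?mul0r.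
Qed.

Lemma kernel_varE : (\int[mu]_x (\1_(~` X) x * F x)%:E)%E = V%:E.
Proof.
rewrite /V /Rintegral fineK//; apply: integrable_fin_num => //.
apply: indic_integrable; first exact: measurableC.
by case: kernel_mass_integrable.
Qed.

Lemma kernel_massC_integrable : Ri (fun x => \1_X x * G x) /\
  (\int[mu]_x (\1_X x * G x))%R = V.
Proof.
have mX' := measurableC mX.
have E := kernel_mass_sym sf K_proj k_kernel mX' mX.
split; last by rewrite /Rintegral E kernel_varE.
apply: Rintegrable_ge0; last by rewrite E kernel_varE ltry.
- apply: measurable_funM; first exact: measurable_indic.
  exact: (kernel_mass_meas sf k_kernel).
- by move=> x; rewrite mulr_ge0 ?indic_ge0 ?kernel_mass_ge0.
Qed.

Definition eigmass j x : R := normc (N (phi j) x) ^+ 2.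
Local Notation u := eigmass.

Lemma norm2_N_eigfun j : norm2 (N (phi j)) = ev j * norm2 (phi j).
Proof.
have Lj := phi_L2 j; have LM := compression_L2 K_proj mX Lj.
apply: complexI; rewrite -(dotp_compressionff K_proj mX Lj).
rewrite (@dotp_aeeq _ _ _ _ _ (fun x => (ev j)%:C * phi j x) _ (phi j))//.
- by rewrite dotpZl// dotpff -realcM.
- exact: L2_scale.
- exact: (compression_eigfun K_proj mX s j).
- exact: aeeq_refl.
Qed.

Lemma eigval_norm2 j : ev j * norm2 (phi j) = ev j.
Proof.
rewrite /eigval /eigfun /zero_ext; case: ifPn => [/set_mem jD|_]; last by rewrite mul0r.
have [_ /(_ j j jD jD)] := sd_orthonormal s.
by rewrite dotpff eqxx => -[->]; rewrite mulr1.
Qed.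

Lemma eigmass_integrable j : Ri (u j) /\ (\int[mu]_x u j x)%R = ev j.
Proof.
split; first exact: (L2_integrable (N_L2 K_proj mX (phi_L2 j))).
by rewrite -/(norm2 (N (phi j))) norm2_N_eigfun eigval_norm2.
Qed.

Let Fi := kernel_mass_integrable.
Let Gi := kernel_massC_integrable.
Let ui := eigmass_integrable.

Lemma sum_eigmass_le n : {ae mu, forall x, \sum_(0 <= j < n) u j x <= F x}.
Proof.
have H j := normc2_N K_proj k_kernel mX (phi_L2 j).
have := ae_foralln H; apply: filterS2 (kernel_ae k_kernel) => x Sx Hx.
have Lk := L2_restrict mX (kernel_L2 K_proj k_kernel Sx).
rewrite (eq_bigr (fun j => normc (dotp (restrict_op X (k^~ x)) (phi j)) ^+ 2)).
  exact: (bessel Lk (eigfun_suborthonormal s)).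
by move=> j _; exact: Hx.
Qed.

Lemma sum_eigval_le n : \sum_(0 <= j < n) ev j <= tr.
Proof.
have [ni <-] := Fi.
have [si si'] := Rintegrable_sum n (fun j => (ui j).1).
rewrite (eq_bigr (fun j => (\int[mu]_x u j x)%R)); last by move=> j _; rewrite (ui j).2.
by rewrite -si'; apply: ae_le_Rintegral => //; exact: sum_eigmass_le.
Qed.

(** On [X] the [j]-th eigenmass integrates to the squared norm of the compressed eigenfunction,
    [ev j ^+ 2], which leaves [ev j - ev j ^+ 2] outside; there the pointwise Bessel bound by the
    kernel mass is integrated. *)
Lemma sum_eigval_var_le n : \sum_(0 <= j < n) ev j * (1 - ev j) <= V.
Proof.
have mX' := measurableC mX.
have [ni _] := Fi; have vi := indic_integrable mX' ni.
have wi j : Ri (fun x => \1_(~` X) x * u j x) /\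
    (\int[mu]_x (\1_(~` X) x * u j x))%R = ev j * (1 - ev j).
  have [uj uj'] := ui j; split; first exact: indic_integrable.
  rewrite mulrBr mulr1 -{1}uj'.
  have xi := indic_integrable mX uj.
  have -> : ev j * ev j = (\int[mu]_x (\1_X x * u j x))%R.
    have Lj := phi_L2 j; have LM := compression_L2 K_proj mX Lj.
    have -> : (\int[mu]_x (\1_X x * u j x))%R = norm2 (compression K X (phi j)).
      by apply: eq_Rintegral => x _; rewrite /compression normc2_restrict.
    have LZ := L2_scale (ev j)%:C Lj.
    rewrite (norm2_aeeq LM LZ (compression_eigfun K_proj mX s j)) norm2Z//.
    rewrite normc_real real_normK ?num_real//.
    by rewrite expr2 -mulrA eigval_norm2.
  have [_ <-] := Rintegrable_sub uj xi.
  apply: eq_Rintegral => x _; rewrite !indicE in_setC.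
  by case: (_ \in _); rewrite ?mul0r ?mul1r ?subrr ?subr0.
have [si si'] := Rintegrable_sum n (fun j => (wi j).1).
rewrite (eq_bigr (fun j => (\int[mu]_x (\1_(~` X) x * u j x))%R)); last first.
  by move=> j _; rewrite (wi j).2.
rewrite -si'; apply: ae_le_Rintegral => //.
apply: filterS (sum_eigmass_le n) => x H.
by rewrite -mulr_sumr ler_wpM2l// indic_ge0.
Qed.

(** Trading the eigenvalue series for bounds on its partial sums keeps the arguments that follow
    finite. *)
Lemma trace_le_eigval (C : R) :
  (forall n, \sum_(0 <= j < n) ev j <= C) -> tr <= C.
Proof.
move=> H; have [_ [B [D [e [_ hb _]]]]] := M_trace.
rewrite -lee_fin -kernel_traceE.
apply: le_trans (kernel_trace_le_eigval sf K_proj k_kernel mX s hb) _.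
apply: lime_le.
  by apply: is_cvg_nneseries => j _ _; rewrite lee_fin; have /andP[] := eigval_bound s j.
by apply: nearW => n; rewrite sumEFin lee_fin.
Qed.

Lemma tr_ge0 : 0 <= tr.
Proof. by have [_ <-] := Fi; apply: Rintegral_ge0 => x _; exact: kernel_mass_ge0. Qed.

Lemma kernel_var_ge0 : 0 <= V.
Proof.
by apply: Rintegral_ge0 => x _; rewrite mulr_ge0 ?indic_ge0 ?kernel_mass_ge0.
Qed.

Lemma rankE : rank%:R = (Num.ceil tr)%:~R :> R.
Proof.
rewrite /upper_trace (trace_compression sf K_proj k_kernel mX s M_trace) /= -/tr.
rewrite -[in RHS](@gez0_abs (Num.ceil tr)) ?pmulrn//.
by rewrite ceil_ge0 (lt_le_trans _ tr_ge0)// ltrN10.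
Qed.

Lemma le_rank : tr <= rank%:R.
Proof. by rewrite rankE; exact: ceil_ge. Qed.

Lemma rank_lt : rank%:R < tr + 1.
Proof. by rewrite rankE -ltrBlDr; have := ceilB1_lt tr; rewrite rmorphB. Qed.

(** With only [m] eigenvalues, each at most 1, the trace is at most the integer [m], and so is its
    ceiling. The spectrogram thus never refers to an index outside the spectral data. *)
Lemma rank_index j : (j < rank)%N -> sd_index s j.
Proof.
have [-> //|[[m Dm] _]] := sd_indexP s; rewrite Dm => jr /=.
apply: leq_trans jr _; rewrite -(ler_nat R) rankE.
have trm : tr <= m%:R.
  apply: trace_le_eigval => n.
  apply: (@le_trans _ _ (\sum_(0 <= j < n) (j < m)%:R)).
    apply: ler_sum => i _; rewrite /eigval Dm; case: ifPn => [/set_mem im|_].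
      have iD : sd_index s i by rewrite Dm.
      have /andP[_ i1] := sd_eigval_bound iD.
      by rewrite (_ : (i < m)%N = true).
    by rewrite ler0n.
  rewrite -natr_sum ler_nat; suff -> : (\sum_(0 <= j < n) (j < m) = minn n m)%N.
    exact: geq_minr.
  elim: n => [|n IH]; first by rewrite big_nil min0n.
  rewrite big_nat_recr//= IH; case: (ltnP n m) => h.
    by rewrite (minn_idPl h) addn1.
  by rewrite (minn_idPr (leqW h)) addn0.
by have := trm; rewrite pmulrn -ceil_le_int -(ler_int R) -pmulrn.
Qed.

Lemma eigval_noninc i j : (i <= j)%N -> ev j <= ev i.
Proof.
move=> ij; rewrite /eigval; case: ifPn => [/set_mem jD|_]; last first.
  by have /andP[] := eigval_bound s i.
have iD : sd_index s i.
  have [-> //|[[m Dm] _]] := sd_indexP s; move: jD; rewrite Dm /=.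
  exact: leq_ltn_trans.
by rewrite mem_set// sd_eigval_noninc.
Qed.

(* With [th = ev (rank - 1)], [ev j (1 - ev j)] is at least [th (1 - ev j)] for
   [j < rank] and at least [(1 - th) ev j] for [j >= rank]; since [tr <= rank],
   the sum of these bounds dominates the tail of the trace. *)
Lemma eigval_tail : tr - \sum_(0 <= j < rank) ev j <= V.
Proof.
have [r0|r0] := posnP rank.
  rewrite r0 big_nil subr0; apply: le_trans kernel_var_ge0.
  by have := le_rank; rewrite r0.
pose A := \sum_(0 <= j < rank) ev j.
pose theta := ev rank.-1.
have /andP[th0 th1] := eigval_bound s rank.-1.
rewrite lerBlDr; apply: trace_le_eigval => n.
have [nr|rn] := leqP n rank.
  apply: (@le_trans _ _ A); last by rewrite lerDr kernel_var_ge0.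
  rewrite /A (big_cat_nat _ nr)//= lerDl sumr_ge0// => j _.
  by have /andP[] := eigval_bound s j.
rewrite (big_cat_nat _ (ltnW rn))//= addrC lerD2r.
set B := \sum_(rank <= j < n) ev j.
have AB : A + B <= tr by rewrite /A /B -big_cat_nat ?(ltnW rn)//; exact: sum_eigval_le.
have H : theta * (rank%:R - A) + (1 - theta) * B <= V.
  apply: le_trans (sum_eigval_var_le n).
  rewrite (big_cat_nat _ (ltnW rn))//=; apply: lerD.
    have -> : theta * (rank%:R - A) = \sum_(0 <= j < rank) theta * (1 - ev j).
      by rewrite -mulr_sumr sumrB big_const_nat iter_addr_0 subn0.
    apply: ler_sum_nat => j /andP[_ jr].
    apply: ler_wpM2r; first by rewrite subr_ge0; have /andP[] := eigval_bound s j.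
    by apply: eigval_noninc; rewrite -ltnS prednK.
  rewrite /B mulr_sumr; apply: ler_sum_nat => j /andP[jr _].
  rewrite mulrC; apply: ler_wpM2l; first by have /andP[] := eigval_bound s j.
  by rewrite lerD2l lerN2; apply: eigval_noninc; rewrite (leq_trans (leq_pred _)).
have H2 : B <= rank%:R - A by have := le_rank; lra.
apply: le_trans H; rewrite -subr_ge0.
have -> : theta * (rank%:R - A) + (1 - theta) * B - B = theta * (rank%:R - A - B).
  by ring.
by rewrite mulr_ge0// subr_ge0.
Qed.

Lemma sqrt_eigfun j : sd_index s j -> 0 < sd_eigval s j ->
  aeeq (sd_sqrt s (sd_eigfun s j))
       (fun x => (Num.sqrt (sd_eigval s j))%:C * sd_eigfun s j x).
Proof.
move=> jD ep; have [Bpos BB] := sd_sqrtP s; have Lj := (sd_orthonormal s).1 _ jD.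
apply: (positive_operator_eigen Bpos Lj); first by rewrite sqrtr_gt0.
rewrite sqr_sqrtr ?(ltW ep)//; apply: aeeq_trans (BB _ Lj) _.
exact: sd_eigen.
Qed.

(** The polar factor is prescribed on the range of the square root; a positive eigenvalue puts the
    eigenfunction in that range, up to almost everywhere equality and the factor
    [Num.sqrt (sd_eigval s j)]. *)
Lemma polar_eigfun j : sd_index s j -> 0 < sd_eigval s j ->
  aeeq (sd_polar s (sd_eigfun s j))
       (fun x => (Num.sqrt (sd_eigval s j))^-1%:C * N (sd_eigfun s j) x).
Proof.
move=> jD ep; have Lj := (sd_orthonormal s).1 _ jD.
have [[[BL2 _ _ _] _] _] := sd_sqrtP s.
have bW := sd_polar_bounded s; have [WL2 Wae _ _] := bW.
set c := Num.sqrt (sd_eigval s j).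
have c0 : c != 0 by rewrite gt_eqF// sqrtr_gt0.
have H1 := Wae _ _ (BL2 _ Lj) (L2_scale c%:C Lj) (sqrt_eigfun jD ep).
have H2 := bounded_operatorZ c%:C bW Lj.
have H3 := sd_polarP s Lj.
have := aeeq_trans (aeeq_sym (aeeq_trans H1 H2)) H3.
apply: filterS => x /(_ I) <- _.
by rewrite mulrA -realcM mulVf// mul1r.
Qed.

(* For a zero eigenvalue both sides vanish, since 0^-1 = 0. *)
Lemma spectrogram_term j : sd_index s j -> {ae mu, forall x,
  normc (evaluation mu k (sd_polar s (sd_eigfun s j)) x) ^+ 2 =
  (ev j)^-1 * u j x}.
Proof.
move=> jD; have Lj := (sd_orthonormal s).1 _ jD.
have [WL2 _ _ _] := sd_polar_bounded s.
have ej : ev j = sd_eigval s j by rewrite /eigval mem_set.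
have fj : phi j = sd_eigfun s j by rewrite /eigfun /zero_ext mem_set.
rewrite /eigmass fj ej.
have [e0|ep] := eqVneq (sd_eigval s j) 0.
  have W0 : aeeq (sd_polar s (sd_eigfun s j)) (fun=> 0).
    apply: sd_polar_ker => //; apply: aeeq_trans (sd_eigen jD) _.
    by apply: aeW => x _; rewrite e0 mul0r.
  apply: filterS (kernel_ae k_kernel) => x Sx.
  have Lk := kernel_L2 K_proj k_kernel Sx.
  rewrite /evaluation (dotp_aeeq (WL2 _ Lj) (L20 mu) Lk Lk W0 (aeeq_refl _ _)).
  by rewrite dotp0l normc2_0 e0 invr0 mul0r.
have {}ep : 0 < sd_eigval s j by rewrite lt0r ep; have /andP[] := sd_eigval_bound jD.
have P1 := polar_eigfun jD ep.
have LP : L (sd_polar s (sd_eigfun s j)).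
  have [[_ Lae L0 Llin _] _ _] := K_proj.
  apply: Lae (aeeq_sym P1); last exact: WL2.
  rewrite (_ : (fun x => _) = (fun x =>
      (Num.sqrt (sd_eigval s j))^-1%:C * N (sd_eigfun s j) x + (fun=> 0) x)).
    by apply: Llin => //; apply: (proj_in K_proj); exact: L2_restrict.
  by apply/funext => x; rewrite addr0.
apply: filterS2 P1 (evaluation_id k_kernel LP) => x /(_ I) E1 /(_ I) ->.
rewrite E1 ComplexField.Normc.normcM normc_real exprMn real_normK ?num_real//.
by rewrite exprVn sqr_sqrtr// ltW.
Qed.

Lemma acc_spectrogram_ae : {ae mu, forall x, acc_spectrogram k s x =
  \sum_(0 <= j < rank) (ev j)^-1 * u j x}.
Proof.
have H j : {ae mu, forall x, sd_index s j ->
    normc (evaluation mu k (sd_polar s (sd_eigfun s j)) x) ^+ 2 =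
    (ev j)^-1 * u j x}.
  have [jD|jD] := pselect (sd_index s j); last by apply: aeW => x.
  by apply: filterS (spectrogram_term jD) => x + _.
have := ae_foralln H; apply: filterS => x Hx.
rewrite /acc_spectrogram; apply: eq_big_nat => j /andP[_ jr].
by apply: Hx; exact: (rank_index jr).
Qed.

Lemma acc_spectrogram_meas : measurable_fun setT (acc_spectrogram k s).
Proof.
have [WL2 _ _ _] := sd_polar_bounded s.
(* The eigenfunctions are unconstrained outside the index set; the default 0 makes every term
   measurable and alters none below [rank]. *)
pose h j x := if j \in sd_index s then
  normc (evaluation mu k (sd_polar s (sd_eigfun s j)) x) ^+ 2 else 0.
have -> : acc_spectrogram k s = (fun x => \sum_(0 <= j < rank) h j x).
  apply/funext => x; apply: eq_big_nat => j /andP[_ jr].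
  by rewrite /h mem_set//; exact: (rank_index jr).
apply: measurable_sum => j; rewrite /h; case: (boolP (j \in sd_index s)) => [/set_mem jD|_];
  last exact: measurable_cst.
apply: measurable_normc2; apply: (evaluation_meas sf k_kernel).
exact: (L2_meas (WL2 _ ((sd_orthonormal s).1 _ jD))).
Qed.

(* Compare the spectrogram first with the sum of the [u j], [j < rank], then with
   the kernel mass of [X], which differs from [k x x] by the mass of the
   complement on [X]; the three errors are at most [rank - A], [tr - A] and
   [2 V], where [A] is the sum of the first [rank] eigenvalues. *)
Theorem spectrogram_estimate :
  (\int[mu]_x (normc ((acc_spectrogram k s x)%:C - k x x * (\1_X x)%:C))%:E
     <= (1 + 4 * V)%:E)%E.
Proof.
have mX' := measurableC mX.
have [Fint FT] := Fi; have [Gint GV] := Gi.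
have F'int := indic_integrable mX' Fint.
have wi j := Rintegrable_scale `|(ev j)^-1 - 1| (ui j).1.
have [wint wT] := Rintegrable_sum rank (fun j => (wi j).1).
have [uint uT] := Rintegrable_sum rank (fun j => (ui j).1).
have [bi1 bT1] := Rintegrable_sub Fint uint.
have [bi2 bT2] := Rintegrable_add wint bi1.
have [bi3 bT3] := Rintegrable_add Gint F'int.
have [bi bT] := Rintegrable_add bi2 bi3.
set b := (fun x => _ + _) in bi bT.
have hb : {ae mu, forall x,
    normc ((acc_spectrogram k s x)%:C - k x x * (\1_X x)%:C) <= b x}.
  near=> x.
  have Sx : S0 x by near: x; exact: (kernel_ae k_kernel).
  have rx : acc_spectrogram k s x = \sum_(0 <= j < rank) (ev j)^-1 * u j x.
    by near: x; exact: acc_spectrogram_ae.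
  have ux : \sum_(0 <= j < rank) u j x <= F x.
    by near: x; exact: (sum_eigmass_le).
  have kx := kernel_massC K_proj k_kernel mX Sx.
  have kxx : k x x = (complex.Re (k x x))%:C by rewrite (kernel_diag k_kernel Sx).
  have F0 := kernel_mass_ge0 mu k X x; have G0 := kernel_mass_ge0 mu k (~` X) x.
  rewrite kxx -realcM -realcN -realcD normc_real -kx rx.
  have wE : `|\sum_(0 <= j < rank) (ev j)^-1 * u j x - \sum_(0 <= j < rank) u j x|
     <= \sum_(0 <= j < rank) `|(ev j)^-1 - 1| * u j x.
    rewrite -sumrB; apply: le_trans (ler_norm_sum _ _ _) _.
    apply: ler_sum => j _; rewrite (_ : _ - _ = ((ev j)^-1 - 1) * u j x).
      have u0 : 0 <= u j x by exact: sqr_ge0.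
      by rewrite normrM (ger0_norm u0).
    by rewrite mulrBl mul1r.
  rewrite /b !indicE in_setC; case: (x \in X);
    [exact: estimate_inside wE ux F0 G0|exact: estimate_outside wE ux F0 G0].
clearbody b.
have mh : measurable_fun setT
    (fun x => normc ((acc_spectrogram k s x)%:C - k x x * (\1_X x)%:C)).
  apply: (@measurable_normc _ _ _ (fun x => (acc_spectrogram k s x)%:C - k x x * (\1_X x)%:C)).
  have -> : (fun x => (acc_spectrogram k s x)%:C - k x x * (\1_X x)%:C) =
      (fun x => (acc_spectrogram k s x)%:C + k x x * (- \1_X x)%:C).
    by apply/funext => x; rewrite realcN mulrN.
  apply: cmeasurableD.
    exact: (cmeasurable_real acc_spectrogram_meas).
  apply: cmeasurableM; first exact: (kernel_diag_meas k_kernel).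
  apply: cmeasurable_real; apply: (@measurable_funN _ _ _ _ (\1_X : T -> R)).
  exact: measurable_indic.
apply: le_trans (ae_integral_le mh (fun x => normc_ge0 _) bi hb) _.
rewrite lee_fin bT bT2 bT1 bT3 wT uT FT GV -/kernel_var.
have -> : \sum_(0 <= j < rank) (\int[mu]_x u j x)%R = \sum_(0 <= j < rank) ev j.
  by apply: eq_bigr => j _; exact: (ui j).2.
have -> : \sum_(0 <= j < rank) (\int[mu]_x (`|(ev j)^-1 - 1| * u j x))%R =
    \sum_(0 <= j < rank) `|(ev j)^-1 - 1| * ev j.
  by apply: eq_bigr => j _; rewrite (wi j).2 (ui j).2.
have wle : \sum_(0 <= j < rank) `|(ev j)^-1 - 1| * ev j <=
    rank%:R - \sum_(0 <= j < rank) ev j.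
  have -> : rank%:R = \sum_(0 <= j < rank) 1 :> R.
    by rewrite big_const_nat iter_addr_0 subn0.
  rewrite -sumrB; apply: ler_sum => j _.
  have /andP[e0 e1] := eigval_bound s j.
  exact: estimate_term.
exact: (estimate_total wle (eigval_tail)
  (rank_lt)).
Unshelve. all: by end_near. Qed.

End Estimate.

(** * Simple configurations *)

Section MetricBorel.
Context (R : realType) (S : completeMetricType R).
Implicit Types (x : S) (A : set (borel S)).

Lemma metric_ball_open x (r : R) : open (ball x r : set S).
Proof.
rewrite openE => y; rewrite ballEmdist /= => xy.
apply/nbhs_ballP; exists (r - mdist x y) => /=; first by rewrite subr_gt0.
move=> z; rewrite !ballEmdist /= => yz.
by apply: le_lt_trans (metric_triangle x y z) _; rewrite -ltrBrDl.
Qed.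

Lemma open_borel (U : set S) : open U -> measurable (U : set (borel S)).
Proof. by move=> oU; apply: sub_sigma_algebra. Qed.

Lemma measurable_borel1 x : measurable ([set x] : set (borel S)).
Proof. by apply: Defs.compact_measurable; exact: compact_set1. Qed.

(** An exhaustion consists of precompact sets, whereas local trace class is tested on bounded ones.
    The balls of integer radius around one point cover the compact closure, and finitely many
    suffice. *)
Lemma precompact_bounded (A : set S) : precompact A -> bounded_subset A.
Proof.
rewrite precompactE => cA; exists point.
have cov : cover_compact (closure A) by rewrite -compact_cover.
have [] := cov nat setT (fun n => ball (point : S) n%:R).
- by move=> n _; exact: metric_ball_open.
- move=> y _; exists (Num.truncn (mdist point y)).+1 => //.
  by rewrite ballEmdist /= truncnS_gt.
move=> D _ AD; exists (\max_(i <- finmap.enum_fset D) i)%N%:R => y /subset_closure /AD[n /= nD].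
rewrite !ballEmdist /= => /lt_le_trans; apply; rewrite ler_nat.
by apply: (leq_bigmax_seq (F := id)) => //; exact: nD.
Qed.

Section Config.
Variable xi : config S.
Local Notation m := (config_measure xi).

Lemma config_integer A : measurable A -> (m A < +oo)%E ->
  exists n : nat, m A = n%:R%:E.
Proof. by case: xi => ? [? H] /=; exact: H. Qed.

Lemma config_radon (C : set S) : compact C -> (m C < +oo)%E.
Proof. by case: xi => ? [H ?] /=; exact: H. Qed.

Lemma config_precompact A : measurable A -> precompact (A : set S) -> (m A < +oo)%E.
Proof.
move=> mA; rewrite precompactE => /[dup] cA /config_radon; apply: le_lt_trans.
apply: le_measure; rewrite ?inE//; first exact: Defs.compact_measurable.
exact: subset_closure.
Qed.

Lemma config_lt1 A : measurable A -> (m A < 1)%E -> m A = 0%E.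
Proof.
move=> mA m1; have [|n mn] := config_integer mA; first exact: lt_trans m1 (ltry _).
by move: m1; rewrite mn lte_fin (ltr_nat _ n 1) ltnS leqn0 => /eqP ->.
Qed.

(** Small balls around [x], cut down to a compact neighbourhood so that their mass is finite, have
    masses decreasing to that of the point. A mass below 1 is 0 by integrality. *)
Lemma config_null_nbhs x : locally_compact [set: S] -> m [set x] = 0%E ->
  exists U : set S, [/\ open U, U x & m U = 0%E].
Proof.
move=> lc x0; have [B xB [cB _]] := lc x I.
have {}xB : nbhs x B by move: xB; rewrite /within /=; apply: filterS => y; exact.
pose F n : set (borel S) := ball x n.+1%:R^-1 `&` B°.
have oF n : open (F n : set S).
  by apply: openI; [exact: metric_ball_open|exact: open_interior].
have mF n : measurable (F n) by exact: open_borel.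
have F1 : \bigcap_n F n = [set x].
  apply/seteqP; split => [y yF|_ ->] /=; last first.
    by move=> n _; split => //; exact: ballxx.
  have xy0 : mdist x y <= 0.
    apply/ler_addgt0Pr => e e0; rewrite add0r.
    have /ltr_add_invr[n] := e0; rewrite add0r => ne.
    have [] := yF n I; rewrite ballEmdist /= => xy _.
    by rewrite ltW// (lt_trans xy).
  by apply/esym/mdist_positivity/eqP; rewrite eq_le xy0 mdist_ge0.
have mF0 : (m (F 0%N) < +oo)%E.
  apply: le_lt_trans (config_radon cB); apply: le_measure; rewrite ?inE//.
    exact: Defs.compact_measurable.
  by move=> y [_]; exact: interior_subset.
have F1m : measurable (\bigcap_n F n) by rewrite F1; exact: measurable_borel1.
have nF : nonincreasing_seq F.
  move=> i j ij; apply/subsetPset => y [yj yB]; split => //.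
  by apply: le_ball yj; rewrite lef_pV2 ?posrE// ler_nat.
have := nonincreasing_cvg_mu mF0 mF F1m nF; rewrite F1 x0 => c0.
have [n Hn] : exists n, (m (F n) < 1)%E.
  apply: contrapT => /forallNP H; have cF : cvgn (m \o F) by apply/cvg_ex; exists 0%E.
  have : (1%E <= limn (m \o F))%E.
    by apply: lime_ge => //; apply: nearW => n /=; rewrite leNgt; exact/negP/H.
  by rewrite (cvg_lim _ c0)// lee_fin ler10.
exists (F n); split => //; last exact: config_lt1.
by split => //; exact: ballxx.
Qed.

Lemma simple_supp x : locally_compact [set: S] -> simple_config xi ->
  supp xi x <-> m [set x] = 1%E.
Proof.
move=> lc sx; split => [xs|x1 U oU Ux].
  have [x0|//] := sx x; have [U [oU Ux U0]] := config_null_nbhs lc x0.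
  by have := xs U oU Ux; rewrite U0 ltxx.
apply: (@lt_le_trans _ _ (m [set x])); first by rewrite x1.
apply: le_measure; rewrite ?inE//; [exact: measurable_borel1|exact: open_borel|].
by move=> _ ->.
Qed.

(** A point off the support lies in a null open set, hence in a null ball with centre in a countable
    dense set and radius [n.+1%:R^-1]; there are countably many such balls. *)
Lemma ae_supp : separable_space S -> {ae m, forall x, supp xi x}.
Proof.
move=> [A cA dA].
have [f fA] : exists f : nat -> S, A `<=` range f.
  have [A0|[f]] := pfcard_geP cA.
    have [|x [_]] := dA setT _ openT; first by exists point.
    by rewrite A0.
  by exists f => x /(@surj _ _ _ _ f)[n _ <-]; exists n.
pose V (p : nat * nat) : set (borel S) := ball (f p.1) p.2.+1%:R^-1.
pose F n : set (borel S) :=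
  if unpickle n is Some p then if m (V p) == 0%E then V p else set0 else set0.
have F0 n : {ae m, forall x, ~ F n x}.
  rewrite /F; case: unpickle => [p|]; last by apply: aeW => x [].
  case: eqP => [p0|_]; last by apply: aeW => x [].
  exists (V p); split => //; first by apply: open_borel; exact: metric_ball_open.
  by move=> x /= /contrapT.
have := ae_foralln F0; apply: filterS => x xF U oU Ux.
rewrite lt0e measure_ge0 andbT; apply/eqP => U0.
have /nbhs_ballP[e /= e0 xeU] : nbhs x U by exact: open_nbhs_nbhs.
have [n ne] : exists n : nat, n.+1%:R^-1 < e / 2.
  have /ltr_add_invr[n] : 0 < e / 2 by rewrite divr_gt0.
  by rewrite add0r; exists n.
have n0 : 0 < n.+1%:R^-1 :> R by rewrite invr_gt0.
have [|a [xa /fA[p _ pa]]] := dA _ _ (metric_ball_open x n.+1%:R^-1).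
  by exists x; exact: ballxx.
apply: (xF (pickle (p, n))); rewrite /F pickleK /V /=.
case: eqP => [_|[]]; first by rewrite pa; exact: ball_sym.
apply/eqP; rewrite eq_le measure_ge0 andbT -U0; apply: le_measure; rewrite ?inE.
- by apply: open_borel; exact: metric_ball_open.
- exact: open_borel.
move=> z az; apply: xeU; rewrite (splitr e); apply: (le_ball (ltW (ltrD ne ne))).
by apply: ball_triangle az; rewrite pa.
Qed.

Lemma measure_seq1 (s : seq (borel S)) : uniq s ->
  (forall x, x \in s -> m [set x] = 1%E) ->
  measurable [set` s] /\ m [set` s] = (size s)%:R%:E.
Proof.
elim: s => [_ _|a s IH /= /andP[aN us] s1].
  rewrite (_ : [set` [::]] = set0) ?measure0//.
  by apply/seteqP; split.
have [|ms Es] := IH us; first by move=> x xs; apply: s1; rewrite in_cons xs orbT.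
rewrite (_ : [set` a :: s] = [set a] `|` [set` s]); last first.
  apply/seteqP; split => x /=; rewrite in_cons; first by case/orP => [/eqP|]; [left|right].
  by case => [->|->]; rewrite ?eqxx ?orbT.
split; first by apply: measurableU => //; exact: measurable_borel1.
transitivity (m [set a] + m [set` s])%E; last first.
  by rewrite Es s1 ?mem_head// -EFinD -natr1 addrC.
apply: measureU => //; first exact: measurable_borel1.
by apply/seteqP; split => // x [/= ->]; rewrite (negbTE aN).
Qed.

(** More support points in [A] than its finite integer mass would contradict monotonicity, each
    being an atom of mass 1; the part of [A] off the support is null. *)
Lemma config_count A : separable_space S -> locally_compact [set: S] ->
  simple_config xi -> measurable A -> precompact (A : set S) ->
  exists s : seq (borel S), [/\ uniq s, forall x, x \in s <-> A x /\ supp xi x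
    & m A = (size s)%:R%:E].
Proof.
move=> Ssep lc sx mA pA; have Aoo := config_precompact mA pA.
have [n mn] := config_integer mA Aoo.
have fin : finite_set (A `&` (supp xi : set (borel S))).
  apply: contrapT => /(infinite_set_fset n.+1)[B0 BA0 Bn].
  pose B : seq (borel S) := finmap.enum_fset B0.
  have BA : [set` B] `<=` A `&` (supp xi : set (borel S)) by exact: BA0.
  have [||mB EB] := @measure_seq1 B; first exact: finmap.fset_uniq.
    by move=> x xB; apply/(simple_supp _ lc sx); exact: (BA x xB).2.
  have : (m [set` B] <= m A)%E.
    by apply: le_measure; rewrite ?inE// => x /BA[].
  by rewrite EB mn lee_fin ler_nat leqNgt Bn.
have /finite_fsetP[B0 BE0] := fin.
pose B : seq (borel S) := finmap.enum_fset B0.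
have uB : uniq B by exact: finmap.fset_uniq.
have BE : A `&` (supp xi : set (borel S)) = [set` B] by rewrite BE0.
have sB x : x \in B <-> A x /\ supp xi x.
  split => [xB|xA].
    by have : [set` B] x by []; rewrite -BE.
  by have : (A `&` (supp xi : set (borel S))) x by []; rewrite BE.
exists B; split => //.
have [|mB EB] := @measure_seq1 B uB.
  by move=> x /sB[_ /(simple_supp _ lc sx)].
rewrite -EB; have [N [mN N0 sN]] := ae_supp Ssep.
have BA : [set` B] `<=` A by move=> x /= /sB[].
apply/eqP; rewrite eq_le; apply/andP; split; last first.
  by apply: le_measure; rewrite ?inE.
apply: (@le_trans _ _ (m ([set` B] `|` N))).
  apply: le_measure; rewrite ?inE//; first exact: measurableU.
  move=> x Ax; have [xs|xs] := pselect (supp xi x); last by right; exact: sN.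
  by left => /=; apply/sB.
apply: le_trans (measureU2 _ _ _) _ => //.
by rewrite [X in (_ + X)%E]N0 adde0.
Qed.

End Config.
End MetricBorel.

(** * Moments of the number of points *)

Section NonmeasurableIntegral.
Context d (T : measurableType d) (R : realType).
Variable mu : {measure set T -> \bar R}.
Local Open Scope ereal_scope.

(** The integral of a nonnegative function is a supremum over the simple functions below it, which
    is monotone even without measurability. *)
Lemma ge0_le_integralT (f g : T -> \bar R) : (forall x, 0 <= f x) ->
  (forall x, f x <= g x) -> \int[mu]_x f x <= \int[mu]_x g x.
Proof.
move=> f0 fg; have g0 x : 0 <= g x by exact: le_trans (f0 x) (fg x).
rewrite !ge0_integralTE//; apply: ge_ereal_sup => _ [h hf <-].
by apply: ereal_sup_ubound; exists h => // x; exact: le_trans (hf x) (fg x).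
Qed.

(* [f] need not be measurable: the sums over tuples of points of the support are
   only known to agree a.e. with measurable functions. *)
Lemma ae_eq_integralT (f g : T -> \bar R) : measurable_fun setT g ->
  (forall x, 0 <= f x) -> (forall x, 0 <= g x) ->
  {ae mu, forall x, f x = g x} -> \int[mu]_x f x = \int[mu]_x g x.
Proof.
move=> mg f0 g0 [N [mN N0 fgN]].
have NC x : ~ N x -> f x = g x by move=> Nx; apply: contrapT => fgx; exact/Nx/fgN.
have m1 : measurable_fun setT (fun x => (\1_N x : R)%:E).
  by apply/measurable_EFinP; exact: measurable_indic.
have m0 : measurable_fun setT (fun x => (\1_(~` N) x : R)%:E).
  by apply/measurable_EFinP; apply: measurable_indic; exact: measurableC.
have aeN : {ae mu, forall x, ~ N x}.
  by exists N; split => // x /= /contrapT.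
apply/eqP; rewrite eq_le; apply/andP; split.
(* Everywhere, [f] lies between [g] set to 0 on [N] and [g] raised to infinity on [N]; both are
   measurable and agree with [g] off a null set. *)
- apply: (@le_trans _ _ (\int[mu]_x (g x + +oo * (\1_N x)%:E))).
    apply: ge0_le_integralT => // x.
    have [Nx|Nx] := pselect (N x).
      by rewrite indicE mem_set// mule1 addey ?leey// -ltNye (lt_le_trans _ (g0 x)).
    by rewrite indicE memNset// mule0 adde0 NC.
  rewrite le_eqVlt; apply/orP; left; apply/eqP; apply: ge0_ae_eq_integral => //.
  + by apply: emeasurable_funD => //; exact: emeasurable_funM.
  + by move=> x _; rewrite adde_ge0// mule_ge0// lee_fin indicE ler0n.
  by apply: filterS aeN => x Nx _; rewrite indicE memNset// mule0 adde0.
- apply: (@le_trans _ _ (\int[mu]_x (g x * (\1_(~` N) x)%:E))).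
    rewrite le_eqVlt; apply/orP; left; apply/eqP; apply: ge0_ae_eq_integral => //.
    + exact: emeasurable_funM.
    + by move=> x _; rewrite mule_ge0// lee_fin indicE ler0n.
    by apply: filterS aeN => x Nx _; rewrite indicE mem_set// mule1.
  apply: ge0_le_integralT => x; first by rewrite mule_ge0// lee_fin indicE ler0n.
  have [Nx|Nx] := pselect (N x).
    by rewrite indicE memNset ?mule0//; apply: contrapT => /=; apply.
  by rewrite indicE mem_set// mule1 NC.
Qed.

End NonmeasurableIntegral.

Lemma esum_seq (R : realType) (T : choiceType) (Q : set T) (a : T -> \bar R)
    (l : seq T) : uniq l -> (forall t, Q t -> 0 <= a t)%E ->
  (forall t, Q t -> t \notin l -> a t = 0%E) ->
  (\esum_(t in Q) a t = \sum_(t <- l) (if t \in Q then a t else 0))%E.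
Proof.
move=> ul a0 al; rewrite esum_mkcond.
transitivity (\esum_(t in [set` l]) (if t \in Q then a t else 0))%E.
  rewrite [RHS]esum_mkcond; apply: eq_esum => t _.
  case: ifPn => [/set_mem tQ|_]; last by rewrite if_same.
  by rewrite mem_setE; case: ifPn => // tl; exact: al.
rewrite esum_fset; last 2 first.
- exact: finite_seq.
- by move=> t _; case: ifPn => // /set_mem; exact: a0.
by rewrite -fsbig_seq.
Qed.

(** * Sums over tuples of distinct points *)

Section TupleCount.
Context (R : realType) (T : choiceType).
Variables (Z : set T) (A : set T) (s : seq T).
Hypotheses (us : uniq s) (sP : forall x, x \in s <-> A x /\ Z x).

Lemma esum_1tuples :
  (\esum_(t in [set t : 1.-tuple T | uniq t /\ forall i, Z (tnth t i)])
     (\1_A (tnth t ord0) : R)%:E = (size s)%:R%:E)%E.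
Proof.
rewrite (@esum_seq _ _ _ _ [seq [tuple x] | x <- s]); last 3 first.
- by rewrite map_inj_uniq// => x y [].
- by move=> t _; rewrite lee_fin indicE ler0n.
- move=> t [_ tZ] ts; rewrite indicE memNset// => tA.
  move/negP : ts; apply; apply/mapP; exists (tnth t ord0); first exact/sP.
  by apply/eq_from_tnth => i; rewrite ord1.
rewrite big_map (eq_big_seq (fun=> 1%:E)).
  by rewrite sumEFin big_const_seq count_predT iter_addr_0.
move=> x /sP[xA xZ]; rewrite mem_set; first by rewrite indicE mem_set.
by split => // i; rewrite ord1.
Qed.

Lemma esum_2tuples :
  (\esum_(t in [set t : 2.-tuple T | uniq t /\ forall i, Z (tnth t i)])
     (\1_A (tnth t ord0) * \1_A (tnth t ord_max) : R)%:E =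
   ((size s)%:R * ((size s)%:R - 1))%:E)%E.
Proof.
rewrite (@esum_seq _ _ _ _ [seq [tuple x; y] | x <- s, y <- s]); last 3 first.
- by apply: allpairs_uniq => // [[x y]] [x' y'] _ _ /= [-> ->].
- by move=> t _; rewrite lee_fin mulr_ge0// indicE ler0n.
- move=> t [_ tZ] ts; rewrite !indicE.
  case: (asboolP (A (tnth t ord0))) => [t0|t0]; last by rewrite (memNset t0) mul0r.
  case: (asboolP (A (tnth t ord_max))) => [t1|t1]; last by rewrite (memNset t1) mulr0.
  exfalso; move/negP : ts; apply; apply/allpairsP.
  exists (tnth t ord0, tnth t ord_max); split => /=; [by apply/sP; split|by apply/sP; split|].
  apply/eq_from_tnth => i; rewrite [RHS](tnth_nth (tnth t ord0)).
  by case: i => -[|[|//]] i2 /=; congr (tnth t _); exact: val_inj.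
rewrite big_allpairs_dep /= (eq_big_seq (fun=> ((size s)%:R - 1)%:E)).
  by rewrite sumEFin big_const_seq count_predT iter_addr_0 mulr_natl.
move=> x xs; rewrite (eq_big_seq (fun y => (1 - (y == x)%:R)%:E)).
  rewrite sumEFin sumrB big_const_seq count_predT iter_addr_0; congr (_ - _)%:E.
  rewrite -natr_sum (_ : (\sum_(y <- s) (y == x) = 1)%N)//.
  rewrite (eq_bigr (fun y => if y == x then 1 else 0)%N); last by move=> y _; case: eqP.
  by rewrite -big_mkcond sum1_count (count_uniq_mem x us) xs.
move=> y ys; have [xA xZ] := (sP x).1 xs; have [yA yZ] := (sP y).1 ys.
have [->|yx] := eqVneq y x.
  by rewrite memNset ?subrr//= => -[]; rewrite inE eqxx.
rewrite subr0 mem_set; last first.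
  split; first by rewrite /= inE eq_sym yx.
  by case => -[|[|//]] i2.
by rewrite !indicE !mem_set ?mulr1.
Qed.

End TupleCount.

(** * Product measures of orders one and two *)

Section PowerMeasure.
Context d (T : measurableType d) (R : realType).
Variables (m : {measure set T -> \bar R}) (m_sf : sigma_finite [set: T] m).
Local Open Scope ereal_scope.

Lemma integral_power_step n (mu : {measure set (n.-tuple T) -> \bar R})
    (h : n.+1.-tuple T -> \bar R) : sigma_finite setT mu ->
  measurable_fun setT h -> (forall t, 0 <= h t) ->
  \int[power_step m_sf mu]_t h t = \int[mu]_p \int[m]_x h (tuple_cons (p, x)).
Proof.
move=> mu_sf mh h0.
transitivity (\int[mu \x sf_measure m_sf]_p (h \o @tuple_cons _ T n) p).
  exact: (@ge0_integral_pushforward _ _ _ _ _ _ (measurable_tuple_cons (T := T) (n := n))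
   _ setT h measurableT mh (fun t _ => h0 t)).
exact: (@fubini_tonelli1 _ _ _ _ _ (sf_measure mu_sf) (sf_measure m_sf)
  (h \o @tuple_cons _ T n)
  (measurableT_comp mh (measurable_tuple_cons (n := n))) (fun p => h0 _)).
Qed.

Lemma measurable_cons_integral n (h : n.+1.-tuple T -> \bar R) :
  measurable_fun setT h -> (forall t, 0 <= h t) ->
  measurable_fun setT (fun p => \int[m]_x h (tuple_cons (p, x))).
Proof.
move=> mh h0.
exact: (@measurable_fun_fubini_tonelli_F _ _ _ _ _ (sf_measure m_sf)
  (h \o @tuple_cons _ T n)
  (measurableT_comp mh (measurable_tuple_cons (n := n))) (fun p => h0 _)).
Qed.

Lemma integral_power1 (h : 1.-tuple T -> \bar R) :
  measurable_fun setT h -> (forall t, 0 <= h t) ->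
  \int[power_measure m_sf 1]_t h t = \int[m]_x h [tuple x].
Proof.
move=> mh h0; rewrite /= integral_power_step//; last exact: sigma_finiteT.
rewrite integral_dirac//; last exact: measurable_cons_integral.
rewrite diracT mul1e; apply: eq_integral => x _; congr h; exact: val_inj.
Qed.

Lemma power1_sigma_finite : sigma_finite setT (power_measure m_sf 1).
Proof.
have [F FT Foo] := m_sf.
have mt : measurable_fun setT (fun t : 1.-tuple T => tnth t ord0) by exact: measurable_tnth.
exists (fun n => [set t : 1.-tuple T | F n (tnth t ord0)]).
  apply/esym; rewrite -subTset => t _.
  have : setT (tnth t ord0) by []; rewrite FT => -[n _ Fn].
  by exists n.
move=> n; have [mF Fn] := Foo n.
have mG : measurable [set t : 1.-tuple T | F n (tnth t ord0)].
  by have := mt measurableT _ mF; rewrite setTI.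
split=> //; rewrite -[X in _ X < _]setIT -integral_indic//.
rewrite (@integral_power1 (fun t => (\1_[set t : 1.-tuple T | F n (tnth t ord0)] t)%:E)).
- rewrite (eq_integral (fun x => (\1_(F n) x)%:E)); last first.
    by move=> x _; congr (_%:E); rewrite !indicE; congr (nat_of_bool _)%:R.
  have -> : \int[m]_x (\1_(F n) x)%:E = m (F n); last exact: Fn.
  by rewrite integral_indic// setIT.
- by apply/measurable_EFinP; exact: measurable_indic.
- by move=> t; rewrite lee_fin indicE ler0n.
Qed.

(** [tuple_cons] prepends the new variable, so the inner integral runs over the first coordinate. *)
Lemma integral_power2 (h : 2.-tuple T -> \bar R) :
  measurable_fun setT h -> (forall t, 0 <= h t) ->
  \int[power_measure m_sf 2]_t h t = \int[m]_y \int[m]_x h [tuple x; y].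
Proof.
move=> mh h0.
transitivity (\int[power_measure m_sf 1]_p \int[m]_x h (tuple_cons (p, x))).
  exact: (integral_power_step power1_sigma_finite mh h0).
rewrite (integral_power1 (h := fun p => \int[m]_x h (tuple_cons (p, x)))).
- by apply: eq_integral => y _; apply: eq_integral => x _; congr h; exact: val_inj.
- exact: measurable_cons_integral.
- by move=> p; exact: integral_ge0.
Qed.

Variables (S0 : set T) (mS0 : measurable S0) (S00 : m (~` S0) = 0).

Lemma power1_ae : {ae power_measure m_sf 1, forall t, S0 (tnth t ord0)}.
Proof.
have mt : measurable_fun setT (fun t : 1.-tuple T => tnth t ord0) by exact: measurable_tnth.
have mC := measurableC mS0.
have mG : measurable [set t : 1.-tuple T | (~` S0) (tnth t ord0)].
  by have := mt measurableT _ mC; rewrite setTI.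
exists [set t : 1.-tuple T | (~` S0) (tnth t ord0)]; split => //.
rewrite -[X in _ X = _]setIT -integral_indic//.
rewrite (@integral_power1 (fun t => (\1_[set t : 1.-tuple T | (~` S0) (tnth t ord0)] t)%:E)).
- rewrite (eq_integral (fun x => (\1_(~` S0) x)%:E)); last first.
    by move=> x _; congr (_%:E); rewrite !indicE; congr (nat_of_bool _)%:R.
  by rewrite integral_indic// setIT.
- by apply/measurable_EFinP; exact: measurable_indic.
- by move=> t; rewrite lee_fin indicE ler0n.
Qed.

Lemma power2_ae : {ae power_measure m_sf 2, forall t,
  S0 (tnth t ord0) /\ S0 (tnth t ord_max)}.
Proof.
have mt i : measurable_fun setT (fun t : 2.-tuple T => tnth t i) by exact: measurable_tnth.
have mC := measurableC mS0.
pose B := [set t : 2.-tuple T | (~` S0) (tnth t ord0)] `|`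
          [set t : 2.-tuple T | (~` S0) (tnth t ord_max)].
have mB : measurable B.
  by apply: measurableU; [have := mt ord0 measurableT _ mC|
    have := mt ord_max measurableT _ mC]; rewrite setTI.
have aeS : {ae m, forall x, S0 x} by exists (~` S0); split.
have aeS' := aeS.
exists B; split => //; last first.
  by move=> t /= /not_andP[]; [left|right].
rewrite -[X in _ X = _]setIT -integral_indic//.
rewrite (@integral_power2 (fun t => (\1_B t)%:E)).
- rewrite (ae_eq_integralT (g := cst 0))//.
  + by rewrite integral0.
  + by move=> y; apply: integral_ge0 => x _; rewrite lee_fin indicE ler0n.
  apply: filterS aeS => y Sy; rewrite (ae_eq_integralT (g := cst 0))//.
    by rewrite integral0.
  apply: filterS aeS' => x Sx; rewrite indicE memNset//.
  by case => /=; apply.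
- by apply/measurable_EFinP; exact: measurable_indic.
- by move=> t; rewrite lee_fin indicE ler0n.
Qed.

End PowerMeasure.

Lemma det_mx22 (R : comNzRingType) (M : 'M[R]_2) :
  \det M = M ord0 ord0 * M ord_max ord_max - M ord0 ord_max * M ord_max ord0.
Proof.
rewrite (expand_det_row _ ord0) !big_ord_recl big_ord0 addr0 /cofactor !det_mx11 !mxE.
have -> : lift ord0 ord0 = ord_max :> 'I_2 by exact: val_inj.
have -> : lift ord_max ord0 = ord0 :> 'I_2 by exact: val_inj.
by rewrite /= !addn0 !addn1 expr0 expr1 mul1r mulN1r mulrN.
Qed.

(** * First two factorial moments of a determinantal process *)

Section Moments.
Context (R : realType) (S : completeMetricType R).
Variables (S_sep : separable_space S) (S_lc : locally_compact [set: S]).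
Variable m : {measure set (borel S) -> \bar R}.
Variable m_sf : sigma_finite [set: borel S] m.
Variables (L : set (borel S -> R[i])).
Variables (K : (borel S -> R[i]) -> (borel S -> R[i])).
Variables (k : borel S -> borel S -> R[i]) (S0 : set (borel S)).
Hypotheses (K_proj : orthogonal_projection m L K)
  (k_kernel : reproducing_kernel m L K k S0).
Variable P : probability (config_space S) R.
Hypothesis P_det : determinantal m_sf k P.
Variable A : set (borel S).
Hypotheses (mA : measurable A) (pA : precompact (A : set S)).
Local Notation X := (number_of_points A).

Lemma measurable_config_measure (B : set (borel S)) : measurable B ->
  measurable_fun [set: config_space S] (fun xi : config_space S => config_measure xi B).
Proof.
move=> mB _ Y mY; rewrite setTI; apply: sub_sigma_algebra.
by exists B => //; exists Y => //; rewrite setTI.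
Qed.

Lemma measurable_number_of_points : measurable_fun [set: config_space S] X.
Proof.
by apply: (measurableT_comp _ (measurable_config_measure mA)) => //.
Qed.

Lemma number_of_points_ge0 xi : 0 <= X xi.
Proof. by rewrite /number_of_points fine_ge0. Qed.

Lemma config_ae_filter : Filter (nbhs (almost_everywhere P)).
Proof. exact: (@ae_filter_ringOfSetsType _ _ _ P). Qed.

Lemma simple_count : {ae P, forall xi : config_space S, exists s : seq (borel S),
  [/\ uniq s, forall x, x \in s <-> A x /\ supp xi x & X xi = (size s)%:R]}.
Proof.
have FP := config_ae_filter.
apply: filterS P_det.1 => xi sx.
have [s [us sP mE]] := config_count S_sep S_lc sx mA pA.
by exists s; split => //; rewrite /number_of_points mE.
Qed.

Let test_compact : exists2 C : set S, compact C & A `<=` C.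
Proof. by exists (closure A); [rewrite -precompactE|exact: subset_closure]. Qed.

Lemma kernel_comp_meas d' (U : measurableType d') (f g : U -> borel S) :
  measurable_fun setT f -> measurable_fun setT g ->
  cmeasurable (fun u => k (f u) (g u)).
Proof.
move=> mf mg.
exact: (cmeasurable_comp (measurable_fun_pair mf mg) (kernel_meas k_kernel)).
Qed.

Lemma indic_comp_meas d' (U : measurableType d') (f : U -> borel S) :
  measurable_fun setT f -> measurable_fun setT (fun u => \1_A (f u) : R).
Proof.
move=> mf; have mi : measurable_fun setT (\1_A : borel S -> R) by exact: measurable_indic.
by have := measurableT_comp mi mf; exact.
Qed.

Lemma moment1 : (\int[P]_xi (X xi)%:E = kernel_trace m k A)%E.
Proof.
have FP := config_ae_filter.
pose f (t : 1.-tuple (borel S)) : R := \1_A (tnth t ord0).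
have mt : measurable_fun setT (fun t : 1.-tuple (borel S) => tnth t ord0).
  exact: measurable_tnth.
have mf : measurable_fun setT f by exact: indic_comp_meas.
have f0 t : 0 <= f t by rewrite /f indicE ler0n.
have fC : exists2 C : set S, compact C & forall t, f t != 0 -> forall i, C (tnth t i).
  have [C cC subC] := test_compact; exists C => // t ft i; rewrite ord1; apply: subC.
  by apply: contrapT => tA; move: ft; rewrite /f indicE memNset// eqxx.
have := P_det.2 1%N f mf f0 fC.
rewrite (ae_eq_integralT (g := fun xi => (X xi)%:E)); last 4 first.
- by apply/measurable_EFinP; exact: measurable_number_of_points.
- by move=> xi; apply: esum_ge0 => t _; rewrite lee_fin.
- by move=> xi; rewrite lee_fin number_of_points_ge0.
- apply: filterS simple_count => xi [s [us sP ->]].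
  exact: (esum_1tuples R us sP).
move=> ->.
pose r (t : 1.-tuple (borel S)) : R := complex.Re (k (tnth t ord0) (tnth t ord0)).
have mr : measurable_fun setT r by have [] := kernel_comp_meas mt mt.
have [_ [mS0 S00] _ _ _] := k_kernel.
have kpos x : S0 x -> 0 <= complex.Re (k x x).
  by move=> Sx; rewrite (kernel_diag k_kernel Sx) /= norm2_ge0.
(* The diagonal is known to be nonnegative only on [S0]. The absolute value makes the integrand
   nonnegative everywhere, as iterated integration requires, and changes it on a null set only. *)
transitivity (\int[power_measure m_sf 1]_t (f t * `|r t|)%:E)%E.
  under eq_integral do rewrite det_mx11 mxE.
  apply: ae_eq_integral => //.
  - by apply/measurable_EFinP; apply: measurable_funM => //; exact: mr.
  - by apply/measurable_EFinP; apply: measurable_funM => //; exact: measurableT_comp.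
  apply: filterS (power1_ae m_sf mS0 S00) => t tS _.
  by rewrite ger0_norm//; exact: kpos.
rewrite (integral_power1 m_sf (h := fun t => (f t * `|r t|)%:E)); last 2 first.
- by apply/measurable_EFinP; apply: measurable_funM => //; exact: measurableT_comp.
- by move=> t; rewrite lee_fin mulr_ge0.
rewrite /kernel_trace; apply: ae_eq_integral => //.
- apply/measurable_EFinP; apply: measurable_funM; first exact: measurable_indic.
  apply: measurableT_comp => //.
  by have [] := kernel_diag_meas k_kernel.
- apply/measurable_EFinP; apply: measurable_funM; first exact: measurable_indic.
  by have [] := kernel_diag_meas k_kernel.
apply: filterS (kernel_ae k_kernel) => x Sx _.
by rewrite /f /r /= ger0_norm//; exact: kpos.
Qed.

(** Moving the subtracted square of [normc (k x y)] to the left keeps every integral nonnegative, so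
    Tonelli applies before the factorial moment is known to be finite. *)
Lemma moment2 (t0 : R) : kernel_trace m k A = t0%:E ->
  (\int[P]_xi (X xi * (X xi - 1))%:E +
   \int[m]_x (\1_A x * kernel_mass m k A x)%:E = (t0 ^+ 2)%:E)%E.
Proof.
move=> trE; have FP := config_ae_filter.
pose f (t : 2.-tuple (borel S)) : R := \1_A (tnth t ord0) * \1_A (tnth t ord_max).
have mt i : measurable_fun setT (fun t : 2.-tuple (borel S) => tnth t i).
  exact: measurable_tnth.
have mf : measurable_fun setT f.
  by apply: measurable_funM; exact: indic_comp_meas.
have f0 t : 0 <= f t by rewrite /f mulr_ge0 ?indic_ge0.
have fC : exists2 C : set S, compact C & forall t, f t != 0 -> forall i, C (tnth t i).
  have [C cC subC] := test_compact; exists C => // t; rewrite /f mulf_eq0 negb_or.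
  move=> /andP[f1 f2]; case => -[|[|//]] i2; apply: subC; apply: contrapT => tA.
  - move: f1; rewrite indicE memNset ?eqxx// => H; apply: tA.
    by rewrite (_ : Ordinal _ = ord0)//; exact: val_inj.
  - move: f2; rewrite indicE memNset ?eqxx// => H; apply: tA.
    by rewrite (_ : Ordinal _ = ord_max)//; exact: val_inj.
have := P_det.2 2%N f mf f0 fC.
have X2ge0 : {ae P, forall xi : config_space S, 0 <= X xi * (X xi - 1)}.
  apply: filterS simple_count => xi [s [us sP ->]].
  by case: (size s) => [|n]; rewrite ?mul0r// mulr_ge0// subr_ge0 ler1n.
have mX := measurable_number_of_points.
have mX2 : measurable_fun setT (fun xi => X xi * (X xi - 1)).
  by apply: measurable_funM => //; apply: measurable_funB.
rewrite (ae_eq_integralT (g := fun xi => `|X xi * (X xi - 1)|%:E)); last 4 first.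
- by apply/measurable_EFinP; exact: measurableT_comp.
- by move=> xi; apply: esum_ge0 => t _; rewrite lee_fin.
- by move=> xi; rewrite lee_fin.
- apply: filterS2 X2ge0 simple_count => xi X0 [s [us sP Xs]].
  by rewrite ger0_norm// Xs; exact: (esum_2tuples R us sP).
have -> : (\int[P]_xi `|X xi * (X xi - 1)|%:E = \int[P]_xi (X xi * (X xi - 1))%:E)%E.
  apply: ae_eq_integral => //.
  - by apply/measurable_EFinP; exact: measurableT_comp.
  - exact/measurable_EFinP.
  - by apply: filterS X2ge0 => xi X0 _; rewrite ger0_norm.
move=> ->.
pose dt (x y : borel S) : R := complex.Re (k x x * k y y - k x y * k y x).
have mdt d' (U : measurableType d') (g h : U -> borel S) :
    measurable_fun setT g -> measurable_fun setT h ->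
    measurable_fun setT (fun u => dt (g u) (h u)).
  move=> mg mh; rewrite /dt.
  have -> : (fun u => complex.Re
      (k (g u) (g u) * k (h u) (h u) - k (g u) (h u) * k (h u) (g u))) =
    (fun u => complex.Re (k (g u) (g u) * k (h u) (h u)) -
              complex.Re (k (g u) (h u) * k (h u) (g u))).
    apply/funext => u; rewrite cReD; congr (_ + _).
    by case: (_ * _) => ? ?.
  apply: measurable_funB.
  - by have [] := cmeasurableM (kernel_comp_meas mg mg) (kernel_comp_meas mh mh).
  - by have [] := cmeasurableM (kernel_comp_meas mg mh) (kernel_comp_meas mh mg).
have dtE x y : S0 x -> S0 y -> dt x y =
    complex.Re (k x x) * complex.Re (k y y) - normc (k x y) ^+ 2.
  move=> Sx Sy; rewrite /dt (kernel_conj K_proj k_kernel Sx Sy) mulcJ.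
  by rewrite (kernel_diag k_kernel Sx) (kernel_diag k_kernel Sy) -realcM -realcN -realcD.
(* Nonnegativity of the two-point determinant is Cauchy-Schwarz for the sections at [x] and [y]. *)
have dt0 x y : S0 x -> S0 y -> 0 <= dt x y.
  move=> Sx Sy; rewrite dtE// subr_ge0.
  have [_ _ _ _ [_ H]] := k_kernel; rewrite H//.
  rewrite (kernel_diag k_kernel Sx) (kernel_diag k_kernel Sy) /= mulrC.
  by apply: cauchy_schwarz; exact: (kernel_L2 K_proj k_kernel).
have [_ [mS0 S00] _ _ _] := k_kernel.
have mh : measurable_fun setT (fun t : 2.-tuple (borel S) =>
    (f t * `|dt (tnth t ord0) (tnth t ord_max)|)%:E).
  apply/measurable_EFinP; apply: measurable_funM => //.
  by apply: measurableT_comp => //; exact: mdt.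
transitivity (\int[power_measure m_sf 2]_t
    (f t * `|dt (tnth t ord0) (tnth t ord_max)|)%:E +
    \int[m]_x (\1_A x * kernel_mass m k A x)%:E)%E.
  congr (_ + _)%E.
  have detE (t : 2.-tuple (borel S)) :
      complex.Re (\det (\matrix_(i < 2, j < 2) k (tnth t i) (tnth t j))) =
      dt (tnth t ord0) (tnth t ord_max).
    by rewrite det_mx22 !mxE.
  apply: ae_eq_integral => //.
  - apply/measurable_EFinP; apply: measurable_funM => //.
    by under eq_fun do rewrite detE; exact: mdt.
  apply: filterS (power2_ae m_sf mS0 S00) => t [tS0 tS1] _.
  by rewrite detE ger0_norm//; exact: dt0.
rewrite (integral_power2 m_sf mh); last by move=> t; rewrite lee_fin mulr_ge0.
pose q x : R := \1_A x * `|complex.Re (k x x)|.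
have mq : measurable_fun setT q.
  apply: measurable_funM; first exact: measurable_indic.
  by apply: measurableT_comp => //; have [] := kernel_diag_meas k_kernel.
have q0 x : 0 <= q x by rewrite mulr_ge0 ?indic_ge0.
have kpos x : S0 x -> 0 <= complex.Re (k x x).
  by move=> Sx; rewrite (kernel_diag k_kernel Sx) /= norm2_ge0.
have qt : (\int[m]_x (q x)%:E = t0%:E)%E.
  rewrite -trE /kernel_trace; apply: ae_eq_integral => //.
  - exact/measurable_EFinP.
  - apply/measurable_EFinP; apply: measurable_funM; first exact: measurable_indic.
    by have [] := kernel_diag_meas k_kernel.
  by apply: filterS (kernel_ae k_kernel) => x Sx _; rewrite /q ger0_norm//; exact: kpos.
pose hD (p : borel S * borel S) := (\1_A p.2 * \1_A p.1 * `|dt p.2 p.1|)%:E.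
pose hE (p : borel S * borel S) := (\1_A p.2 * \1_A p.1 * normc (k p.2 p.1) ^+ 2)%:E.
have m11 : measurable_fun setT (fun p : borel S * borel S => \1_A p.2 * \1_A p.1 : R).
  apply: measurable_funM; [exact: measurable_indic_snd|exact: measurable_indic_fst].
have mhD : measurable_fun setT hD.
  apply/measurable_EFinP; apply: measurable_funM => //.
  by apply: measurableT_comp => //; exact: mdt.
have mhE : measurable_fun setT hE.
  apply/measurable_EFinP; apply: measurable_funM => //.
  apply: (@measurable_normc2 _ _ _ (fun p : borel S * borel S => k p.2 p.1)).
  exact: kernel_comp_meas.
have hD0 p : (0 <= hD p)%E by rewrite lee_fin mulr_ge0// mulr_ge0 ?indic_ge0.
have hE0 p : (0 <= hE p)%E by rewrite lee_fin mulr_ge0 ?sqr_ge0// mulr_ge0 ?indic_ge0.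
have mFD := measurable_section_integral m_sf mhD hD0.
have mFE := measurable_section_integral m_sf mhE hE0.
have -> : (\int[m]_x (\1_A x * kernel_mass m k A x)%:E =
    \int[m]_y \int[m]_x hE (y, x))%E.
  apply: ge0_ae_eq_integral => //.
  - apply/measurable_EFinP; apply: measurable_funM; first exact: measurable_indic.
    exact: (kernel_mass_meas m_sf k_kernel).
  - by move=> x _; rewrite lee_fin mulr_ge0 ?indic_ge0 ?kernel_mass_ge0.
  - by move=> x _; exact: integral_ge0.
  apply: filterS (kernel_ae k_kernel) => y Sy _.
  rewrite EFinM (kernel_massE K_proj k_kernel mA Sy) -ge0_integralZl_EFin//; last 2 first.
  - by move=> x _; rewrite lee_fin mulr_ge0 ?indic_ge0 ?sqr_ge0.
  - apply/measurable_EFinP; apply: measurable_funM; first exact: measurable_indic.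
    by apply: measurable_normc2; exact: (kernel_section_meas k_kernel).
  by apply: eq_integral => x _; rewrite /hE /= -EFinM mulrCA mulrA.
transitivity (\int[m]_y (\int[m]_x hD (y, x) + \int[m]_x hE (y, x)))%E.
  by rewrite [RHS]ge0_integralD// => y _; apply: integral_ge0 => x _.
have t00 : 0 <= t0 by rewrite -lee_fin -qt; apply: integral_ge0 => x _; rewrite lee_fin.
transitivity (\int[m]_y (t0%:E * (q y)%:E))%E; last first.
  rewrite ge0_integralZl_EFin//.
  - by rewrite qt -EFinM.
  - by move=> y _; rewrite lee_fin.
  - exact/measurable_EFinP.
apply: ge0_ae_eq_integral.
- exact: measurableT.
- exact: emeasurable_funD.
- by apply: emeasurable_funM; [exact: measurable_cst|exact/measurable_EFinP].
- by move=> y _; apply: adde_ge0; apply: integral_ge0 => x _.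
- by move=> y _; rewrite mule_ge0 ?lee_fin.
apply: filterS (kernel_ae k_kernel) => y Sy _.
have mDy : measurable_fun setT (fun x => hD (y, x)).
  exact: measurableT_comp mhD (pair1_measurable y).
have mEy : measurable_fun setT (fun x => hE (y, x)).
  exact: measurableT_comp mhE (pair1_measurable y).
transitivity (\int[m]_x (hD (y, x) + hE (y, x)))%E.
  by rewrite [RHS]ge0_integralD.
transitivity (\int[m]_x ((q y)%:E * (q x)%:E))%E; last first.
  rewrite ge0_integralZl_EFin//.
  - by rewrite qt muleC.
  - by move=> x _; rewrite lee_fin.
  - exact/measurable_EFinP.
apply: ge0_ae_eq_integral.
- exact: measurableT.
- exact: emeasurable_funD.
- by apply: emeasurable_funM; [exact: measurable_cst|exact/measurable_EFinP].
- by move=> x _; apply: adde_ge0.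
- by move=> x _; rewrite mule_ge0 ?lee_fin.
apply: filterS (kernel_ae k_kernel) => x Sx _.
rewrite /hD /hE /= -EFinD -EFinM; congr EFin.
rewrite (ger0_norm (dt0 _ _ Sx Sy)) (dtE _ _ Sx Sy) /q.
by rewrite (ger0_norm (kpos _ Sx)) (ger0_norm (kpos _ Sy)); ring.
Qed.

End Moments.

(** * Variance of the number of points *)

Section Variance.
Context (R : realType) (S : completeMetricType R).
Variables (S_sep : separable_space S) (S_lc : locally_compact [set: S]).
Variable m : {measure set (borel S) -> \bar R}.
Variable m_sf : sigma_finite [set: borel S] m.
Variables (L : set (borel S -> R[i])).
Variables (K : (borel S -> R[i]) -> (borel S -> R[i])).
Variables (k : borel S -> borel S -> R[i]) (S0 : set (borel S)).
Hypotheses (K_proj : orthogonal_projection m L K)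
  (k_kernel : reproducing_kernel m L K k S0).
Variable P : probability (config_space S) R.
Hypothesis P_det : determinantal m_sf k P.
Variable A : set (borel S).
Hypotheses (mA : measurable A) (pA : precompact (A : set S)).
Variable s : spectral_data m K A.
Hypothesis M_trace : trace_class m (compression K A).
Local Notation X := (number_of_points A).
Local Notation tr := (kernel_traceR m k A).
Local Notation V := (kernel_var m k A).
Local Notation Ri u := (P.-integrable [set: config_space S] (EFin \o u)).

Let mX := measurable_number_of_points mA.

Lemma kernel_mass_insideE :
  (\int[m]_x (\1_A x * kernel_mass m k A x)%:E = (tr - V)%:E)%E.
Proof.
have [Fi Ft] := kernel_mass_integrable m_sf K_proj k_kernel mA s M_trace.
have Ai := indic_integrable mA Fi; have Bi := indic_integrable (measurableC mA) Fi.
have [Di DE] := Rintegrable_sub Fi Bi.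
rewrite -Ft /kernel_var -DE /Rintegral fineK; last exact: integrable_fin_num.
apply: eq_integral => x _; congr (_%:E); rewrite !indicE in_setC.
by case: (x \in A); rewrite /= ?mul1r ?mul0r ?subr0 ?subrr.
Qed.

Lemma number_of_points_integrable : Ri X /\ (\int[P]_xi X xi)%R = tr.
Proof.
have E := moment1 S_sep S_lc k_kernel P_det mA pA.
rewrite (kernel_traceE m_sf K_proj k_kernel mA s M_trace) in E.
split; last by rewrite /Rintegral E.
apply: Rintegrable_ge0 => //; last by rewrite E ltry.
by move=> xi; exact: number_of_points_ge0.
Qed.

Lemma expectation_number : ('E_P[X] = tr%:E)%E.
Proof.
rewrite unlock (moment1 S_sep S_lc k_kernel P_det mA pA).
exact: (kernel_traceE m_sf K_proj k_kernel mA s M_trace).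
Qed.

Lemma falling_integrable : Ri (fun xi => X xi * (X xi - 1)) /\
  (\int[P]_xi (X xi * (X xi - 1)))%R = tr ^+ 2 - (tr - V).
Proof.
have FP := config_ae_filter P.
have mX2 : measurable_fun setT (fun xi => X xi * (X xi - 1)).
  by apply: measurable_funM => //; apply: measurable_funB.
have := moment2 S_sep S_lc K_proj k_kernel P_det mA pA
  (kernel_traceE m_sf K_proj k_kernel mA s M_trace).
rewrite kernel_mass_insideE => H.
have E : (\int[P]_xi (X xi * (X xi - 1))%:E = (tr ^+ 2 - (tr - V))%:E)%E.
  (* An infinite factorial moment would make the left side infinite while the right side is finite,
     so the sum can be solved for it. *)
  move: H; case: (\int[P]_xi _)%E => // r; rewrite -EFinD => -[<-].
  by rewrite addrK.
split; last by rewrite /Rintegral E.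
apply/integrableP; split; first exact/measurable_EFinP.
rewrite (@ae_eq_integral _ _ _ P setT (fun xi => (X xi * (X xi - 1))%:E))//.
- by rewrite E ltry.
- by apply/measurable_EFinP; exact: measurableT_comp.
- exact/measurable_EFinP.
apply: filterS (simple_count S_sep S_lc P_det mA pA) => xi [l [_ _ Xl]] _ /=.
rewrite ger0_norm// Xl; case: (size l) => [|n]; first by rewrite mul0r.
by rewrite mulr_ge0// subr_ge0 ler1n.
Qed.

Lemma variance_number : ('V_P[X] = V%:E)%E.
Proof.
have [Xi XE] := number_of_points_integrable.
have [Yi YE] := falling_integrable.
have [Zi ZE] := Rintegrable_scale (1 - 2 * tr) Xi.
have [YZi YZE] := Rintegrable_add Yi Zi.
have ci : Ri (fun=> tr ^+ 2).
  exact: (finite_measure_integrable_cst P (tr ^+ 2)).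
have [Wi WE] := Rintegrable_add YZi ci.
rewrite /variance unlock expectation_number /= unlock.
(* The centred square is expanded on the factorial moment; with [t = tr], integration gives
   [(t^2 - t + V) + (1 - 2 t) t + t^2 = V]. *)
rewrite (eq_integral (EFin \o (fun xi =>
  X xi * (X xi - 1) + (1 - 2 * tr) * X xi + tr ^+ 2))); last first.
  move=> xi _; change (((X xi - tr) * (X xi - tr))%:E =
    (X xi * (X xi - 1) + (1 - 2 * tr) * X xi + tr ^+ 2)%:E).
  by congr EFin; ring.
rewrite -(fineK (integrable_fin_num measurableT Wi)).
congr (_%:E); rewrite -/(Rintegral P setT _) WE YZE ZE YE XE.
rewrite Rintegral_cst// (_ : fine _ = 1); first by ring.
by have /= -> := probability_setT P.
Qed.

End Variance.

(** * Passage to the limit along the exhaustion *)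

Theorem theorem1p2 (R : realType) (S : completeMetricType R)
  (S_separable : separable_space S) (S_lc : locally_compact [set: S])
  (lambda : {measure set (borel S) -> \bar R}) (lambda_radon : radon lambda)
  (L : set (borel S -> R[i]))
  (K : (borel S -> R[i]) -> (borel S -> R[i]))
  (K_proj : orthogonal_projection lambda L K)
  (K_ltc : locally_trace_class lambda K)
  (k : borel S -> borel S -> R[i]) (S0 : set (borel S))
  (k_kernel : reproducing_kernel lambda L K k S0)
  (Lam : nat -> set (borel S)) (Lam_exh : exhaustion Lam)
  (P : probability (config_space S) R)
  (P_det : determinantal
             (radon_sigma_finite S_separable S_lc lambda_radon) k P)
  (P_hyp : hyperuniform P Lam)
  (s : forall n, spectral_data lambda K (Lam n)) :
  (((upper_trace lambda K (Lam n))%:R^-1)%:E *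
     \int[lambda]_x
       (normc
          ((acc_spectrogram k (s n) x)%:C
             - k x x * (\1_(Lam n) x)%:C))%:E
   @[n --> \oo] --> 0)%E.
Proof.
set sf := radon_sigma_finite S_separable S_lc lambda_radon in P_det *.
have [mLam pLam _ _] := Lam_exh; have [Eoo Vo] := P_hyp.
have M_trace n : trace_class lambda (compression K (Lam n)).
  by apply: K_ltc => //; exact: precompact_bounded.
pose t n := kernel_traceR lambda k (Lam n).
pose v n := kernel_var lambda k (Lam n).
have Et n : ('E_P[number_of_points (Lam n)] = (t n)%:E)%E.
  exact: (expectation_number S_separable S_lc K_proj k_kernel P_det (mLam n) (pLam n)
    (s n) (M_trace n)).
have Vv n : ('V_P[number_of_points (Lam n)] = (v n)%:E)%E.
  exact: (variance_number S_separable S_lc K_proj k_kernel P_det (mLam n) (pLam n)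
    (s n) (M_trace n)).
have too : t n @[n --> \oo] --> +oo%R.
  by apply/cvgeryP; move: Eoo; under eq_fun do rewrite Et.
have vt0 : v n * (t n)^-1 @[n --> \oo] --> 0.
  apply: (@fine_cvg _ _ _ _ (fun n => (v n * (t n)^-1)%:E)).
  by move: Vo; under eq_fun do rewrite Vv Et /= -EFinM.
have t0 : \forall n \near \oo, 0 < t n by apply: (cvgry_gt too).
have ti0 : (t n)^-1 @[n --> \oo] --> 0.
  by apply/gtr0_cvgV0.
(* This is the estimate [1 + 4 V] divided by the trace, which may replace the larger [upper_trace];
   the first term vanishes as the expectation diverges, the second by the variance ratio. *)
have b0 : ((t n)^-1 + 4 * (v n * (t n)^-1))%:E @[n --> \oo] --> 0%E.
  apply: cvg_EFin; first exact: nearW.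
  rewrite [X in _ --> X](_ : 0 = 0 + 4 * 0); last by rewrite mulr0 addr0.
  by apply: cvgD => //; apply: cvgMr.
apply: (@squeeze_cvge _ _ _ _ (fun=> 0%E) _
  (fun n => ((t n)^-1 + 4 * (v n * (t n)^-1))%:E)) => //.
  near=> n.
  have tn : 0 < t n by near: n.
  apply/andP; split.
    apply: mule_ge0; first by rewrite lee_fin invr_ge0.
    by apply: integral_ge0 => x _; rewrite lee_fin normc_ge0.
  have tN := le_rank sf K_proj k_kernel (mLam n) (s n) (M_trace n).
  have est := spectrogram_estimate sf K_proj k_kernel (mLam n) (s n) (M_trace n).
  have v0 : 0 <= v n by exact: kernel_var_ge0.
  apply: (@le_trans _ _ (((t n)^-1)%:E * (1 + 4 * v n)%:E)%E).
    apply: lee_pmul.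
    - by rewrite lee_fin invr_ge0.
    - by apply: integral_ge0 => x _; rewrite lee_fin normc_ge0.
    - by rewrite lee_fin lef_pV2 ?posrE// (lt_le_trans tn).
    - exact: est.
  by rewrite -EFinM lee_fin mulrDr mulr1 mulrCA [_^-1 * _]mulrC.
exact: cvg_cst.
Unshelve. all: by end_near. Qed.
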